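(* Let $L\ge\alpha>0$ and let $f:\mathbb{R}^d\to\mathbb{R}$ be $(\alpha,L)$-nearly convex with global minimizer $x^*$ and $f^*:=f(x^* )$. Suppose there is a constant $r\ge 0$ such that the stochastic gradient oracle $\mathrm{SG}$ satisfies $\mathbb{E}[\mathrm{SG}(x)]=\nabla f(x)$ and $\mathbb{E}[\|\mathrm{SG}(x)-\nabla f(x)\|^2]\le r^2$ for every $x\in\mathbb{R}^d$. Let $\eta=\frac{2\alpha}{5L^2}$, $\lambda=2\alpha-\eta L^2>0$, $s=\frac{\lambda}{3L}$, let $f_{\mathrm{lb}}\le f^*$ be any lower bound of $f$, and let $$b=\frac{\eta r^2}{2\alpha-\eta L^2}+\frac{5\eta(2\alpha-\eta L^2)+14}{42L}\,(f^*-f_{\mathrm{lb}})\ \ge 0 .$$ Let $x_0\in\mathbb{R}^d$, let $\{x_t\}_{0\le t\le T}$ be the sequence generated by the Gaussian noise descent (GND) algorithm with inputs $x_0,\mathrm{SG},\eta,s,f_{\mathrm{lb}},T$, let $t_*$ be the output index of the algorithm, and define $y_t:=x_t-\eta\nabla f(x_t)$ for $t=0,1,\dots,T$. Then $$\mathbb{E}\big[\|y_t-x^*\|^2\big]\le\Big(1-\frac{\eta\lambda}{100}\Big)^t\|y_0-x^*\|^2+100b\qquad\forall\, t\in\{0,1,\dots,T\}.$$ Moreover, the following hold. (a) If $b=0$, then for any $\varepsilon>0$ and $\zeta\in(0,1)$ one has $\|y_T-x^*\|^2\le\varepsilon$ with probability at least $1-\zeta$, provided that $$T\ge\frac{100}{\eta(2\alpha-\eta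 L^2)}\ln\frac{\|y_0-x^*\|^2}{\zeta\varepsilon}.$$ (b) If $b>0$, then for any $\zeta\in(0,1)$, provided that $$T\ge\frac{200}{\eta(2\alpha-\eta L^2)}\ln\frac{\|y_0-x^*\|^2}{100b\zeta},$$ with probability at least $1-\zeta$ there exists some $t\le T$ satisfying $\|y_t-x^*\|^2\le 200b$. Moreover, letting $\beta:=\beta(f,x^*,\alpha)<\alpha$, one has with probability at least $1-\zeta$ that $$f(x_{t_*})-f^*\le\frac{100Lb}{(1-\eta L)^2},\qquad \|x_{t_*}-x^*\|^2\le\frac{200Lb}{(1-\eta L)^2(\alpha-\beta)},\qquad \|y_{t_*}-x^*\|^2\le\Big(\frac{1+\eta L}{1-\eta L}\Big)^2\frac{200Lb}{\alpha-\beta}.$$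
   Context: Norms are Euclidean. For $\alpha>0$, $\bar x\in\mathbb{R}^d$, $c\in\mathbb{R}$, the set of one-point strongly convex functions is $$\mathcal{P}_\alpha(\bar x,c)=\{\bar f\in C^1(\mathbb{R}^d)\mid \bar f(\bar x)=c,\ \langle\nabla\bar f(x),x-\bar x\rangle\ge\alpha\|x-\bar x\|^2\ \ \forall x\in\mathbb{R}^d\}.$$ For $f\in C^1(\mathbb{R}^d)$, $$\beta(f,\bar x,\alpha):=\inf_{\bar f\in\mathcal{P}_\alpha(\bar x,f(\bar x))}\ \sup_{x\ne\bar x}\frac{2|f(x)-\bar f(x)|}{\|x-\bar x\|^2}.$$ For $L\ge\alpha>0$, a continuously differentiable $f:\mathbb{R}^d\to\mathbb{R}$ is $(\alpha,L)$-nearly convex if (i) $f$ has a unique global minimizer $x^*$; (ii) $\|\nabla f(x)\|\le L\|x-x^*\|$ for all $x\in\mathbb{R}^d$; (iii) $\beta(f,x^*,\alpha)\le\frac14\sqrt{\frac{\alpha^5}{dL^3}}$. The GND algorithm, with inputs an initial point $x_0\in\mathbb{R}^d$, a stochastic gradient oracle $\mathrm{SG}$ (for each $x$, $\mathrm{SG}(x)$ is a random vector in $\mathbb{R}^d$), a step size $\eta>0$, a noise factor $s>0$, a number $f_{\mathrm{lb}}$, and a number of iterations $T$, computes for $t=0,\dots,T-1$: $$x_{t+\frac12}=x_t-\eta\,\mathrm{SG}(x_t),\qquad \sigma_t=\sqrt{\eta s\,\big(f(x_{t+\frac12})-f_{\mathrm{lb}}\big)^+},\qquad x_{t+1}=x_{t+\frac12}-\sigma_t\xi_t,\quad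 \xi_t\sim\mathcal{N}(0,\tfrac1d I_d),$$ where $(a)^+=\max\{a,0\}$. It outputs $x_{t_*}$, where $t_*$ is the smallest index in $\operatorname{argmin}_{0\le t\le T}f(x_t)$. Each oracle call uses fresh randomness independent of the past, so that, conditionally on all randomness generated before step $t$, $\mathrm{SG}(x_t)$ has mean $\nabla f(x_t)$ and $\mathbb{E}\|\mathrm{SG}(x_t)-\nabla f(x_t)\|^2\le r^2$; each $\xi_t$ is independent of everything generated before it (including $\mathrm{SG}(x_t)$). *)

(* Defs.v *)
From HB Require Import structures.
From mathcomp Require Import all_boot all_order all_algebra.
From mathcomp Require Import all_classical all_reals all_analysis.

Set Implicit Arguments.
Unset Strict Implicit.
Unset Printing Implicit Defensive.

Import Order.TTheory GRing.Theory Num.Theory.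
Import numFieldNormedType.Exports.

Local Open Scope classical_set_scope.
Local Open Scope ring_scope.

(* The product sigma-algebra on matrices, generated by the coordinate maps (the
   analogue of the library's structure on tuples). On 'rV[R]_d it is the Borel
   sigma-algebra. *)
Definition measure_matrix_display : measure_display -> measure_display.
Proof. exact. Qed.

Section measurable_matrix.
Context {disp : measure_display} {T : measurableType disp} (m n : nat).

Definition matrix_cylinders : set (set 'M[T]_(m, n)) :=
  \bigcup_(ij in [set: 'I_m * 'I_n])
    preimage_set_system setT (fun M : 'M[T]_(m, n) => M ij.1 ij.2) measurable.

Let matrix_set0 : <<s matrix_cylinders >> set0.
Proof. exact: sigma_algebra0. Qed.

Let matrix_setC A :
  <<s matrix_cylinders >> A -> <<s matrix_cylinders >> (~` A).
Proof. exact: sigma_algebraC. Qed.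

Let matrix_bigcup (F : (set 'M[T]_(m, n))^nat) :
  (forall i, <<s matrix_cylinders >> (F i)) ->
  <<s matrix_cylinders >> (\bigcup_i F i).
Proof. exact: sigma_algebra_bigcup. Qed.

HB.instance Definition _ := @isMeasurable.Build (measure_matrix_display disp)
  'M[T]_(m, n) <<s matrix_cylinders >> matrix_set0 matrix_setC matrix_bigcup.

End measurable_matrix.

Section euclidean_calculus.
Context {R : realType} {d : nat}.
Implicit Types (x v w : 'rV[R]_d) (f : 'rV[R]_d -> R).

Definition dotv v w : R := \sum_(i < d) v 0 i * w 0 i.

(* The library norm `|x| on 'rV[R]_d is the sup norm; this is the Euclidean one. *)
Definition enorm x : R := Num.sqrt (dotv x x).

Definition grad f x : 'rV[R]_d := \row_(i < d) 'D_(delta_mx 0 i) f x.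

Definition C1 f : Prop :=
  (forall x, differentiable f x) /\ continuous (grad f).

Definition global_minimizer f x : Prop := forall z, f x <= f z.

Definition one_point_strongly_convex (alpha : R) (xbar : 'rV[R]_d) (c : R) :
    set ('rV[R]_d -> R) :=
  [set fbar | [/\ C1 fbar, fbar xbar = c &
     forall x, alpha * enorm (x - xbar) ^+ 2 <= dotv (grad fbar x) (x - xbar)]].

(* Extended-real valued: +oo is possible before any assumption on f. *)
Definition sc_deviation f (xbar : 'rV[R]_d) (alpha : R) : \bar R :=
  ereal_inf [set ereal_sup [set (2 * `|f x - fbar x| / enorm (x - xbar) ^+ 2)%:E
                            | x in [set x | x != xbar]]
            | fbar in one_point_strongly_convex alpha xbar (f xbar)].

Definition nearly_convex (alpha L : R) f : Prop :=
  C1 f /\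
  exists xstar : 'rV[R]_d,
    [/\ global_minimizer f xstar /\ (forall z, global_minimizer f z -> z = xstar),
        forall x, enorm (grad f x) <= L * enorm (x - xstar) &
        (sc_deviation f xstar alpha <=
           (4^-1 * Num.sqrt (alpha ^+ 5 / (d%:R * L ^+ 3)))%:E)%E].

End euclidean_calculus.

Section stochastic_oracle.
Context {R : realType} {d : nat} {dS : measure_display} {S : measurableType dS}.

(* The oracle is represented by SG : 'rV_d -> S -> 'rV_d together with the law mu
   of the seed: SG(x) is the random vector s |-> SG x s on (S, mu). A fresh call
   is an evaluation at a fresh seed. Joint measurability ensures that SG(x_t) is a
   random vector when x_t is one. *)
Definition unbiased_oracle (mu : probability S R)
    (SG : 'rV[R]_d -> S -> 'rV[R]_d) (f : 'rV[R]_d -> R) (r : R) : Prop :=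
  [/\ measurable_fun setT (fun p : 'rV[R]_d * S => SG p.1 p.2),
      forall x i, mu.-integrable setT (fun s => (SG x s 0%R i)%:E) /\
        ('E_mu[fun s => (SG x s 0 i)%R] = (grad f x 0%R i)%:E)%E &
      forall x,
        ('E_mu[fun s => (enorm (SG x s - grad f x) ^+ 2)%R] <= (r ^+ 2)%:E)%E].

Section gnd.
Variables (f : 'rV[R]_d -> R) (SG : 'rV[R]_d -> S -> 'rV[R]_d).
Variables (eta s flb : R) (x0 : 'rV[R]_d).

(* One realization of the iterates, driven by the seeds u and the vectors xi. *)
Fixpoint gnd (u : nat -> S) (xi : nat -> 'rV[R]_d) (t : nat) : 'rV[R]_d :=
  if t is k.+1 then
    let x := gnd u xi k in
    let xhalf := x - eta *: SG x (u k) in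
    let sigma := Num.sqrt (eta * s * Num.max (f xhalf - flb) 0) in
    xhalf - sigma *: xi k
  else x0.

End gnd.

End stochastic_oracle.

(* Smallest index in argmin_{0 <= t <= T} v t. *)
Definition first_argmin {R : realType} (v : nat -> R) (T : nat) : nat :=
  find (fun t => all (fun k => v t <= v k) (iota 0 T.+1)) (iota 0 T.+1).

Section randomness.
Context {R : realType} {dO : measure_display} {Omega : measurableType dO}.
Variable P : probability Omega R.

Definition has_law {dS : measure_display} {S : measurableType dS}
    (X : Omega -> S) (mu : probability S R) : Prop :=
  measurable_fun setT X /\
  forall A, measurable A -> P (X @^-1` A) = mu A.

(* X ~ N(0, v I_d): the coordinates are independent with law N(0, v);
   the second parameter of normal_prob is the standard deviation. *)
Definition isotropic_normal {d : nat} (X : Omega -> 'rV[R]_d) (v : R) : Prop :=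
  measurable_fun setT X /\
  forall A : 'I_d -> set R, (forall i, measurable (A i)) ->
    P [set w | forall i, A i (X w 0 i)] =
    (\prod_(i < d) normal_prob 0%R (Num.sqrt v) (A i))%E.

Definition independent_classes (F G : set (set Omega)) : Prop :=
  forall A B, F A -> G B -> P (A `&` B) = (P A * P B)%E.

Section gnd_randomness.
Context {d : nat} {dS : measure_display} {S : measurableType dS}.
Variables (u : nat -> Omega -> S) (xi : nat -> Omega -> 'rV[R]_d).

(* All events determined by the randomness generated before step t. *)
Definition past (t : nat) : set (set Omega) :=
  <<s \bigcup_(k in `I_t) (preimage_set_system setT (u k) measurable `|`
                           preimage_set_system setT (xi k) measurable) >>.

(* The same, including the oracle call of step t. *)
Definition past_half (t : nat) : set (set Omega) :=
  <<s past t `|` preimage_set_system setT (u t) measurable >>.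

Definition gnd_randomness (mu : probability S R) (T : nat) : Prop :=
  forall t, (t < T)%N ->
    [/\ has_law (u t) mu,
        isotropic_normal (xi t) d%:R^-1,
        independent_classes (preimage_set_system setT (u t) measurable) (past t) &
        independent_classes (preimage_set_system setT (xi t) measurable)
                            (past_half t)].

End gnd_randomness.
End randomness.

(* Main.v *)
Require Import Defs.
From HB Require Import structures.
From mathcomp Require Import all_boot all_order all_algebra.
From mathcomp Require Import all_classical all_reals all_analysis.
From mathcomp Require Import measurable_realfun.
From mathcomp Require Import ring lra.

Set Implicit Arguments.
Unset Strict Implicit.
Unset Printing Implicit Defensive.

Import Order.TTheory GRing.Theory Num.Theory.
Import numFieldNormedType.Exports.

Local Open Scope classical_set_scope.
Local Open Scope ring_scope.

(** The quantity that decreases is the squared distance from the minimizer after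
    an exact gradient step, [V x = enorm (x - eta *: grad f x - xstar) ^+ 2]. It is
    shown to contract in conditional mean by the factor [1 - eta * lambda / 100], up
    to an additive error, and all the assertions follow from that.

    Expanding the square and using [enorm (grad f x) <= L * enorm (x - xstar)]
    bounds [V] at a point [xstar + z] by
    [(1 + eta ^+ 2 * L ^+ 2) * dotv z z - 2 * eta * dotv (grad f (xstar + z)) z].
    For a one-point strongly convex function the last inner product is at least
    [alpha * dotv z z]. Here [f] is only close in value to such a function [fbar],
    with no control on [grad f - grad fbar], and the inner product may be negative.
    The point of the Gaussian noise is that only the mean matters for
    [z = a - sigma *: X], where [X] is the noise. The inner product is the derivative
    at [h = 0] of [f (xstar + (1 + h) *: z)]. The increment of [fbar] is bounded below
    along the ray (ray_growth). The mean increment of [g = f - fbar], recentred at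
    [xstar], is the mean of [g z * (rho - 1)], where [rho] is the likelihood ratio
    between the laws of [(1 + h) *: z] and of [z] (integral_rescaling). Since
    [g] is at most [delta / 2 * dotv z z] in absolute value, the
    arithmetic-geometric inequality and the closed form of the mean of [rho ^+ 2]
    (integral_rescaling_ratio_dev) bound this mean by a multiple of [h]. Dividing by
    [h] and letting [h] tend to 0 gives integral_grad_perturbed_ge: the mean of the
    inner product is at least [alpha] times the mean of [dotv z z], minus
    [delta / 2 * sqrt (d * (2 + dotv a a / sigma ^+ 2)) * (dotv a a + 3 * sigma ^+ 2)].

    This error is large when [sigma] is small compared with the distance to the
    minimizer, but [sigma ^+ 2] is proportional to [f xh - flb] at the half iterate
    [xh], which is at least of the order of the squared distance by quadratic_lower.
    The threshold on the deviation is such that the error leaves a fraction of the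
    contraction (step_arithmetic, noisy_step), at the price of a multiple of
    [f xstar - flb]. Averaging over the oracle adds [eta ^+ 2 * r ^+ 2] because it is
    unbiased (oracle_step). By independence the past may be frozen in these two
    averages (integral_resample), which gives the drift inequality on every event of
    the past (conditional_step).

    Iterating the drift on the whole space bounds the expectations, and Markov's
    inequality gives the case [b = 0]. For [b > 0], as long as [V] stays above
    [200 * b] the additive error is at most half of the contraction, so on the event
    that this has been the case so far [V] decays at half the rate in mean, and
    Markov's inequality shows that the event is unlikely to persist (drift_hitting).
    Finally the output iterate has a function value no larger than that of the
    iterate at the hitting time, and the quadratic bounds above and below convert
    this into the stated accuracy (accuracy_of_lower_value). *)

(** * Euclidean geometry *)

Lemma le_of_sqr_le (R : realType) (x y : R) : 0 <= y -> x ^+ 2 <= y ^+ 2 -> x <= y.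
Proof.
move=> y0; rewrite leNgt => h; rewrite leNgt; apply: contra h => yx.
by rewrite !expr2 ltr_pM.
Qed.

Section euclid.
Context {R : realType} {d : nat}.
Implicit Types (v w x : 'rV[R]_d) (k : R).

Lemma dotvC v w : dotv v w = dotv w v.
Proof. by apply: eq_bigr => i _; rewrite mulrC. Qed.

Lemma dotvDl v w x : dotv (v + w) x = dotv v x + dotv w x.
Proof. by rewrite -big_split; apply: eq_bigr => i _; rewrite mxE mulrDl. Qed.

Lemma dotvZl k v w : dotv (k *: v) w = k * dotv v w.
Proof. by rewrite mulr_sumr; apply: eq_bigr => i _; rewrite mxE mulrA. Qed.

Lemma dotvNl v w : dotv (- v) w = - dotv v w.
Proof. by rewrite -scaleN1r dotvZl mulN1r. Qed.

Lemma dotvDr v w x : dotv x (v + w) = dotv x v + dotv x w.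
Proof. by rewrite dotvC dotvDl !(dotvC x). Qed.

Lemma dotvZr k v w : dotv w (k *: v) = k * dotv w v.
Proof. by rewrite dotvC dotvZl dotvC. Qed.

Lemma dotvNr v w : dotv w (- v) = - dotv w v.
Proof. by rewrite dotvC dotvNl dotvC. Qed.

Definition dotvE := (dotvDl, dotvDr, dotvNl, dotvNr, dotvZl, dotvZr).

Lemma dotvv_ge0 v : 0 <= dotv v v.
Proof. by apply: sumr_ge0 => i _; rewrite -expr2 sqr_ge0. Qed.

Lemma dotvv_eq0 v : dotv v v = 0 -> v = 0.
Proof.
move/eqP; rewrite psumr_eq0 => [|i _]; last by rewrite -expr2 sqr_ge0.
move=> /allP h; apply/rowP => i; rewrite mxE.
by have := h i (mem_index_enum i); rewrite mulf_eq0 orbb => /eqP.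
Qed.

Lemma enorm_sqr v : enorm v ^+ 2 = dotv v v.
Proof. by rewrite sqr_sqrtr // dotvv_ge0. Qed.

Lemma enorm_ge0 v : 0 <= enorm v.
Proof. exact: sqrtr_ge0. Qed.

Lemma dotv_young k v w : 2 * k * dotv v w <= dotv v v + k ^+ 2 * dotv w w.
Proof.
have := dotvv_ge0 (v - k *: w); rewrite !dotvE (dotvC w v); nra.
Qed.

Lemma cauchy_schwarz v w : dotv v w ^+ 2 <= dotv v v * dotv w w.
Proof.
have [w0|w0] := eqVneq (dotv w w) 0.
  by rewrite (dotvv_eq0 w0) -(scale0r w) !dotvZr !mul0r mulr0 expr0n.
have wp : 0 < dotv w w by rewrite lt_neqAle eq_sym w0 dotvv_ge0.
have := dotv_young (dotv v w / dotv w w) v w.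
set p := dotv v w; set W := dotv w w in wp w0 *.
rewrite -(ler_pM2r wp) (_ : 2 * (p / W) * p * W = 2 * p ^+ 2); last by field.
rewrite (_ : (_ + (p / W) ^+ 2 * W) * W = dotv v v * W + p ^+ 2); first by lra.
by field.
Qed.

Lemma ler_dotv v w : `|dotv v w| <= enorm v * enorm w.
Proof.
rewrite -(@ler_pXn2r _ 2) ?nnegrE ?mulr_ge0 ?enorm_ge0 //.
by rewrite exprMn !enorm_sqr real_normK ?num_real // cauchy_schwarz.
Qed.

Lemma ler_enormD v w : enorm (v + w) <= enorm v + enorm w.
Proof.
rewrite -(@ler_pXn2r _ 2) ?nnegrE ?addr_ge0 ?enorm_ge0 //.
rewrite sqrrD !enorm_sqr !dotvE (dotvC w v).
have := ler_norm (dotv v w); have := ler_dotv v w; lra.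
Qed.

Lemma enormZ k v : enorm (k *: v) = `|k| * enorm v.
Proof. by rewrite /enorm !dotvE mulrA -expr2 sqrtrM ?sqr_ge0 // sqrtr_sqr. Qed.

Lemma enormN v : enorm (- v) = enorm v.
Proof. by rewrite -scaleN1r enormZ normrN1 mul1r. Qed.

Lemma enorm0 : enorm (0 : 'rV[R]_d) = 0.
Proof. by rewrite -(scale0r 0) enormZ normr0 mul0r. Qed.

Lemma enorm_eq0 v : enorm v = 0 -> v = 0.
Proof. by move=> h; apply: dotvv_eq0; rewrite -enorm_sqr h expr0n. Qed.

End euclid.

(** * Functions along rays *)

Section rays.
Context {R : realType} {d : nat}.
Implicit Types (f : 'rV[R]_d -> R) (a v x : 'rV[R]_d).

Lemma derive_grad f x v : differentiable f x -> 'D_v f x = dotv (grad f x) v.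
Proof.
move=> df; rewrite deriveE // {1}(row_sum_delta v) linear_sum.
apply: eq_bigr => i _; rewrite linearZ mxE /= -deriveE //.
by rewrite mulrC.
Qed.

Lemma is_derive_ray f a v (t : R) : (forall x, differentiable f x) ->
  is_derive t 1 (fun u : R => f (a + u *: v)) (dotv (grad f (a + t *: v)) v).
Proof.
move=> df; have dv := @diff_derivable _ _ _ f (a + t *: v) v (df _).
(* both difference quotients are the same function *)
have E : (fun h : R => h^-1 *: (f (a + (h *: (1 : R) + t) *: v) - f (a + t *: v)))
    = (fun h : R => h^-1 *: (f (h *: v + (a + t *: v)) - f (a + t *: v))).
  apply/funext => h; congr (_ *: (f _ - _)).
  by rewrite scalerDl [h *: 1]mulr1 addrCA.
apply: DeriveDef; first by rewrite /derivable E.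
by rewrite -derive_grad // /derive E.
Qed.

(** By the mean value theorem, [f] minus the quadratic is nondecreasing along the
    ray. *)
Lemma ray_growth f a v (c : R) : (forall x, differentiable f x) ->
  (forall x, c * enorm (x - a) ^+ 2 <= dotv (grad f x) (x - a)) ->
  forall s t : R, 0 <= s -> s <= t ->
    c / 2 * (t ^+ 2 - s ^+ 2) * enorm v ^+ 2 <= f (a + t *: v) - f (a + s *: v).
Proof.
move=> df hc s t s0 st.
pose h (u : R) := f (a + u *: v) - c / 2 * enorm v ^+ 2 * u ^+ 2.
have dh (u : R) : is_derive u 1 h
    (dotv (grad f (a + u *: v)) v - c / 2 * enorm v ^+ 2 * (2 * u)).
  apply: is_deriveB; first exact: is_derive_ray.
  by apply: is_derive_eq; rewrite /GRing.scale /=; ring.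
suff : h s <= h t by rewrite /h; lra.
have [->//|nst] := eqVneq s t.
have {nst}st : s < t by rewrite lt_neqAle nst.
rewrite -subr_ge0.
have [u /itvP uI ->] : exists2 u, u \in `]s, t[ & h t - h s =
    (dotv (grad f (a + u *: v)) v - c / 2 * enorm v ^+ 2 * (2 * u)) * (t - s).
  apply: MVT => // u; apply: derivable_within_continuous => z _.
  exact: ex_derive.
apply: mulr_ge0; last by rewrite subr_ge0 ltW.
have u0 : 0 < u by rewrite (le_lt_trans s0) // uI.
have := hc (a + u *: v); rewrite addrAC subrr add0r enormZ exprMn dotvZr.
rewrite real_normK ?num_real // => hu.
rewrite -(pmulr_rge0 _ u0); move: hu; lra.
Qed.

Lemma gradN f x : (forall x, differentiable f x) ->
  grad (fun z => - f z) x = - grad f x.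
Proof.
by move=> df; apply/rowP => i; rewrite !mxE deriveN //; exact: diff_derivable.
Qed.

Lemma ray_growth_le f a v (c : R) : (forall x, differentiable f x) ->
  (forall x, dotv (grad f x) (x - a) <= c * enorm (x - a) ^+ 2) ->
  forall s t : R, 0 <= s -> s <= t ->
    f (a + t *: v) - f (a + s *: v) <= c / 2 * (t ^+ 2 - s ^+ 2) * enorm v ^+ 2.
Proof.
move=> df hc s t s0 st.
have dN x : differentiable (fun z => - f z) x by apply: differentiableN.
have hN x : - c * enorm (x - a) ^+ 2 <= dotv (grad (fun z => - f z) x) (x - a).
  by rewrite gradN // dotvNl mulNr lerN2.
by have := ray_growth v dN hN s0 st; lra.
Qed.

End rays.

(** * Consequences of near convexity *)

Section near_convexity.
Context {R : realType} {d : nat}.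
Variables (f : 'rV[R]_d -> R) (xstar : 'rV[R]_d) (alpha : R).

(** The infimum defining the deviation may not be attained, so a one-point
    strongly convex approximation is only available for each radius strictly
    above it. *)
Lemma sc_deviation_witness (delta : R) :
  (sc_deviation f xstar alpha < delta%:E)%E ->
  exists2 fbar, one_point_strongly_convex alpha xstar (f xstar) fbar &
    forall x, `|f x - fbar x| <= delta / 2 * enorm (x - xstar) ^+ 2.
Proof.
case/ereal_inf_lt => _ [fbar hbar <-] hsup; exists fbar => // x.
have [->|xne] := eqVneq x xstar.
  by case: hbar => _ -> _; rewrite !subrr normr0 enorm0 expr0n mulr0.
have xp : 0 < enorm (x - xstar) ^+ 2.
  rewrite exprn_even_gt0 //=; apply: contra xne => /eqP /enorm_eq0 /eqP.
  by rewrite subr_eq0.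
have /le_lt_trans/(_ hsup) : ((2 * `|f x - fbar x| / enorm (x - xstar) ^+ 2)%:E <=
   ereal_sup [set (2 * `|f x - fbar x| / enorm (x - xstar) ^+ 2)%:E
      | x in [set x | x != xstar]])%E.
  by apply: ereal_sup_ubound; exists x.
by rewrite lte_fin ltr_pdivrMr //; lra.
Qed.

Lemma sc_deviation_fin_num (bnd : R) : (0 < d)%N ->
  (sc_deviation f xstar alpha <= bnd%:E)%E ->
  exists2 beta, sc_deviation f xstar alpha = beta%:E & beta <= bnd.
Proof.
move=> d0 hle.
have sc0 : (0 <= sc_deviation f xstar alpha)%E.
  apply: le_ereal_inf_tmp => _ [fbar _ <-].
  pose i0 := Ordinal d0; pose x := xstar + delta_mx 0 i0.
  have xne : x != xstar.
    rewrite -subr_eq0 addrAC subrr add0r; apply/eqP => /matrixP /(_ 0 i0).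
    by rewrite !mxE !eqxx => /eqP; rewrite oner_eq0.
  apply: le_ereal_sup_tmp; exists (2 * `|f x - fbar x| / enorm (x - xstar) ^+ 2)%:E.
    by exists x.
  rewrite lee_fin divr_ge0 ?exprn_ge0 ?enorm_ge0 //; exact: mulr_ge0.
case: (sc_deviation f xstar alpha) hle sc0 => // beta hle _.
by exists beta => //; rewrite -lee_fin.
Qed.

Lemma strongly_convex_radial (fbar : 'rV[R]_d -> R) v (s t : R) :
  one_point_strongly_convex alpha xstar (f xstar) fbar -> 0 <= s -> s <= t ->
  alpha / 2 * (t ^+ 2 - s ^+ 2) * enorm v ^+ 2 <=
    fbar (xstar + t *: v) - fbar (xstar + s *: v).
Proof. by case=> -[df _] _ hs s0 st; exact: ray_growth. Qed.

(** The approximating function grows at least like [alpha / 2] times the squared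
    distance, and [f] differs from it by at most [delta / 2] times that. *)
Lemma quadratic_lower (delta : R) x :
  (sc_deviation f xstar alpha < delta%:E)%E ->
  (alpha - delta) / 2 * enorm (x - xstar) ^+ 2 <= f x - f xstar.
Proof.
case/sc_deviation_witness => fbar hbar /(_ x).
have := strongly_convex_radial (x - xstar) hbar (lexx 0) ler01.
rewrite scale1r scale0r addr0 (addrC xstar) subrK; case: hbar => _ -> _.
have := ler_norm (fbar x - f x); rewrite distrC; lra.
Qed.

Lemma quadratic_upper (L : R) x : (forall x, differentiable f x) ->
  (forall x, enorm (grad f x) <= L * enorm (x - xstar)) ->
  f x - f xstar <= L / 2 * enorm (x - xstar) ^+ 2.
Proof.
move=> df hg.
have hle z : dotv (grad f z) (z - xstar) <= L * enorm (z - xstar) ^+ 2.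
  apply: le_trans (ler_norm _) _; apply: le_trans (ler_dotv _ _) _.
  by rewrite expr2 mulrA ler_wpM2r ?enorm_ge0.
have := ray_growth_le (x - xstar) df hle (lexx 0) ler01.
by rewrite scale1r scale0r addr0 (addrC xstar) subrK; lra.
Qed.

End near_convexity.

Lemma differentiable_continuousT {R : realType} {d : nat} (f : 'rV[R]_d -> R) :
  (forall x, differentiable f x) -> continuous f.
Proof. by move=> df x; exact: differentiable_continuous. Qed.

(** * Weighted laws *)

Section weighted_law.
Local Open Scope ereal_scope.
Context {R : realType} d1 d2 (T1 : measurableType d1) (T2 : measurableType d2).
Variables (m1 : {measure set T1 -> \bar R}) (w : T1 -> R) (X : T1 -> T2).
Hypotheses (mw : measurable_fun setT w) (w0 : forall x, (0 <= w x)%R).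
Hypothesis mX : measurable_fun setT X.

Import HBNNSimple.

Let mindicX (A : set T2) : measurable A ->
  measurable_fun setT (fun x => \1_A (X x) : R).
Proof. by move=> mA; apply: measurableT_comp => //; exact: measurable_indic. Qed.

(** It is enough to test the image under [X] of the measure of density [w] on
    indicators, by monotone approximation with simple functions. This common form
    serves for densities ([X] the identity), for affine changes of variables and
    for integrating out one coordinate of a random vector. *)
Lemma integral_weighted_law (m2 : {measure set T2 -> \bar R}) :
  (forall A, measurable A -> \int[m1]_x (\1_A (X x) * w x)%:E = m2 A) ->
  forall F : T2 -> \bar R, measurable_fun setT F -> (forall y, 0 <= F y) ->
    \int[m1]_x (F (X x) * (w x)%:E) = \int[m2]_y F y.
Proof.
move=> m12 F mF F0.
pose F_ := nnsfun_approx measurableT mF.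
have cvgF y : EFin \o F_ ^~ y @ \oo --> F y.
  by apply: cvg_nnsfun_approx => //.
transitivity (limn (fun n => \int[m2]_y (F_ n y)%:E)); last first.
  rewrite -monotone_convergence//.
  - by apply: eq_integral => y _; apply/cvg_lim => //; exact: cvgF.
  - by move=> n; exact/measurable_EFinP/measurable_funP.
  - by move=> n y _; rewrite lee_fin.
  - by move=> y _ m n mn; rewrite lee_fin; exact/lefP/nd_nnsfun_approx.
have -> : (fun n => \int[m2]_y (F_ n y)%:E) =
          (fun n => \int[m1]_x ((F_ n (X x))%:E * (w x)%:E)).
  apply/funext => n.
  under eq_integral do rewrite fimfunE -fsumEFin//.
  rewrite ge0_integral_fsum//; last 2 first.
  - by move=> r; exact/measurable_EFinP/measurable_funM.
  - by move=> r y _; rewrite nnfun_muleindic_ge0.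
  under [RHS]eq_integral => x _.
    rewrite fimfunE -fsumEFin// ge0_mule_fsuml; last first.
      by move=> r; rewrite EFinM nnfun_muleindic_ge0.
    over.
  rewrite ge0_integral_fsum//; last 2 first.
  - move=> r; apply/measurable_EFinP/measurable_funM => //.
    by apply: measurable_funM => //; exact: mindicX.
  - move=> r y _; apply: mule_ge0; last by rewrite lee_fin.
    by rewrite EFinM nnfun_muleindic_ge0.
  apply: eq_fsbigr => r rF.
  have r0 : (0 <= r)%R by case/set_mem: rF => t _ <-; exact: fun_ge0.
  rewrite integralZl_indic_nnsfun// integral_indic// setIT.
  under eq_integral do rewrite EFinM -muleA.
  rewrite ge0_integralZl//; last 2 first.
  - rewrite (_ : (fun x => _) = EFin \o (fun x => \1_(F_ n @^-1` [set r]) (X x) * w x)%R) //.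
    by apply/measurable_EFinP/measurable_funM => //; exact: mindicX.
  - by move=> y _; rewrite lee_fin mulr_ge0.
  by rewrite m12.
rewrite -monotone_convergence//.
- apply: eq_integral => x _; apply/esym/cvg_lim => //.
  by apply: cvgeZr => //; exact: cvgF.
- move=> n; apply: emeasurable_funM; last exact/measurable_EFinP.
  by apply/measurable_EFinP/measurableT_comp.
- by move=> n x _; rewrite mule_ge0 ?lee_fin.
- move=> x _ m n mn; rewrite lee_wpmul2r ?lee_fin//.
  exact/lefP/nd_nnsfun_approx.
Qed.

End weighted_law.

(** * Measurability of row vectors *)

Section measurable_rV.
Context {R : realType} {d : nat}.

Lemma measurable_coord (i : 'I_d) :
  measurable_fun setT (fun M : 'rV[R]_d => M 0 i).
Proof.
move=> _ A mA; apply: sub_sigma_algebra.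
by exists (0, i) => //; exists A.
Qed.

Lemma measurable_rV dT (T : measurableType dT) (g : T -> 'rV[R]_d) :
  (forall i, measurable_fun setT (fun t => g t 0 i)) -> measurable_fun setT g.
Proof.
move=> mg; apply: (@measurability _ _ _ _ setT g _ (erefl _)).
move=> _ [_ [[i0 i] _ [A mA <-]] <-] /=; rewrite !setTI ord1.
by have := mg i measurableT A mA; rewrite setTI.
Qed.

Lemma measurable_rVP dT (T : measurableType dT) (g : T -> 'rV[R]_d) :
  measurable_fun setT g <-> forall i, measurable_fun setT (fun t => g t 0 i).
Proof.
split=> [mg i|]; last exact: measurable_rV.
exact: measurableT_comp (measurable_coord i) mg.
Qed.

Let grid n (x : 'rV[R]_d) : 'rV[int]_d :=
  \row_i Num.floor (n.+1%:R * x 0 i).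
Let ungrid n (z : 'rV[int]_d) : 'rV[R]_d := \row_i ((z 0 i)%:~R / n.+1%:R).

Let measurable_grid n z : measurable [set x | grid n x = z].
Proof.
have -> : [set x | grid n x = z] =
    \big[setI/setT]_(i <- enum 'I_d) [set x : 'rV[R]_d | Num.floor (n.+1%:R * x 0 i) = z 0 i].
  apply/seteqP; split => x /=.
    move=> <-; rewrite -bigcap_seq => i _ /=; by rewrite mxE.
  rewrite -bigcap_seq => h; apply/rowP => i; rewrite mxE; apply: h => /=.
  by rewrite mem_enum.
apply: bigsetI_measurable => i _.
have -> : [set x : 'rV[R]_d | Num.floor (n.+1%:R * x 0 i) = z 0 i] =
   (fun x : 'rV[R]_d => n.+1%:R * x 0 i) @^-1` `[(z 0 i)%:~R, (z 0 i + 1)%:~R[.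
  apply/seteqP; split => x /=; rewrite in_itv /=.
    by move=> <-; exact: floor_itv.
  exact: floor_def.
rewrite -[X in measurable X]setTI; apply: (measurable_funM _ _) => //=.
exact: measurable_coord.
Qed.

Let cvg_grid x : ungrid n (grid n x) @[n --> \oo] --> x.
Proof.
apply/cvg_ballP => e e0; near=> n; split => // i j.
rewrite ord1 /ball /= /ungrid /grid !mxE.
have n0 : 0 < n.+1%:R :> R by rewrite ltr0n.
have /andP[h1 h2] := floor_itv (n.+1%:R * x 0 j).
have ne : e^-1 < n.+1%:R.
  near: n; exists (Num.bound e^-1) => // m /= hm.
  have := archi_boundP (ltW (_ : 0 < e^-1)); rewrite invr_gt0 => /(_ e0) h.
  by apply: lt_le_trans h _; rewrite ler_nat; apply: leqW.
have e1 : 1 < e * n.+1%:R by rewrite -ltr_pdivrMl // mulr1.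
set z := (Num.floor _)%:~R in h1 *.
rewrite intrD in h2; set a := n.+1%:R in n0 e1 h1 h2 *.
rewrite (_ : x 0 j - z / a = (a * x 0 j - z) / a); last by field; rewrite gt_eqF.
rewrite ger0_norm ?divr_ge0 ?subr_ge0 // ?ltW // ltr_pdivrMr //.
by move: h2; rewrite -/z; lra.
Unshelve. all: by end_near. Qed.

(** The sigma-algebra is generated by the coordinates, not by the open sets.
    Rounding the argument to a grid gives functions that are constant on countably
    many measurable cells, and a continuous function is their pointwise limit. *)
Lemma continuous_measurable_rV (f : 'rV[R]_d -> R) :
  continuous f -> measurable_fun setT f.
Proof.
move=> cf; pose h n x := f (ungrid n (grid n x)).
apply: (measurable_fun_cvg (h := h)) => [n _ A mA|x _].
  have -> : setT `&` h n @^-1` A =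
      \bigcup_(z in [set z | A (f (ungrid n z))]) [set x | grid n x = z].
    rewrite setTI; apply/seteqP; split => x /=; first by move=> hA; exists (grid n x).
    by case=> z /= + xz; rewrite -xz.
  rewrite bigcup_mkcond; apply: countable_bigcupT_measurable.
    exact: countableP.
  by move=> z; case: ifP => // _; exact: measurable_grid.
exact: (cvg_comp (fun n => ungrid n (grid n x)) f (@cvg_grid x) (@cf x)).
Qed.

Definition box (A : 'I_d -> set R) : set 'rV[R]_d := [set M | forall i, A i (M 0 i)].

Lemma boxE A : box A = \big[setI/setT]_(i <- enum 'I_d) ((fun M : 'rV[R]_d => M 0 i) @^-1` A i).
Proof.
apply/seteqP; split => x /=; rewrite -bigcap_seq => h i; first by move=> _; exact: h.
by apply: h; rewrite /= mem_enum.
Qed.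

Lemma measurable_box A : (forall i, measurable (A i)) -> measurable (box A).
Proof.
move=> mA; rewrite boxE; apply: bigsetI_measurable => i _.
by rewrite -[X in measurable X]setTI; apply: measurable_coord.
Qed.

(** Boxes are stable under intersection and generate the cylinders, so the
    uniqueness theorem for finite measures applies. *)
Lemma rV_measure_unique (m1 m2 : {measure set 'rV[R]_d -> \bar R}) :
  (m1 setT < +oo)%E ->
  (forall A, (forall i, measurable (A i)) -> m1 (box A) = m2 (box A)) ->
  forall B, measurable B -> m1 B = m2 B.
Proof.
move=> m1oo m12 B mB.
pose G : set (set 'rV[R]_d) := [set C | exists2 A, (forall i, measurable (A i)) & C = box A].
have boxT : box (fun=> setT) = setT by apply/seteqP; split.
apply: (measure_unique G (fun=> setT)) => //.
- apply/seteqP; split; last first.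
    apply: smallest_sub; first exact: sigma_algebra_measurable.
    by move=> _ [A mA ->]; exact: measurable_box.
  apply: smallest_sub; first exact: smallest_sigma_algebra.
  move=> _ [[i0 i] _ [A mA <-]] /=; rewrite setTI ord1.
  apply: sub_sigma_algebra; exists (fun j => if j == i then A else setT).
    by move=> j; case: ifP.
  apply/seteqP; split=> M /=; first by move=> h j; case: eqP => // ->.
  by move=> /(_ i); rewrite eqxx.
- move=> _ _ [A mA ->] [A' mA' ->]; exists (fun i => A i `&` A' i).
    by move=> i; exact: measurableI.
  apply/seteqP; split=> M /=; first by move=> [h h'] i; split.
  by move=> h; split=> i; case: (h i).
- by move=> _; exists (fun=> setT).
- by rewrite bigcup_const.
- by move=> A [A' mA' ->]; exact: m12.
Qed.

Lemma measurable_dotv dT (T : measurableType dT) (g h : T -> 'rV[R]_d) :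
  measurable_fun setT g -> measurable_fun setT h ->
  measurable_fun setT (fun t => dotv (g t) (h t)).
Proof.
move=> /measurable_rVP mg /measurable_rVP mh.
by apply: measurable_sum => i; exact: measurable_funM.
Qed.

Lemma measurable_rVD dT (T : measurableType dT) (g h : T -> 'rV[R]_d) :
  measurable_fun setT g -> measurable_fun setT h ->
  measurable_fun setT (fun t => g t + h t).
Proof.
move=> /measurable_rVP mg /measurable_rVP mh; apply/measurable_rVP => i.
by under eq_fun do rewrite mxE; exact: measurable_funD.
Qed.

Lemma measurable_rVZ dT (T : measurableType dT) (k : T -> R) (h : T -> 'rV[R]_d) :
  measurable_fun setT k -> measurable_fun setT h ->
  measurable_fun setT (fun t => k t *: h t).
Proof.
move=> mk /measurable_rVP mh; apply/measurable_rVP => i.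
by under eq_fun do rewrite mxE; exact: measurable_funM.
Qed.

Lemma measurable_rVB dT (T : measurableType dT) (g h : T -> 'rV[R]_d) :
  measurable_fun setT g -> measurable_fun setT h ->
  measurable_fun setT (fun t => g t - h t).
Proof.
move=> /measurable_rVP mg /measurable_rVP mh; apply/measurable_rVP => i.
by under eq_fun do rewrite !mxE; exact: measurable_funB.
Qed.

End measurable_rV.

Section density_measure.
Local Open Scope ereal_scope.
Context {R : realType} d1 d2 (T1 : measurableType d1) (T2 : measurableType d2).
Variables (m1 : {measure set T1 -> \bar R}) (w : T1 -> R) (X : T1 -> T2).
Hypotheses (mw : measurable_fun setT w) (w0 : forall x, (0 <= w x)%R).
Hypothesis mX : measurable_fun setT X.

Let M (A : set T2) := \int[m1]_(x in X @^-1` A) (w x)%:E.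

Let M0 : M set0 = 0.
Proof. by rewrite /M preimage_set0 integral_set0. Qed.

Let M_ge0 A : 0 <= M A.
Proof. by apply: integral_ge0 => x _; rewrite lee_fin. Qed.

Let M_sigma_additive : semi_sigma_additive M.
Proof.
move=> F mF tF mUF; rewrite /M preimage_bigcup ge0_integral_bigcup //.
- apply: is_cvg_ereal_nneg_natsum_cond => n _ _; exact: M_ge0.
- by move=> k; rewrite -[X in measurable X]setTI; exact: mX.
- by apply/measurable_EFinP; exact: measurable_funTS.
- by move=> x _; rewrite lee_fin.
- by move=> i j _ _ [x [Fi Fj]]; apply: tF => //; exists (X x).
Qed.

(** The weighted law as a genuine measure, so that it can be compared with the
    law of an affine image by testing boxes only. *)
Lemma weighted_law_measure : exists M : {measure set T2 -> \bar R},
  forall A, measurable A -> M A = \int[m1]_x (\1_A (X x) * w x)%:E.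
Proof.
pose MM : {measure set T2 -> \bar R} :=
  HB.pack M (isMeasure.Build _ _ _ M M0 M_ge0 M_sigma_additive).
exists MM => A mA; rewrite /MM /= /M integral_mkcond.
apply: eq_integral => x _; rewrite /patch indicE.
case: ifPn => /= [/set_mem|/negP] h.
  by rewrite mem_set // mul1r.
by rewrite memNset ?mul0r // => hA; apply: h; apply: mem_set.
Qed.

End density_measure.

Lemma integral_probability_cst {R : realType} d (T : measurableType d)
  (P : probability T R) (c : \bar R) : (\int[P]_w c = c)%E.
Proof.
rewrite integral_cst // -[RHS]mule1; congr (_ * _)%E; exact: probability_setT.
Qed.

Section independence.
Local Open Scope ereal_scope.
Context {R : realType} d d' d1 d2 (T : measurableType d) (T' : measurableType d')
  (T1 : measurableType d1) (T2 : measurableType d2).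
Variables (P : probability T R) (P' : probability T' R).
Variables (Y : T -> T1) (X : T -> T2) (X' : T' -> T2).
Hypotheses (mY : measurable_fun setT Y) (mX : measurable_fun setT X)
  (mX' : measurable_fun setT X').
Hypothesis indep : forall A B, measurable A -> measurable B ->
  P (Y @^-1` A `&` X @^-1` B) = P (Y @^-1` A) * P' (X' @^-1` B).

(** Independence makes the joint law of [Y] and [X] a product, and Tonelli's
    theorem integrates the second factor first. Taking for [Y] the identity into
    the coarser sigma-algebra of the past, the inner integral is the conditional
    expectation given the past. *)
Lemma integral_resample (F : T1 * T2 -> \bar R) :
  measurable_fun setT F -> (forall p, 0 <= F p) ->
  \int[P]_w F (Y w, X w) = \int[P]_w \int[P']_w' F (Y w, X' w').
Proof.
move=> mF F0.
pose YR : {RV P >-> T1} := mfun_Sub (mem_set mY).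
pose XR : {RV P' >-> T2} := mfun_Sub (mem_set mX').
have mYX : measurable_fun setT (fun w => (Y w, X w)).
  exact: measurable_fun_pair.
transitivity (\int[pushforward P (fun w => (Y w, X w))]_p F p).
  by rewrite ge0_integral_pushforward.
transitivity (\int[distribution P YR \x distribution P' XR]_p F p).
  apply: eq_measure_integral => A mA _; apply/esym.
  by apply: product_measure_unique.
rewrite (_ : \int[_]_p F p = \int[distribution P YR]_x fubini_F (distribution P' XR) F x); last first.
  exact: fubini_tonelli1.
rewrite /fubini_F ge0_integral_distribution //.
- apply: eq_integral => w _ /=; rewrite ge0_integral_distribution //.
  exact: measurable_fun_pair2.
- exact: measurable_fun_fubini_tonelli_F.
- by move=> y; exact: integral_ge0.
Qed.

End independence.

(** * The one-dimensional Gaussian law *)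

Section gauss1.
Local Open Scope ereal_scope.
Context {R : realType}.
Local Notation mu := (@lebesgue_measure R).

Lemma integral_normal_prob (m s : R) (F : R -> \bar R) :
  measurable_fun setT F -> (forall x, 0 <= F x) ->
  \int[normal_prob m s]_x F x = \int[mu]_x (F x * (normal_pdf m s x)%:E).
Proof.
move=> mF F0; apply/esym.
apply: (@integral_weighted_law R _ _ _ _ mu (normal_pdf m s) idfun) => //.
- exact: measurable_normal_pdf.
- exact: normal_pdf_ge0.
- exact: measurable_id.
move=> A mA; rewrite /= /normal_prob [RHS]integral_mkcond.
apply: eq_integral => x _; rewrite /patch indicE.
by case: ifPn => _ /=; rewrite ?mul1r ?mul0r.
Qed.

(** The pushforward of the Lebesgue measure by an affine map, scaled by the slope,
    gives every interval its length; the sign of the slope decides which end of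
    the preimage is closed. *)
Lemma integral_affine (t m : R) (F : R -> \bar R) : t != 0%R ->
  measurable_fun setT F -> (forall x, 0 <= F x) ->
  \int[mu]_x (F (t * x + m)%R * `|t|%:E) = \int[mu]_x F x.
Proof.
move=> t0 mF F0.
have tp : (0 < `|t|)%R by rewrite normr_gt0.
pose aff : measurableTypeR R -> measurableTypeR R := fun x => (t * x + m)%R.
have maff : measurable_fun setT aff.
  have h : measurable_fun setT (fun x : R => t * x + m)%R.
    by apply: measurable_funD => //; exact: measurable_funM.
  exact: h.
have law := @integral_weighted_law R _ _ _ _ mu (fun=> `|t|%R) _ _ _ maff mu.
apply: law => //.
pose M : {measure set (measurableTypeR R) -> \bar R} :=
  mscale (NngNum (ltW tp)) (pushforward mu aff).
move=> A mA.
transitivity (M maff A).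
  under eq_integral do rewrite EFinM.
  rewrite ge0_integralZr //; last first.
    by apply/measurable_EFinP; apply: measurableT_comp => //; exact: measurable_indic.
  rewrite /M /mscale /= muleC; congr (_ * _).
  transitivity (mu (aff @^-1` A `&` setT)); last by rewrite setIT.
  rewrite -integral_indic //.
  by rewrite -[X in measurable X]setTI; exact: maff.
apply/esym; have := lebesgue_measure_unique (mu := M maff). apply=> // _ [[a b]] _ <- /=.
rewrite lebesgue_measure_itv /M /mscale /= /pushforward lte_fin.
have [ht|ht] : (0 < t \/ t < 0)%R by case: (ltgtP t 0%R) t0; auto.
- have -> : aff @^-1` `]a, b] = `]((a - m) / t)%R, ((b - m) / t)%R]%classic.
    apply/seteqP; split => x /=; rewrite !in_itv /= ltr_pdivrMr // ler_pdivlMr //;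
      rewrite /aff => /andP[h1 h2]; apply/andP; split; lra.
  rewrite lebesgue_measure_itv /= lte_fin ltr_pM2r ?invr_gt0 // ltrD2r.
  case: ifPn => _; last by rewrite mule0.
  by rewrite gtr0_norm // -!EFinB -EFinM; congr (_%:E); field.
- have -> : aff @^-1` `]a, b] = `[((b - m) / t)%R, ((a - m) / t)%R[%classic.
    apply/seteqP; split => x /=; rewrite !in_itv /= ltr_ndivlMr // ler_ndivrMr //;
      rewrite /aff => /andP[h1 h2]; apply/andP; split; lra.
  rewrite lebesgue_measure_itv /= lte_fin ltr_nM2r ?invr_lt0 // ltrD2r.
  case: ifPn => _; last by rewrite mule0.
  by rewrite ltr0_norm // -!EFinB -EFinM; congr (_%:E); field.
Qed.

(** The density of the law of [t * x + m] with respect to the law of [x], for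
    [x] centred Gaussian of standard deviation [s]. *)
Definition gauss_ratio (s t m x : R) : R :=
  `|t|^-1 * expR (x ^+ 2 / (2 * s ^+ 2) - (x - m) ^+ 2 / (2 * (t * s) ^+ 2)).

Lemma gauss_ratio_ge0 s t m x : (0 <= gauss_ratio s t m x)%R.
Proof. by rewrite mulr_ge0 ?expR_ge0 ?invr_ge0. Qed.

Lemma measurable_gauss_ratio s t m : measurable_fun setT (gauss_ratio s t m).
Proof.
apply: measurable_funM => //; apply: measurableT_comp => //.
by apply: measurable_funB; apply: measurable_funM => //;
  apply: measurable_funX => //; exact: measurable_funB.
Qed.

Lemma normal_peakE (s : R) : s != 0%R ->
  normal_peak s = (`|s|^-1 * (Num.sqrt (2 * pi))^-1)%R.
Proof.
move=> s0; rewrite /normal_peak -mulrnAr -mulr_natl sqrtrM ?sqr_ge0 //.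
by rewrite sqrtr_sqr invfM.
Qed.

Lemma normal_pdf_affine (s t m x : R) : s != 0%R -> t != 0%R ->
  normal_pdf 0 s x = (`|t| * normal_pdf m (t * s) (t * x + m))%R.
Proof.
move=> s0 t0; have ts0 : (t * s != 0)%R by rewrite mulf_neq0.
rewrite !normal_pdfE // !normal_peakE // normrM invfM /normal_fun.
have n0 : (`|t| != 0)%R by rewrite normr_eq0.
rewrite -!mulrA mulVKf //; congr (_ * (_ * expR _))%R.
by field; rewrite s0 t0.
Qed.

Lemma normal_pdf_ratio (s t m x : R) : s != 0%R -> t != 0%R ->
  normal_pdf m (t * s) x = (gauss_ratio s t m x * normal_pdf 0 s x)%R.
Proof.
move=> s0 t0; have ts0 : (t * s != 0)%R by rewrite mulf_neq0.
rewrite !normal_pdfE // !normal_peakE // normrM invfM /normal_fun /gauss_ratio.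
rewrite [RHS]mulrACA -expRD -!mulrA; congr (_ * (_ * (_ * expR _)))%R.
by field; rewrite s0 t0.
Qed.

Lemma normal_prob_affine (s t m : R) (F : R -> \bar R) : s != 0%R -> t != 0%R ->
  measurable_fun setT F -> (forall x, 0 <= F x) ->
  \int[normal_prob 0 s]_x F (t * x + m)%R =
  \int[normal_prob 0 s]_x (F x * (gauss_ratio s t m x)%:E).
Proof.
move=> s0 t0 mF F0.
have mr := measurable_gauss_ratio s t m.
have mFa : measurable_fun setT (fun x => F (t * x + m)%R).
  apply: measurableT_comp => //.
  by apply: measurable_funD => //; exact: measurable_funM.
rewrite !integral_normal_prob //; first last.
- by move=> x; rewrite mule_ge0 ?lee_fin ?gauss_ratio_ge0.
- by apply: emeasurable_funM => //; exact/measurable_EFinP.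
transitivity (\int[mu]_x (F x * (normal_pdf m (t * s) x)%:E)).
  rewrite -[RHS](@integral_affine t m) //; first last.
  - by move=> x; rewrite mule_ge0 ?lee_fin ?normal_pdf_ge0.
  - apply: emeasurable_funM => //; apply/measurable_EFinP.
    exact: measurable_normal_pdf.
  apply: eq_integral => x _; rewrite (normal_pdf_affine m x s0 t0).
  by rewrite EFinM muleA muleAC.
apply: eq_integral => x _; rewrite normal_pdf_ratio // EFinM muleA //.
Qed.

(** Completing the square turns the squared likelihood ratio times the density
    into a constant times another normal density; the condition [t ^+ 2 < 2] keeps
    the resulting variance positive. *)
Lemma gauss_ratio_sqr (s t m x : R) : s != 0%R -> (0 < t)%R -> (t ^+ 2 < 2)%R ->
  let q := Num.sqrt (2 - t ^+ 2) in
  (gauss_ratio s t m x ^+ 2 * normal_pdf 0 s x = (t * q)^-1 *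
     expR (m ^+ 2 / (s ^+ 2 * (2 - t ^+ 2))) *
     normal_pdf (2 * m / (2 - t ^+ 2)) (t * s / q) x)%R.
Proof.
move=> s0 t0 t2 q.
have q0 : (0 < q)%R by rewrite sqrtr_gt0 subr_gt0.
have qE : (q ^+ 2 = 2 - t ^+ 2)%R by rewrite sqr_sqrtr // subr_ge0 ltW.
have ts0 : (t * s / q != 0)%R.
  by rewrite !mulf_neq0 ?invr_eq0 // gt_eqF.
rewrite !normal_pdfE // !normal_peakE // !normrM normfV (gtr0_norm q0).
rewrite (gtr0_norm t0) /normal_fun /gauss_ratio (gtr0_norm t0) exprMn -expRM_natl.
set c := ((Num.sqrt (2 * pi))^-1)%R.
have sn0 : (`|s| != 0)%R by rewrite normr_eq0.
have t0' : (t != 0)%R by rewrite gt_eqF.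
have q0' : (q != 0)%R by rewrite gt_eqF.
have d0 : (2 - t ^+ 2 != 0)%R by rewrite -qE expf_neq0.
set A := expR _; set B := expR _; set C := expR _; set D := expR _.
have -> : (t^-1 ^+ 2 * A * (`|s|^-1 * c * B) = t^-1 ^+ 2 * `|s|^-1 * c * (A * B))%R.
  by ring.
have -> : ((t * q)^-1 * C * ((t * `|s| / q)^-1 * c * D) =
    t^-1 ^+ 2 * `|s|^-1 * c * (C * D))%R.
  field.
  by rewrite t0' q0' sn0.
congr (_ * _)%R; rewrite -!expRD; congr expR.
rewrite expr_div_n exprMn qE.
by field; rewrite s0 t0' d0.
Qed.

Lemma integral_gauss_ratio_sqr (s t m : R) : s != 0%R -> (0 < t)%R -> (t ^+ 2 < 2)%R ->
  \int[normal_prob 0 s]_x (gauss_ratio s t m x ^+ 2)%:E =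
  ((t * Num.sqrt (2 - t ^+ 2))^-1 * expR (m ^+ 2 / (s ^+ 2 * (2 - t ^+ 2))))%:E.
Proof.
move=> s0 t0 t2; rewrite integral_normal_prob; first last.
- by move=> x; rewrite lee_fin sqr_ge0.
- by apply/measurable_EFinP; apply: measurable_funX; exact: measurable_gauss_ratio.
under eq_integral do rewrite -EFinM gauss_ratio_sqr // EFinM.
rewrite ge0_integralZl //.
- by rewrite integral_normal_pdf mule1.
- by apply/measurable_EFinP; exact: measurable_normal_pdf.
- by move=> x _; rewrite lee_fin normal_pdf_ge0.
- by rewrite lee_fin mulr_ge0 ?expR_ge0 // invr_ge0 mulr_ge0 ?sqrtr_ge0 // ltW.
Qed.

End gauss1.

Section gauss1_moments.
Local Open Scope ereal_scope.
Context {R : realType}.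
Variable s : R.
Hypothesis s0 : s != 0%R.
Local Notation gamma := (normal_prob 0 s).

Let gamma1 : \int[gamma]_x 1 = 1.
Proof. by rewrite integral_cst // mul1e; exact: (@probability_setT _ _ _ gamma). Qed.

(** The density ratio of a centred dilation is an exponential of a square, and it
    integrates to one; this yields the exponential moments of the square, from
    which the second and fourth moments are bounded. *)
Lemma integral_expR_sqr (q : R) : (0 < q)%R ->
  \int[gamma]_x (expR ((1 - q ^+ 2) * (x ^+ 2 / (2 * s ^+ 2))))%:E = q^-1%:E.
Proof.
move=> q0; have qi0 : q^-1%R != 0%R by rewrite invr_eq0 gt_eqF.
have m1 : measurable_fun setT (cst 1 : R -> \bar R) by [].
have m2 : measurable_fun setT (fun x => (gauss_ratio s q^-1 0 x)%:E).
  by apply/measurable_EFinP; exact: measurable_gauss_ratio.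
have := normal_prob_affine 0 s0 qi0 m1 (fun=> lee01).
rewrite /= gamma1; under eq_integral do rewrite mul1e.
move=> h.
transitivity (\int[gamma]_x (q^-1%:E * (gauss_ratio s q^-1 0 x)%:E)).
  apply: eq_integral => x _; rewrite -EFinM; congr EFin.
  rewrite /gauss_ratio gtr0_norm ?invr_gt0 // invrK mulKf ?gt_eqF //.
  by congr expR; rewrite subr0; field; rewrite s0 gt_eqF.
rewrite ge0_integralZl // -?h ?mule1 //.
- by move=> x _; rewrite lee_fin gauss_ratio_ge0.
- by rewrite lee_fin invr_ge0 ltW.
Qed.

Let mexp (q : R) :
  measurable_fun setT (fun x : R => expR ((1 - q ^+ 2) * (x ^+ 2 / (2 * s ^+ 2)))).
Proof.
apply: measurableT_comp => //; apply: measurable_funM => //.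
by apply: measurable_funM => //; exact: measurable_funX.
Qed.

(** Bound [expR] below by its tangent at 0 in the exponential moment, and let [q]
    tend to 1: in place of the limit, a second moment above [s ^+ 2] is refuted
    at a suitable [q]. *)
Lemma integral_sqr_le : \int[gamma]_x (x ^+ 2)%:E <= (s ^+ 2)%:E.
Proof.
have s2 : (0 < s ^+ 2)%R by rewrite exprn_even_gt0.
have M0 : 0 <= \int[gamma]_x (x ^+ 2)%:E.
  by apply: integral_ge0 => x _; rewrite lee_fin sqr_ge0.
have key (q : R) : (0 < q)%R -> (q < 1)%R ->
    \int[gamma]_x (x ^+ 2)%:E * ((1 - q ^+ 2) / (2 * s ^+ 2))%:E + 1 <= q^-1%:E.
  move=> q0 q1; rewrite -(integral_expR_sqr q0).
  have c0 : (0 <= (1 - q ^+ 2) / (2 * s ^+ 2))%R.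
    apply: divr_ge0; last by apply: mulr_ge0 => //; exact: ltW.
    by rewrite subr_ge0 exprn_ile1 // ltW.
  have m2 : measurable_fun setT (fun x : R => (x ^+ 2)%:E).
    by apply/measurable_EFinP; exact: measurable_funX.
  rewrite -ge0_integralZr // => [|x _]; last by rewrite lee_fin sqr_ge0.
  rewrite -[X in _ + X]gamma1 -ge0_integralD //.
  - apply: ge0_le_integral => //.
    + by move=> x _; rewrite adde_ge0 // -EFinM lee_fin mulr_ge0 ?sqr_ge0.
    + by apply: emeasurable_funD => //; exact: emeasurable_funM.
    + apply/measurable_EFinP; exact: mexp.
    + move=> x _; rewrite -EFinM -EFinD lee_fin.
      apply: le_trans (expR_ge1Dx _); rewrite le_eqVlt; apply/orP; left.
      by apply/eqP; ring.
  - by move=> x _; rewrite -EFinM lee_fin mulr_ge0 ?sqr_ge0.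
  - exact: emeasurable_funM.
case: (\int[gamma]_x _) M0 key => [M||] //; last first.
  move=> _ /(_ (2^-1)%R); rewrite invr_gt0 ltr0n invf_lt1 ?ltr1n // => /(_ isT isT).
  rewrite gt0_mulye ?addye // lte_fin; apply: divr_gt0; last exact: mulr_gt0.
  by rewrite subr_gt0 expr_lt1 // ?invr_ge0 ?invf_lt1 ?ltr1n.
rewrite !lee_fin => M0 key; rewrite leNgt; apply/negP => sM.
have Mp : (0 < M)%R by apply: lt_trans sM.
(* with q = 1 - e, the inequality reads M q (1 + q) <= 2 s^2, which fails to
   first order in e as soon as 3 e M < 2 (M - s^2) *)
pose e := ((M - s ^+ 2) / (3 * M))%R.
have e0 : (0 < e)%R by rewrite divr_gt0 ?mulr_gt0 ?subr_gt0.
have e1 : (e < 1)%R by rewrite ltr_pdivrMr ?mulr_gt0 // mul1r; lra.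
have eE : (e * M = (M - s ^+ 2) / 3)%R by rewrite /e; field; rewrite gt_eqF.
have q0 : (0 < 1 - e)%R by lra.
have q1 : (1 - e < 1)%R by lra.
have := key _ q0 q1; rewrite -EFinM -EFinD lee_fin; set q := (1 - e)%R in q0 q1 *.
rewrite -(ler_pM2r q0) mulVf ?gt_eqF // => h.
have {}h : (M * (q * (1 + q)) <= 2 * s ^+ 2)%R.
  have q1' : (0 < 1 - q)%R by lra.
  rewrite -(ler_pM2l q1').
  have : ((M * ((1 - q ^+ 2) / (2 * s ^+ 2)) + 1) * q * (2 * s ^+ 2) <= 1 * (2 * s ^+ 2))%R.
    by rewrite ler_pM2r // mulr_gt0.
  rewrite (_ : _ * q * (2 * s ^+ 2) = M * (1 - q ^+ 2) * q + q * (2 * s ^+ 2))%R; last first.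
    by field; exact: s0.
  nra.
have : (M * (2 - 3 * e) <= M * (q * (1 + q)))%R.
  by rewrite ler_pM2l // /q; nra.
nra.
Qed.

Lemma expR1_lb : (64 / 25 <= expR 1 :> R)%R.
Proof.
have <- : (8^-1 * 8%:R = 1 :> R)%R by rewrite mulVf.
rewrite expRM_natr.
have step (b a c : R) : (0 <= b)%R -> (b <= a)%R -> (c <= b * b)%R -> (c <= a ^+ 2)%R.
  by move=> b0 ba bc; apply: le_trans bc _; rewrite expr2 ler_pM.
have h0 : (9 / 8 <= expR (8^-1 : R))%R by apply: le_trans (expR_ge1Dx _); lra.
have h1 : (81 / 64 <= expR (8^-1 : R) ^+ 2)%R by apply: step h0 _; lra.
have h2 : (8 / 5 <= expR (8^-1 : R) ^+ 2 ^+ 2)%R by apply: step h1 _; lra.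
by rewrite (exprM _ 4 2) (exprM _ 2 2); apply: step h2 _; lra.
Qed.

(** From [u / 2 <= expR (u / 2 - 1)], squared; the constant is rounded up from
    [4 / expR 2]. *)
Lemma sqr_le_expR (u : R) : (0 <= u)%R -> (u ^+ 2 <= 5 / 8 * expR u)%R.
Proof.
move=> u0.
have h1 : (u / 2 * expR 1 <= expR (u / 2))%R.
  rewrite -ler_pdivlMr ?expR_gt0 // -expRN -expRD.
  by apply: le_trans (expR_ge1Dx _); lra.
have h2 : (u * (32 / 25) <= expR (u / 2))%R.
  apply: le_trans h1; have := expR1_lb; nra.
have -> : expR u = (expR (u / 2) ^+ 2)%R by rewrite -expRM_natl; congr expR; field.
have h3 : ((u * (32 / 25)) ^+ 2 <= expR (u / 2) ^+ 2)%R.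
  by apply: lerXn2r => //; rewrite ?nnegrE ?expR_ge0 // mulr_ge0 // divr_ge0.
have := sqr_ge0 u; nra.
Qed.

(** The exponential moment at [q = 2^-1] dominates the fourth power. The constant
    9, in place of the sharp 3, is the one that completes a square for a perturbed
    point. *)
Lemma integral_pow4_le : \int[gamma]_x (x ^+ 4)%:E <= (9 * s ^+ 4)%:E.
Proof.
have s2 : (0 < s ^+ 2)%R by rewrite exprn_even_gt0.
have s4 : (0 <= s ^+ 4)%R by rewrite exprn_even_ge0.
have c0 : (0 <= 40 / 9 * s ^+ 4)%R by rewrite mulr_ge0 // divr_ge0.
have h0 : (0 < 2^-1 :> R)%R by rewrite invr_gt0.
apply: (@le_trans _ _ (\int[gamma]_x ((40 / 9 * s ^+ 4)%:E *
   (expR ((1 - 2^-1 ^+ 2) * (x ^+ 2 / (2 * s ^+ 2))))%:E))).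
  apply: ge0_le_integral => //.
  - by move=> x _; rewrite lee_fin exprn_even_ge0.
  - by apply/measurable_EFinP; exact: measurable_funX.
  - by apply: emeasurable_funM => //; apply/measurable_EFinP; exact: mexp.
  move=> x _; rewrite -EFinM lee_fin.
  set u := ((1 - _) * _)%R.
  have u0 : (0 <= u)%R.
    apply: mulr_ge0; first by nra.
    by apply: divr_ge0; [exact: sqr_ge0|apply: mulr_ge0 => //; exact: ltW].
  have := sqr_le_expR u0.
  have -> : (x ^+ 4 = u ^+ 2 * (64 / 9 * s ^+ 4))%R.
    by rewrite /u; field; exact: s0.
  by move=> h; have := ler_wpM2r s4 h; lra.
rewrite ge0_integralZl //.
- by rewrite integral_expR_sqr // invrK -EFinM lee_fin; lra.
- apply/measurable_EFinP; exact: mexp.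
Qed.

End gauss1_moments.

(** * Isotropic Gaussian vectors *)

Section isotropic.
Local Open Scope ereal_scope.
Context {R : realType} {d : nat} dO (Omega : measurableType dO).
Variables (P : probability Omega R) (X : Omega -> 'rV[R]_d) (v : R).
Hypotheses (v0 : (0 < v)%R) (isoX : isotropic_normal P X v).
Local Notation s := (Num.sqrt v).
Local Notation gamma := (normal_prob 0 s).

Let s0 : s != 0%R.
Proof. by rewrite gt_eqF // sqrtr_gt0. Qed.

Let s2 : (s ^+ 2 = v)%R.
Proof. by rewrite sqr_sqrtr // ltW. Qed.

Let mX : measurable_fun setT X.
Proof. by case: isoX. Qed.

Let mXi i : measurable_fun setT (fun w => X w 0%R i).
Proof. by move: i; exact/measurable_rVP. Qed.

Let mprod (g : 'I_d -> R -> R) (Q : pred 'I_d) : (forall i, measurable_fun setT (g i)) ->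
  measurable_fun setT (fun w => (\prod_(i < d | Q i) g i (X w 0 i))%R).
Proof.
move=> mg; under eq_fun do rewrite big_mkcond; apply: measurable_prod => i _.
by case: (Q i) => //; apply: measurableT_comp.
Qed.

(** Independence of the coordinates is given on boxes; this is its form for
    products of nonnegative functions. *)
Lemma integral_isotropic_prod (g : 'I_d -> R -> R) (c : 'I_d -> R) :
  (forall i, measurable_fun setT (g i)) -> (forall i t, (0 <= g i t)%R) ->
  (forall i, \int[gamma]_t (g i t)%:E = (c i)%:E) ->
  \int[P]_w (\prod_(i < d) g i (X w 0 i))%:E = (\prod_(i < d) c i)%:E.
Proof.
(* The hypothesis on the law covers products of indicators. The induction is on
   the number n of leading factors that are arbitrary; the last of them is
   replaced by an indicator through the weighted law of its coordinate. *)
suff main n : forall (g : 'I_d -> R -> R) (c : 'I_d -> R),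
    (forall i, measurable_fun setT (g i)) -> (forall i t, (0 <= g i t)%R) ->
    (forall i, \int[gamma]_t (g i t)%:E = (c i)%:E) ->
    (forall i : 'I_d, (n <= i)%N -> exists2 A, measurable A & g i = \1_A) ->
    \int[P]_w (\prod_(i < d) g i (X w 0 i))%:E = (\prod_(i < d) c i)%:E.
  move=> mg g0 gc; apply: (main d) => // i; by rewrite leqNgt ltn_ord.
elim: n => [|n IH] {}g {}c mg g0 gc gA.
  have /choice [A hA] : forall i, exists A, measurable A /\ g i = \1_A.
    by move=> i; have [A] := gA i (leq0n i); exists A.
  have mA i : measurable (A i) by case: (hA i).
  have gE i : g i = \1_(A i) by case: (hA i).
  transitivity (P (X @^-1` box A)); last first.
    have [_ ->] := isoX => //; rewrite -prodEFin; apply: eq_bigr => i _.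
    by rewrite -gc gE integral_indic ?setIT //; exact: mA.
  rewrite -[Z in _ = P Z]setIT -integral_indic //; last first.
    by rewrite -[Z in measurable Z]setTI; apply: mX => //; exact: measurable_box.
  apply: eq_integral => w _; congr EFin; rewrite indicE.
  have [/set_mem hw|/negP hw] := boolP (w \in _).
    by rewrite big1 // => i _; rewrite gE indicE mem_set //; exact: hw.
  have [i hi] : exists i, ~ A i (X w 0%R i).
    by apply/existsNP => h; apply: hw; apply: mem_set.
  by rewrite (bigD1 i) //= gE indicE memNset // mul0r.
have [dn|nd] := leqP d n.
  by apply: IH => // i ni; have := leq_trans (ltn_ord i) (leq_trans dn ni); rewrite ltnn.
pose k := Ordinal nd.
pose W w := (\prod_(i < d | i != k) g i (X w 0 i))%R.
pose C := (\prod_(i < d | i != k) c i)%R.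
have c0 i : (0 <= c i)%R.
  by rewrite -lee_fin -gc; apply: integral_ge0 => t _; rewrite lee_fin.
have C0 : (0 <= C)%R by apply: prodr_ge0 => i _.
pose M : {measure set (measurableTypeR R) -> \bar R} := mscale (NngNum C0) gamma.
have mW : measurable_fun setT W by exact: mprod.
have W0 w : (0 <= W w)%R by apply: prodr_ge0 => i _.
have mgk : measurable_fun setT (fun t => (g k t)%:E) by exact/measurable_EFinP.
have mXk : measurable_fun setT (fun w => X w 0%R k : measurableTypeR R) := @mXi k.
have law := @integral_weighted_law R _ _ _ _ P W _ mW W0 mXk M _ (fun t => (g k t)%:E) mgk.
transitivity (\int[P]_w ((g k (X w 0%R k))%:E * (W w)%:E)).
  by apply: eq_integral => w _; rewrite -EFinM (bigD1 k).
rewrite law.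
- rewrite ge0_integral_mscale //; last by move=> t _; rewrite lee_fin.
  by rewrite gc -EFinM (bigD1 k) //= mulrC.
- move=> A mA.
  pose g' i := if i == k then \1_A else g i.
  pose c' i := if i == k then fine (gamma A) else c i.
  transitivity (\int[P]_w (\prod_(i < d) g' i (X w 0 i))%:E).
    apply: eq_integral => w _; rewrite (bigD1 k) //= /g' eqxx; congr (_ * _)%:E.
    by apply: eq_bigr => i /negbTE ->.
  rewrite (IH g' c').
  + rewrite (bigD1 k) //= /c' eqxx /M /mscale /= muleC EFinM fineK ?fin_num_measure //.
    by congr (_ * _%:E); apply: eq_bigr => i /negbTE ->.
  + by move=> i; rewrite /g'; case: ifP => // _; exact: measurable_indic.
  + by move=> i t; rewrite /g'; case: ifP => // _; rewrite indicE.
  + move=> i; rewrite /g' /c'; case: ifP => // _.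
    by rewrite integral_indic // setIT fineK ?fin_num_measure.
  + move=> i ni; rewrite /g'; case: eqP => [_|ik]; first by exists A.
    apply: gA; rewrite ltn_neqAle ni andbT; apply/eqP => ni'; apply: ik.
    exact: val_inj.
- by move=> t; rewrite lee_fin.
Qed.

Lemma integral_isotropic_coord (h : R -> R) (c : R) (i : 'I_d) :
  measurable_fun setT h -> (forall t, (0 <= h t)%R) ->
  \int[gamma]_t (h t)%:E = c%:E -> \int[P]_w (h (X w 0 i))%:E = c%:E.
Proof.
move=> mh h0 hc.
pose g j := if j == i then h else fun=> 1%R.
have := @integral_isotropic_prod g (fun j => if j == i then c else 1%R).
have pick (F : 'I_d -> R) : (\prod_j (if j == i then F j else 1%R) = F i)%R.
  by rewrite (bigD1 i) //= eqxx big1 ?mulr1 // => j /negbTE ->.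
rewrite (pick (fun=> c)) => <-.
- by apply: eq_integral => w _; rewrite -(pick (fun j => h (X w 0%R j))) /g;
    congr EFin; apply: eq_bigr => j _; case: ifP.
- by move=> j; rewrite /g; case: ifP.
- by move=> j t; rewrite /g; case: ifP.
- move=> j; rewrite /g; case: ifP => // _; rewrite integral_cst // mul1e.
  exact: (@probability_setT _ _ _ gamma).
Qed.

(** The density of the law of [t *: X + m] with respect to that of [X]. *)
Definition isotropic_ratio (t : R) (m : 'rV[R]_d) (x : 'rV[R]_d) : R :=
  \prod_(i < d) gauss_ratio s t (m 0%R i) (x 0%R i).

Lemma isotropic_ratio_ge0 t m x : (0 <= isotropic_ratio t m x)%R.
Proof. by apply: prodr_ge0 => i _; exact: gauss_ratio_ge0. Qed.

Lemma measurable_isotropic_ratio t m :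
  measurable_fun setT (fun w => isotropic_ratio t m (X w)).
Proof.
by apply: (mprod (g := fun i => gauss_ratio s t (m 0%R i))) => i;
  exact: measurable_gauss_ratio.
Qed.

Let affine_coord (t : R) (m : 'rV[R]_d) w i :
  (t *: X w + m)%R 0%R i = (t * X w 0 i + m 0 i)%R.
Proof. by rewrite !mxE. Qed.

Let measurable_affine t m : measurable_fun setT (fun w => t *: X w + m)%R.
Proof.
apply/measurable_rVP => i; under eq_fun do rewrite affine_coord.
by apply: measurable_funD => //; exact: measurable_funM.
Qed.

Let ge0_integral_isotropic_affine (t : R) (m : 'rV[R]_d) (F : 'rV[R]_d -> \bar R) :
  t != 0%R -> measurable_fun setT F -> (forall x, 0 <= F x) ->
  \int[P]_w F (t *: X w + m)%R =
  \int[P]_w (F (X w) * (isotropic_ratio t m (X w))%:E).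
Proof.
move=> t0 mF F0; set rho := fun w => isotropic_ratio t m (X w).
have mrho : measurable_fun setT rho by exact: measurable_isotropic_ratio.
have rho0 w : (0 <= rho w)%R by exact: isotropic_ratio_ge0.
have [M ME] := weighted_law_measure P mrho rho0 mX.
have maff := @measurable_affine t m.
pose Z w : 'rV[R]_d := (t *: X w + m)%R.
pose M' : {measure set 'rV[R]_d -> \bar R} := pushforward P Z.
transitivity (\int[M' maff]_x F x).
  by rewrite /M' ge0_integral_pushforward.
apply/esym.
have := @integral_weighted_law R _ _ _ _ P rho X mrho rho0 mX (M' maff) _ F mF F0.
apply => A mA; rewrite -ME //; apply/esym.
move: A mA; apply: rV_measure_unique.
  by rewrite /M' /= /pushforward preimage_setT probability_setT ltry.
move=> A mA; rewrite ME; last exact: measurable_box.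
pose A' i := (fun x : R => t * x + m 0 i)%R @^-1` A i.
have maff1 i : measurable_fun setT (fun x : R => t * x + m 0 i)%R.
  by apply: measurable_funD => //; exact: measurable_funM.
have mA' i : measurable (A' i).
  by rewrite -[S in measurable S]setTI; apply: maff1.
transitivity (P [set w | forall i, A' i (X w 0%R i)]).
  congr (P _); apply/seteqP; split => w /= h i; have := h i;
  by rewrite /A' /= /Z ?affine_coord.
rewrite (proj2 isoX) //.
pose g i x := (\1_(A i) x * gauss_ratio s t (m 0 i) x)%R.
have mind i : measurable_fun setT (\1_(A i) : R -> R) by exact: measurable_indic.
have gE i : \int[gamma]_x (g i x)%:E = gamma (A' i).
  have := @normal_prob_affine R s t (m 0%R i) (fun x => (\1_(A i) x)%:E) s0 t0.
  have -> : \int[gamma]_x (\1_(A i) (t * x + m 0%R i)%R)%:E = gamma (A' i).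
    by rewrite -[in RHS](setIT (A' i)) -integral_indic //; exact: mA'.
  by move=> -> //; exact/measurable_EFinP.
transitivity (\int[P]_w (\prod_(i < d) g i (X w 0 i))%:E).
  rewrite (@integral_isotropic_prod g (fun i => fine (gamma (A' i)))).
  - rewrite -prodEFin; apply: eq_bigr => i _; rewrite fineK //.
    by apply: (@fin_num_measure _ _ _ gamma); exact: mA'.
  - by move=> i; apply: measurable_funM => //; exact: measurable_gauss_ratio.
  - by move=> i x; rewrite mulr_ge0 ?gauss_ratio_ge0 // indicE.
  - by move=> i; rewrite gE fineK //; apply: (@fin_num_measure _ _ _ gamma); exact: mA'.
apply: eq_integral => w _; congr EFin.
rewrite /g big_split /=; congr (_ * _)%R; rewrite indicE.
have [/set_mem hw|/negP hw] := boolP (X w \in box A).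
  by rewrite big1 // => i _; rewrite indicE mem_set //; exact: hw.
have [i hi] : exists i, ~ A i (X w 0%R i).
  by apply/existsNP => h; apply: hw; apply: mem_set.
by rewrite (bigD1 i) //= indicE memNset // mul0r.
Qed.

Let maxe_pMl (a : \bar R) (r : R) : (0 <= r)%R ->
  maxe (a * r%:E) 0 = maxe a 0 * r%:E.
Proof.
move=> r0; have [a0|a0] := leP 0 a.
  by rewrite (max_idPl _) // mule_ge0 // lee_fin.
by rewrite mul0e (max_idPr _) // mule_le0_ge0 // ?ltW // lee_fin.
Qed.

(** Both sides agree on indicators of boxes by the one-dimensional case, hence for
    nonnegative functions; a function of variable sign is split into its positive
    and negative parts. *)
Lemma integral_isotropic_affine (t : R) (m : 'rV[R]_d) (F : 'rV[R]_d -> \bar R) :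
  t != 0%R -> measurable_fun setT F ->
  \int[P]_w F (t *: X w + m)%R =
  \int[P]_w (F (X w) * (isotropic_ratio t m (X w))%:E).
Proof.
move=> t0 mF; have r0 w := isotropic_ratio_ge0 t m (X w).
rewrite integralE [RHS]integralE; congr (_ - _).
- transitivity (\int[P]_w F^\+ (t *: X w + m)%R).
    by apply: eq_integral => w _; rewrite !funeposE.
  rewrite ge0_integral_isotropic_affine //; last exact: measurable_funepos.
  by apply: eq_integral => w _; rewrite !funeposE maxe_pMl.
- transitivity (\int[P]_w F^\- (t *: X w + m)%R).
    by apply: eq_integral => w _; rewrite !funenegE.
  rewrite ge0_integral_isotropic_affine //; last exact: measurable_funeneg.
  by apply: eq_integral => w _; rewrite !funenegE -mulNe maxe_pMl.
Qed.

Lemma integral_isotropic_opp (F : 'rV[R]_d -> \bar R) :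
  measurable_fun setT F -> \int[P]_w F (- X w)%R = \int[P]_w F (X w).
Proof.
move=> mF; have n0 : (-1 : R)%R != 0%R by rewrite oppr_eq0 oner_eq0.
have := integral_isotropic_affine 0 n0 mF.
under eq_integral do rewrite scaleN1r addr0; move=> ->.
apply: eq_integral => w _; rewrite /isotropic_ratio big1 ?mule1 // => i _.
by rewrite /gauss_ratio normrN1 invr1 mul1r mxE subr0 mulN1r sqrrN subrr expR0.
Qed.

Lemma integral_isotropic_ratio (t : R) (m : 'rV[R]_d) : t != 0%R ->
  \int[P]_w (isotropic_ratio t m (X w))%:E = 1.
Proof.
move=> t0; have m1 : measurable_fun setT (cst 1 : 'rV[R]_d -> \bar R) by [].
have := integral_isotropic_affine m t0 m1.
under [Z in _ = Z]eq_integral do rewrite /= mul1e.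
by move=> <-; rewrite /= integral_cst // mul1e; exact: probability_setT.
Qed.

Lemma integral_isotropic_ratio_sqr (t : R) (m : 'rV[R]_d) :
  (0 < t)%R -> (t ^+ 2 < 2)%R ->
  \int[P]_w (isotropic_ratio t m (X w) ^+ 2)%:E =
  ((t * Num.sqrt (2 - t ^+ 2)) ^- d *
    expR (dotv m m / (v * (2 - t ^+ 2))))%:E.
Proof.
move=> t0 t2.
transitivity (\int[P]_w (\prod_(i < d) gauss_ratio s t (m 0 i) (X w 0 i) ^+ 2)%:E).
  by apply: eq_integral => w _; rewrite /isotropic_ratio -prodrXl.
rewrite (@integral_isotropic_prod (fun i x => gauss_ratio s t (m 0%R i) x ^+ 2)%R
  (fun i => (t * Num.sqrt (2 - t ^+ 2))^-1 *
     expR (m 0%R i ^+ 2 / (v * (2 - t ^+ 2))))%R).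
- rewrite big_split /= prodr_const card_ord exprVn; congr (_ * _)%:E.
  rewrite -expR_sum; congr expR; rewrite mulr_suml.
  by apply: eq_bigr => i _; rewrite expr2.
- by move=> i; apply: measurable_funX; exact: measurable_gauss_ratio.
- by move=> i x; exact: sqr_ge0.
- by move=> i; rewrite integral_gauss_ratio_sqr // s2.
Qed.

Let integral_coord_le (h : R -> R) (c : R) (i : 'I_d) :
  measurable_fun setT h -> (forall t, (0 <= h t)%R) ->
  \int[gamma]_t (h t)%:E <= c%:E -> \int[P]_w (h (X w 0 i))%:E <= c%:E.
Proof.
move=> mh h0 hc; apply: le_trans hc.
have I0 : 0 <= \int[gamma]_t (h t)%:E.
  by apply: integral_ge0 => t _; rewrite lee_fin.
case E : (\int[gamma]_t (h t)%:E) I0 => [r||] // _; last by rewrite leey.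
by rewrite (integral_isotropic_coord i mh h0 E).
Qed.

Let integral_sum_coord_le (h : R -> R) (c : R) :
  measurable_fun setT h -> (forall t, (0 <= h t)%R) ->
  \int[gamma]_t (h t)%:E <= c%:E ->
  \int[P]_w (\sum_(i < d) h (X w 0 i)%R)%:E <= (d%:R * c)%:E.
Proof.
move=> mh h0 hc.
have -> : \int[P]_w (\sum_(i < d) h (X w 0 i)%R)%:E =
    \int[P]_w (\sum_(i < d) (h (X w 0%R i))%:E).
  by apply: eq_integral => w _; rewrite sumEFin.
rewrite ge0_integral_sum //; first last.
- by move=> i w _; rewrite lee_fin.
- by move=> i; apply/measurable_EFinP; exact: measurableT_comp.
apply: (@le_trans _ _ (\sum_(i < d) c%:E)).
  by apply: lee_sum => i _; exact: integral_coord_le.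
by rewrite sumEFin sumr_const card_ord mulr_natl.
Qed.

Lemma integral_dotvv_isotropic_le :
  \int[P]_w (dotv (X w) (X w))%:E <= (d%:R * v)%:E.
Proof.
apply: (integral_sum_coord_le (h := fun x => x * x)%R).
- exact: measurable_funM.
- by move=> x; rewrite -expr2 sqr_ge0.
- have := integral_sqr_le s0; rewrite s2; apply: le_trans; rewrite le_eqVlt.
  by apply/orP; left; apply/eqP; apply: eq_integral => x _; rewrite expr2.
Qed.

(** By the Cauchy-Schwarz inequality against the constant vector, the squared
    norm is controlled by the sum of the fourth powers of the coordinates. *)
Lemma integral_dotvv_sqr_isotropic_le :
  \int[P]_w (dotv (X w) (X w) ^+ 2)%:E <= (9 * (d%:R * v) ^+ 2)%:E.
Proof.
have m4 : measurable_fun setT (fun x : R => x ^+ 4)%R by exact: measurable_funX.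
have p4 (x : R) : (0 <= x ^+ 4)%R by exact: exprn_even_ge0.
have mS : measurable_fun setT (fun w => (\sum_(i < d) X w 0%R i ^+ 4)%:E).
  by apply/measurable_EFinP; apply: measurable_sum => i; exact: measurable_funX.
apply: (@le_trans _ _ (\int[P]_w (d%:R%:E * (\sum_(i < d) X w 0%R i ^+ 4)%:E))).
  apply: ge0_le_integral => //.
  - by move=> w _; rewrite lee_fin sqr_ge0.
  - apply/measurable_EFinP; apply: measurable_funX; apply: measurable_sum => i.
    exact: measurable_funM.
  - exact: emeasurable_funM.
  move=> w _; rewrite -EFinM lee_fin.
  pose a : 'rV[R]_d := \row_i (X w 0%R i ^+ 2)%R.
  have := cauchy_schwarz (\row_i 1%R) a.
  have -> : dotv (\row_i 1%R) a = dotv (X w) (X w).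
    by apply: eq_bigr => i _; rewrite !mxE mul1r expr2.
  have -> : dotv (\row_(i < d) 1%R) (\row_i 1%R) = d%:R :> R.
    rewrite /dotv (eq_bigr (fun=> 1%R)) ?sumr_const ?card_ord //.
    by move=> i _; rewrite !mxE mulr1.
  have -> // : dotv a a = (\sum_(i < d) X w 0%R i ^+ 4)%R.
  by apply: eq_bigr => i _; rewrite !mxE -exprD.
rewrite ge0_integralZl //.
- rewrite (_ : (9 * _)%R = (d%:R * (d%:R * (9 * s ^+ 4)))%R); last first.
    by rewrite (exprM _ 2 2) s2; ring.
  rewrite [leRHS]EFinM; apply: lee_pmul => //; rewrite ?lee_fin ?ler0n //.
    by apply: integral_ge0 => w _; rewrite lee_fin sumr_ge0.
  by apply: (integral_sum_coord_le (h := fun x => x ^+ 4)%R) => //; exact: integral_pow4_le.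
- by move=> w _; rewrite lee_fin sumr_ge0.
Qed.

End isotropic.

(** * A point perturbed by isotropic Gaussian noise *)

Section perturbed_point.
Context {R : realType} {d : nat} dO (Omega : measurableType dO).
Variables (P : probability Omega R) (X : Omega -> 'rV[R]_d).
Hypotheses (d0 : (0 < d)%N) (isoX : isotropic_normal P X d%:R^-1).
Variables (a : 'rV[R]_d) (sigma : R).
Hypothesis sigma0 : 0 < sigma.

Definition perturbed w : 'rV[R]_d := a - sigma *: X w.
Local Notation z := perturbed.
Local Notation q w := (dotv (z w) (z w)).
Local Notation n2 := (dotv a a).

Let v0 : 0 < d%:R^-1 :> R.
Proof. by rewrite invr_gt0 ltr0n. Qed.

Let dv : d%:R * d%:R^-1 = 1 :> R.
Proof. by rewrite mulfV // pnatr_eq0 -lt0n. Qed.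

Let mX : measurable_fun setT X.
Proof. by case: isoX. Qed.

Let mpert : measurable_fun setT (fun x : 'rV[R]_d => a - sigma *: x).
Proof. by apply: measurable_rVB => //; apply: measurable_rVZ. Qed.

Lemma measurable_perturbed : measurable_fun setT z.
Proof. exact: measurableT_comp mpert mX. Qed.

Local Open Scope ereal_scope.

(* Averaging over the noise and its opposite removes the odd terms, whose
   integrability would otherwise have to be treated separately. *)
Let symmetrize (F G : 'rV[R]_d -> R) (c : R) :
  measurable_fun setT F -> (forall x, (0 <= F x)%R) ->
  measurable_fun setT G ->
  (forall x, (F (a - sigma *: x) + F (a + sigma *: x) <= 2 * G x)%R) ->
  \int[P]_w (G (X w))%:E <= c%:E ->
  \int[P]_w (F (z w))%:E <= c%:E.
Proof.
move=> mF F0 mG FG Gc.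
have mFz : measurable_fun setT (fun x : 'rV[R]_d => (F (a - sigma *: x)%R)%:E).
  by apply/measurable_EFinP; exact: measurableT_comp mF mpert.
have I0 : 0 <= \int[P]_w (F (z w))%:E.
  by apply: integral_ge0 => w _; rewrite lee_fin.
have G0 x : (0 <= G x)%R by have := FG x; have := F0 (a - sigma *: x)%R;
  have := F0 (a + sigma *: x)%R; lra.
have Fopp : \int[P]_w (F (a + sigma *: X w)%R)%:E = \int[P]_w (F (z w))%:E.
  have := integral_isotropic_opp v0 isoX mFz.
  by under eq_integral do rewrite scalerN opprK.
have mFm : measurable_fun setT (fun w => (F (a + sigma *: X w)%R)%:E).
  apply/measurable_EFinP; apply: measurableT_comp mF _.
  by apply: measurable_rVD => //; exact: measurable_rVZ.
have mFzw : measurable_fun setT (fun w => (F (z w))%:E).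
  by apply/measurable_EFinP; exact: measurableT_comp mF measurable_perturbed.
have mGX : measurable_fun setT (fun w => (G (X w))%:E).
  by apply/measurable_EFinP; exact: measurableT_comp mG mX.
have : \int[P]_w (F (z w))%:E + \int[P]_w (F (z w))%:E <= (2 * c)%:E.
  rewrite -{2}Fopp -ge0_integralD //; first last.
  - by move=> w _; rewrite lee_fin.
  - by move=> w _; rewrite lee_fin.
  apply: (@le_trans _ _ (\int[P]_w (2%:E * (G (X w))%:E))).
    apply: ge0_le_integral => //.
    - by move=> w _; rewrite adde_ge0 // lee_fin.
    - exact: emeasurable_funD.
    - exact: emeasurable_funM.
    - by move=> w _; rewrite -EFinD -EFinM lee_fin FG.
  rewrite ge0_integralZl //; last by move=> w _; rewrite lee_fin.
  by rewrite [leRHS]EFinM; apply: lee_wpmul2l => //; rewrite lee_fin.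
case: (\int[P]_w _) I0 => [r||] // _.
by rewrite -EFinD !lee_fin; lra.
Qed.

Let dotv_pert x : dotv (a - sigma *: x)%R (a - sigma *: x)%R =
  (n2 + sigma ^+ 2 * dotv x x - 2 * sigma * dotv a x)%R.
Proof. by rewrite !dotvE (dotvC x a); ring. Qed.

Let dotv_pert' x : dotv (a + sigma *: x)%R (a + sigma *: x)%R =
  (n2 + sigma ^+ 2 * dotv x x + 2 * sigma * dotv a x)%R.
Proof. by rewrite !dotvE (dotvC x a); ring. Qed.

Let mdd : measurable_fun setT (fun x : 'rV[R]_d => dotv x x).
Proof. exact: measurable_dotv. Qed.

Let ddX1 : \int[P]_w (dotv (X w) (X w))%:E <= 1%:E.
Proof. by have := integral_dotvv_isotropic_le v0 isoX; rewrite dv. Qed.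

Let ddX2 : \int[P]_w (dotv (X w) (X w) ^+ 2)%:E <= 9%:E.
Proof.
by have := integral_dotvv_sqr_isotropic_le v0 isoX; rewrite dv expr1n mulr1.
Qed.

Let mddX : measurable_fun setT (fun w => dotv (X w) (X w)).
Proof. exact: measurable_dotv. Qed.

Let integral_quadratic (c0 c1 c2 : R) : (0 <= c0)%R -> (0 <= c1)%R -> (0 <= c2)%R ->
  \int[P]_w (c0 + c1 * dotv (X w) (X w) + c2 * dotv (X w) (X w) ^+ 2)%:E <=
  (c0 + c1 + 9 * c2)%:E.
Proof.
move=> h0 h1 h2.
have m1 : measurable_fun setT (fun w => (dotv (X w) (X w))%:E) by exact/measurable_EFinP.
have m2 : measurable_fun setT (fun w => (dotv (X w) (X w) ^+ 2)%:E).
  by apply/measurable_EFinP; exact: measurable_funX.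
have -> : \int[P]_w (c0 + c1 * dotv (X w) (X w) + c2 * dotv (X w) (X w) ^+ 2)%:E =
   c0%:E + c1%:E * \int[P]_w (dotv (X w) (X w))%:E + c2%:E * \int[P]_w (dotv (X w) (X w) ^+ 2)%:E.
  rewrite -!ge0_integralZl // => [|w _|w _]; rewrite ?lee_fin ?sqr_ge0 ?dotvv_ge0 //.
  have -> : c0%:E = \int[P]_w c0%:E :> \bar R.
    by rewrite integral_probability_cst.
  rewrite -!ge0_integralD //; try by [apply: emeasurable_funM | apply: emeasurable_funD => //; exact: emeasurable_funM | move=> w _; rewrite -?EFinM -?EFinD lee_fin ?addr_ge0 ?mulr_ge0 ?sqr_ge0 ?dotvv_ge0].
rewrite !EFinD; apply: leeD; first apply: leeD => //.
- rewrite -[leRHS]mule1; exact: lee_wpmul2l.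
- by rewrite muleC (mulrC 9%R) EFinM -[leLHS]muleC; exact: lee_wpmul2l.
Qed.

Lemma integral_perturbed_sqr_le :
  \int[P]_w (q w)%:E <= (n2 + sigma ^+ 2)%:E.
Proof.
apply: (@symmetrize (fun x => dotv x x) (fun x => n2 + sigma ^+ 2 * dotv x x)%R).
- exact: mdd.
- exact: dotvv_ge0.
- by apply: measurable_funD => //; exact: measurable_funM.
- by move=> x; rewrite dotv_pert dotv_pert'; lra.
have := @integral_quadratic n2 (sigma ^+ 2) 0 (dotvv_ge0 _) (sqr_ge0 _) (lexx _).
rewrite mulr0 addr0; under eq_integral do rewrite mul0r addr0; exact.
Qed.

(** The even part of the fourth power of the norm is a polynomial in the squared
    norm of the noise once its mixed term is bounded by the Cauchy-Schwarz
    inequality; the coefficients 6 and 9 then form a perfect square. *)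
Lemma integral_perturbed_pow4_le :
  \int[P]_w (q w ^+ 2)%:E <= ((n2 + 3 * sigma ^+ 2) ^+ 2)%:E.
Proof.
have n20 : (0 <= n2)%R by exact: dotvv_ge0.
have s20 := sqr_ge0 sigma.
apply: (@symmetrize (fun x => dotv x x ^+ 2)%R
  (fun x => n2 ^+ 2 + (6 * n2 * sigma ^+ 2) * dotv x x + sigma ^+ 4 * dotv x x ^+ 2)%R).
- by apply: measurable_funX; exact: mdd.
- by move=> x; exact: sqr_ge0.
- apply: measurable_funD.
    by apply: measurable_funD => //; apply: measurable_funM => //; exact: mdd.
  by apply: measurable_funM => //; apply: measurable_funX; exact: mdd.
- move=> x; rewrite dotv_pert dotv_pert'.
  by have := ler_wpM2l s20 (cauchy_schwarz a x); lra.
rewrite (_ : (_ + _) ^+ 2 = n2 ^+ 2 + 6 * n2 * sigma ^+ 2 + 9 * sigma ^+ 4)%R; last by ring.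
apply: integral_quadratic; first exact: sqr_ge0.
- by apply: mulr_ge0 => //; apply: mulr_ge0.
- exact: exprn_even_ge0.
Qed.

End perturbed_point.

(** * Real integrals against a probability *)

Section real_expectation.
Context {R : realType} dO (Omega : measurableType dO) (P : probability Omega R).
Implicit Types f g : Omega -> R.
Local Notation itg f := (P.-integrable setT (EFin \o f)).
Local Notation I f := (\int[P]_w f w).

Lemma integrable_real_le f g : measurable_fun setT f -> (forall w, `|f w| <= g w) -> itg g -> itg f.
Proof.
move=> mf fg; apply: le_integrable => //; first exact/measurable_EFinP.
by move=> w _ /=; rewrite lee_fin (le_trans (fg w)) // ler_norm.
Qed.

Lemma integrable_realD f g : itg f -> itg g -> itg (fun w => f w + g w).
Proof. by move=> hf hg; have := integrableD measurableT hf hg; apply: eq_integrable. Qed.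

Lemma integrable_realB f g : itg f -> itg g -> itg (fun w => f w - g w).
Proof. by move=> hf hg; have := integrableB measurableT hf hg; apply: eq_integrable. Qed.

Lemma integrable_realZ k f : itg f -> itg (fun w => k * f w).
Proof. by move=> hf; have := integrableZl measurableT k hf; apply: eq_integrable. Qed.

Lemma integrable_real_cst k : itg (fun=> k).
Proof. exact: finite_measure_integrable_cst. Qed.

Lemma integrable_real_ge0 f (c : R) : measurable_fun setT f -> (forall w, 0 <= f w) ->
  (\int[P]_w (f w)%:E <= c%:E)%E -> itg f /\ I f <= c.
Proof.
move=> mf f0 fc; have hf : itg f.
  apply/integrableP; split; first exact/measurable_EFinP.
  apply: le_lt_trans (ltry c); apply: le_trans fc.
  by under eq_integral do rewrite /= ger0_norm //.
split=> //; rewrite -lee_fin fineK //; exact: integrable_fin_num hf.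
Qed.

Lemma EFin_Rint f : itg f -> (\int[P]_w (f w)%:E)%E = (I f)%:E.
Proof. by move=> hf; rewrite fineK //; exact: integrable_fin_num hf. Qed.

Lemma RintD f g : itg f -> itg g -> I (fun w => f w + g w) = I f + I g.
Proof. exact: RintegralD. Qed.

Lemma RintB f g : itg f -> itg g -> I (fun w => f w - g w) = I f - I g.
Proof. exact: RintegralB. Qed.

Lemma RintZ k f : itg f -> I (fun w => k * f w) = k * I f.
Proof. by move=> hf; exact: RintegralZl. Qed.

Lemma Rint_cst k : I (fun=> k) = k.
Proof. by rewrite /Rintegral integral_probability_cst. Qed.

Lemma le_Rint f g : itg f -> itg g -> (forall w, f w <= g w) -> I f <= I g.
Proof. by move=> hf hg fg; apply: le_Rintegral. Qed.

End real_expectation.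

(** * Rescaling a Gaussian perturbation *)

Section rescaling.
Context {R : realType} {d : nat} dO (Omega : measurableType dO).
Variables (P : probability Omega R) (X : Omega -> 'rV[R]_d).
Hypotheses (d0 : (0 < d)%N) (isoX : isotropic_normal P X d%:R^-1).
Variables (a : 'rV[R]_d) (sigma : R).
Hypothesis sigma0 : 0 < sigma.
Local Notation z := (perturbed X a sigma).
Local Notation q w := (dotv (z w) (z w)).
Local Notation n2 := (dotv a a).
Local Notation N := (n2 / sigma ^+ 2).
Local Notation itg f := (P.-integrable setT (EFin \o f)).
Local Notation I f := (\int[P]_w f w).

Let v0 : 0 < d%:R^-1 :> R.
Proof. by rewrite invr_gt0 ltr0n. Qed.

Let mX : measurable_fun setT X.
Proof. by case: isoX. Qed.

Let mz : measurable_fun setT z.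
Proof. exact: measurable_perturbed isoX a sigma. Qed.

Let mq : measurable_fun setT (fun w => q w).
Proof. exact: measurable_dotv. Qed.

(** The density of the law of [(1 + h) *: z] with respect to the law of [z]. *)
Definition rescaling_ratio h w : R :=
  isotropic_ratio d%:R^-1 (1 + h) (- (h / sigma) *: a) (X w).
Local Notation rho := rescaling_ratio.

Lemma rescaling_ratio_ge0 h w : 0 <= rho h w.
Proof. exact: isotropic_ratio_ge0. Qed.

Lemma measurable_rescaling_ratio h : measurable_fun setT (rho h).
Proof. exact: measurable_isotropic_ratio isoX _ _. Qed.

Lemma integral_rescaling h (F : 'rV[R]_d -> R) : 0 < h -> measurable_fun setT F ->
  I (fun w => F ((1 + h) *: z w)) = I (fun w => F (z w) * rho h w).
Proof.
move=> h0 mF; rewrite /Rintegral; congr fine.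
have t0 : 1 + h != 0 by rewrite gt_eqF // addr_gt0.
have mFz : measurable_fun setT (fun x : 'rV[R]_d => (F (a - sigma *: x))%:E).
  apply/measurable_EFinP; apply: measurableT_comp => //.
  by apply: measurable_rVB => //; exact: measurable_rVZ.
have E w : (1 + h) *: z w = a - sigma *: ((1 + h) *: X w + - (h / sigma) *: a).
  by apply/rowP => i; rewrite !mxE; field; exact: lt0r_neq0.
under eq_integral do rewrite E.
apply: etrans (integral_isotropic_affine v0 isoX (- (h / sigma) *: a) t0 mFz) _.
by apply: eq_integral => w _; rewrite -EFinM.
Qed.

(** An upper bound for the exponential growth rate, in [h ^+ 2], of the second
    moment of the likelihood ratio; its limit at 0 is the Fisher information of
    the dilation. *)
Definition rescaling_rate h : R := d%:R * ((2 + h) ^+ 2 / (2 * (1 - (h * (2 + h)) ^+ 2)) +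
   N / (1 - h * (2 + h))).

Lemma cvg_rescaling_rate : rescaling_rate h @[h --> (0 : R)] --> d%:R * (2 + N).
Proof.
have c0 : (h : R) @[h --> (0 : R)] --> (0 : R) by exact: cvg_id.
have c2 : 2 + h @[h --> (0 : R)] --> (2 + 0 : R) by apply: cvgD => //; exact: cvg_cst.
have cp : h * (2 + h) @[h --> (0 : R)] --> (0 * (2 + 0) : R) by exact: cvgM.
have cp2 : (h * (2 + h)) ^+ 2 @[h --> (0 : R)] --> ((0 * (2 + 0)) ^+ 2 : R).
  by rewrite expr2; under eq_fun do rewrite expr2; exact: cvgM.
have c22 : (2 + h) ^+ 2 @[h --> (0 : R)] --> ((2 + 0) ^+ 2 : R).
  by rewrite expr2; under eq_fun do rewrite expr2; exact: cvgM.
have cc (c : R) : c @[_ --> (0 : R)] --> c by exact: cvg_cst.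
have -> : d%:R * (2 + N) = d%:R * ((2 + 0) ^+ 2 / (2 * (1 - (0 * (2 + 0)) ^+ 2)) +
   N / (1 - 0 * (2 + 0))).
  by rewrite addr0 mul0r expr0n /= !subr0 mulr1 divr1 expr2 mulfK.
rewrite /rescaling_rate.
apply: cvgM => //; apply: cvgD; apply: cvgM => //; apply: cvgV.
- by rewrite mul0r expr0n /= subr0 mulr1.
- by apply: cvgM => //; exact: cvgB.
- by rewrite mul0r subr0 oner_eq0.
- exact: cvgB.
Qed.

Let dr : d%:R != 0 :> R.
Proof. by rewrite pnatr_eq0 -lt0n. Qed.

(** With [p = h * (2 + h)], the closed form of the second moment is a power of
    [(1 - p ^+ 2)^-1], bounded by an exponential through [1 + x <= expR x],
    times the exponential contributed by the translation. *)
Lemma integral_rescaling_ratio_sqr h : 0 < h -> h <= 4^-1 ->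
  (\int[P]_w (rho h w ^+ 2)%:E <= (expR (h ^+ 2 * rescaling_rate h))%:E)%E.
Proof.
move=> h0 h4; have t0 : 0 < 1 + h by lra.
have t2 : (1 + h) ^+ 2 < 2 by nra.
rewrite integral_isotropic_ratio_sqr // lee_fin.
set p := h * (2 + h).
have p0 : 0 < p by rewrite /p mulr_gt0 // addr_gt0.
have p1 : p < 1 by rewrite /p; nra.
have u1 : 0 < 1 - p ^+ 2 by nra.
have tp : 2 - (1 + h) ^+ 2 = 1 - p by rewrite /p; ring.
have tq : ((1 + h) * Num.sqrt (2 - (1 + h) ^+ 2)) = Num.sqrt (1 - p ^+ 2).
  rewrite tp -{1}(ger0_norm (ltW t0)) -sqrtr_sqr -sqrtrM ?sqr_ge0 //.
  by congr Num.sqrt; rewrite /p; ring.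
rewrite tq tp.
have -> : h ^+ 2 * rescaling_rate h =
    (p ^+ 2 / (2 * (1 - p ^+ 2))) *+ d + h ^+ 2 * (d%:R * (N / (1 - p))).
  rewrite /rescaling_rate -/p -mulr_natr /p; field.
  by rewrite -/p (gt_eqF u1) (gt_eqF sigma0) subr_eq0 (gt_eqF p1).
rewrite expRD; apply: ler_pM; rewrite ?expR_ge0 // ?invr_ge0 ?exprn_ge0 ?sqrtr_ge0 //.
  rewrite -mulr_natr expRM_natr -exprVn lerXn2r ?nnegrE ?expR_ge0 ?invr_ge0 ?sqrtr_ge0 //.
  rewrite -(@ler_pXn2r _ 2) ?nnegrE ?expR_ge0 ?invr_ge0 ?sqrtr_ge0 //.
  rewrite exprVn sqr_sqrtr ?(ltW u1) // -expRM_natr.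
  apply: le_trans (expR_ge1Dx _); rewrite le_eqVlt; apply/orP; left; apply/eqP.
  by field; rewrite gt_eqF.
rewrite ler_expR !dotvE le_eqVlt; apply/orP; left; apply/eqP.
by field; rewrite dr !gt_eqF ?subr_gt0.
Qed.

(** The ratio has mean one, so its variance is its second moment minus one; it
    is of the order of [h ^+ 2], which is why the mean increment of a quadratically
    bounded function under a dilation is of the order of [h]. *)
Lemma integral_rescaling_ratio_dev h : 0 < h -> h <= 4^-1 ->
  itg (rho h) /\ itg (fun w => (rho h w - 1) ^+ 2) /\
  I (fun w => (rho h w - 1) ^+ 2) <= h ^+ 2 * (rescaling_rate h * expR (h ^+ 2 * rescaling_rate h)).
Proof.
move=> h0 h4; have t0 : 1 + h != 0 by rewrite gt_eqF // addr_gt0.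
have mr := measurable_rescaling_ratio h.
have r0 := rescaling_ratio_ge0 h.
have [ir2 r2] := integrable_real_ge0 (measurable_funX 2 mr) (fun w => sqr_ge0 _)
  (integral_rescaling_ratio_sqr h0 h4).
have i1 := integral_isotropic_ratio v0 isoX (- (h / sigma) *: a) t0.
have [ir1 _] : itg (rho h) /\ I (rho h) <= 1 by apply: integrable_real_ge0 => //; rewrite i1.
have r1 : I (rho h) = 1 by rewrite /Rintegral i1.
have E : (fun w => (rho h w - 1) ^+ 2) = (fun w => (rho h w ^+ 2 - 2 * rho h w) + 1).
  by apply/funext => w; ring.
have i2 : itg (fun w => rho h w ^+ 2 - 2 * rho h w) by apply: integrable_realB => //; exact: integrable_realZ.
split=> //; split; first by rewrite E; apply: integrable_realD => //; exact: integrable_real_cst.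
rewrite E RintD //; last exact: integrable_real_cst.
rewrite RintB ?RintZ ?Rint_cst ?r1 //; last exact: integrable_realZ.
set e := expR _ in r2 *.
have h1 : 1 - h ^+ 2 * rescaling_rate h <= e^-1.
  by rewrite -expRN; apply: le_trans (expR_ge1Dx _); rewrite lexx.
have e0 : 0 < e by exact: expR_gt0.
have : e * (1 - h ^+ 2 * rescaling_rate h) <= 1 by rewrite mulrC -ler_pdivlMr // div1r.
lra.
Qed.

End rescaling.

Lemma measurable_grad {R : realType} {d : nat} (f : 'rV[R]_d -> R) :
  C1 f -> measurable_fun setT (grad f).
Proof.
case=> _ cg; apply/measurable_rVP => i; apply: continuous_measurable_rV => x.
have cc : {for grad f x, continuous (fun v : 'rV[R]_d => v 0 i)}.
  exact: coord_continuous.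
exact: (cvg_comp (grad f) (fun v : 'rV[R]_d => v 0 i) (@cg x) cc).
Qed.

(** * Smoothing the deviation from strong convexity *)

Section smoothed_strong_convexity.
Context {R : realType} {d : nat} dO (Omega : measurableType dO).
Variables (P : probability Omega R) (X : Omega -> 'rV[R]_d).
Hypotheses (d0 : (0 < d)%N) (isoX : isotropic_normal P X d%:R^-1).
Variables (a : 'rV[R]_d) (sigma : R).
Hypothesis sigma0 : 0 < sigma.
Variables (f fbar : 'rV[R]_d -> R) (xstar : 'rV[R]_d) (alpha L delta : R).
Hypotheses (f_C1 : C1 f) (L0 : 0 < L) (delta0 : 0 <= delta) (alpha0 : 0 <= alpha).
Hypothesis f_grad : forall x, enorm (grad f x) <= L * enorm (x - xstar).
Hypothesis fbar_sc : one_point_strongly_convex alpha xstar (f xstar) fbar.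
Hypothesis f_fbar : forall x, `|f x - fbar x| <= delta / 2 * enorm (x - xstar) ^+ 2.
Local Notation z := (perturbed X a sigma).
Local Notation q w := (dotv (z w) (z w)).
Local Notation n2 := (dotv a a).
Local Notation N := (n2 / sigma ^+ 2).
Local Notation itg f := (P.-integrable setT (EFin \o f)).
Local Notation I f := (\int[P]_w f w).
Local Notation rho := (rescaling_ratio X a sigma).
Local Notation M := (n2 + 3 * sigma ^+ 2).

Let df x : differentiable f x.
Proof. by case: f_C1. Qed.

Let mz : measurable_fun setT z.
Proof. exact: measurable_perturbed isoX a sigma. Qed.

Let mq : measurable_fun setT (fun w => q w).
Proof. exact: measurable_dotv. Qed.

Let itgq : itg (fun w => q w) /\ I (fun w => q w) <= n2 + sigma ^+ 2.
Proof.
apply: integrable_real_ge0 => //; first by move=> w; exact: dotvv_ge0.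
exact: integral_perturbed_sqr_le.
Qed.

Let itgq2 : itg (fun w => q w ^+ 2) /\ I (fun w => q w ^+ 2) <= M ^+ 2.
Proof.
apply: integrable_real_ge0 => //; first exact: measurable_funX.
  by move=> w; exact: sqr_ge0.
exact: integral_perturbed_pow4_le.
Qed.

Let cf : continuous f.
Proof. exact: differentiable_continuousT. Qed.

Let cfbar : continuous fbar.
Proof. by case: fbar_sc => -[h _] _ _; exact: differentiable_continuousT. Qed.

Let mf : measurable_fun setT f.
Proof. exact: continuous_measurable_rV. Qed.

Let mfbar : measurable_fun setT fbar.
Proof. exact: continuous_measurable_rV. Qed.

Let shifted (F : 'rV[R]_d -> R) : measurable_fun setT F ->
  measurable_fun setT (fun x => F (xstar + x)).
Proof.
by move=> mF; apply: measurableT_comp => //; exact: measurable_rVD.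
Qed.

Let g x := f (xstar + x) - fbar (xstar + x).

Let mg : measurable_fun setT g.
Proof. by apply: measurable_funB; exact: shifted. Qed.

Let g_le x : `|g x| <= delta / 2 * dotv x x.
Proof. by have := f_fbar (xstar + x); rewrite addrAC subrr add0r enorm_sqr. Qed.

Let phi h w := f (xstar + (1 + h) *: z w) - f (xstar + z w).

Let mphi h : measurable_fun setT (phi h).
Proof.
apply: measurable_funB; apply: (measurableT_comp (shifted mf)) => //.
exact: measurable_rVZ.
Qed.

Let phi_le h w : 0 < h -> h <= 1 -> `|phi h w| <= h * (2 * L * q w).
Proof.
move=> h0 h1.
have bnd x : `|dotv (grad f x) (x - xstar)| <= L * enorm (x - xstar) ^+ 2.
  apply: le_trans (ler_dotv _ _) _; rewrite expr2 mulrA.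
  by rewrite ler_wpM2r ?enorm_ge0.
have up x : dotv (grad f x) (x - xstar) <= L * enorm (x - xstar) ^+ 2.
  exact: le_trans (ler_norm _) (bnd x).
have lo x : - L * enorm (x - xstar) ^+ 2 <= dotv (grad f x) (x - xstar).
  by have := bnd x; rewrite ler_norml mulNr => /andP[].
have h1' : 1 <= 1 + h by lra.
have := ray_growth_le (z w) df up ler01 h1'.
have := ray_growth (z w) df lo ler01 h1'.
rewrite scale1r enorm_sqr -/(phi h w) => l u.
have q0 := dotvv_ge0 (z w).
have hq : 0 <= h * L * q w * (1 - h) by rewrite !mulr_ge0 ?subr_ge0 // ltW.
by rewrite ler_norml; apply/andP; split; nra.
Qed.

Let itgphi h : 0 < h -> h <= 1 -> itg (phi h).
Proof.
move=> h0 h1; apply: (integrable_real_le _ (fun w => phi_le w h0 h1)) => //.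
by apply: integrable_realZ; apply: integrable_realZ; case: itgq.
Qed.

Let gz w := g (z w).

Let mgz : measurable_fun setT gz.
Proof. exact: measurableT_comp. Qed.

Let itggz : itg gz.
Proof.
apply: (integrable_real_le _ (fun w => g_le (z w))) => //.
by apply: integrable_realZ; case: itgq.
Qed.

Let itggtz h : itg (fun w => g ((1 + h) *: z w)).
Proof.
apply: (@integrable_real_le _ _ _ _ _ (fun w => delta / 2 * (1 + h) ^+ 2 * q w)).
- by apply: measurableT_comp => //; exact: measurable_rVZ.
- by move=> w; apply: le_trans (g_le _) _; rewrite !dotvE expr2 !mulrA.
- by apply: integrable_realZ; case: itgq.
Qed.

Let dev h := I (fun w => (rho h w - 1) ^+ 2).

Let young (b c s : R) : 0 < s -> `|b * c| <= (s * b ^+ 2 + c ^+ 2 / s) / 2.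
Proof.
move=> s0; have s1 : s * s^-1 = 1 by rewrite mulfV // gt_eqF.
have h1 : 0 <= s^-1 * (s * b - c) ^+ 2 by rewrite mulr_ge0 ?sqr_ge0 ?invr_ge0 // ltW.
have h2 : 0 <= s^-1 * (s * b + c) ^+ 2 by rewrite mulr_ge0 ?sqr_ge0 ?invr_ge0 // ltW.
have E (e : R) : s^-1 * (s * b + e * c) ^+ 2 =
    s * s^-1 * (s * b ^+ 2) + 2 * e * (s * s^-1) * (b * c) + e ^+ 2 * (c ^+ 2 / s) by ring.
have := E 1; have := E (-1); rewrite s1 !mul1r mulN1r => e1 e2.
by rewrite ler_norml; apply/andP; split; lra.
Qed.

(* The increment of f splits into that of fbar, which is radially monotone, and
   that of the deviation g. The change of variables moves the dilation from g, of
   which only the size is known, to the Gaussian density; theta is the free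
   parameter of the arithmetic-geometric inequality. *)
Let rescaling_increment h theta : 0 < h -> h <= 4^-1 -> 0 < theta ->
  alpha * h * I (fun w => q w)
    - delta / 4 * (h * theta * I (fun w => q w ^+ 2) + dev h / (h * theta))
  <= I (phi h).
Proof.
move=> h0 h4 th0; have h1 : h <= 1 by lra.
have [iq _] := itgq; have [iq2 _] := itgq2.
have [ir [ir2 _]] := integral_rescaling_ratio_dev d0 isoX a sigma0 h0 h4.
have ht : 0 < h * theta by exact: mulr_gt0.
have mr := measurable_rescaling_ratio isoX a sigma h.
pose bd w := delta / 4 * (h * theta * q w ^+ 2 + (rho h w - 1) ^+ 2 / (h * theta)).
have ibd : itg bd.
  apply: integrable_realZ; apply: integrable_realD; first exact: integrable_realZ.
  by have := integrable_realZ (h * theta)^-1 ir2; apply: eq_integrable => // w _ /=; rewrite mulrC.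
have grho w : `|gz w * (rho h w - 1)| <= bd w.
  rewrite normrM; apply: (@le_trans _ _ (delta / 2 * (q w * `|rho h w - 1|))).
    by rewrite mulrA ler_wpM2r // g_le.
  have := young (q w) (rho h w - 1) ht.
  rewrite normrM (ger0_norm (dotvv_ge0 _)) => /(ler_wpM2l delta0).
  by rewrite /bd; lra.
have igr : itg (fun w => gz w * (rho h w - 1)).
  apply: (integrable_real_le _ grho) => //; apply: measurable_funM => //.
  exact: measurable_funB.
have Egr : I (fun w => g ((1 + h) *: z w)) - I gz = I (fun w => gz w * (rho h w - 1)).
  rewrite (integral_rescaling d0 isoX _ sigma0) // -RintB //.
    by congr Rintegral; apply/funext => w; rewrite /gz; ring.
  have := integrable_realD igr itggz; apply: eq_integrable => // w _ /=.
  by congr EFin; rewrite /gz; ring.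
have lb : - I bd <= I (fun w => gz w * (rho h w - 1)).
  have -> : - I bd = I (fun w => -1 * bd w) by rewrite (RintZ (-1) ibd) mulN1r.
  apply: le_Rint => //; first exact: integrable_realZ.
  by move=> w; have := grho w; rewrite ler_norml mulN1r => /andP[].
have Ebd : I bd = delta / 4 * (h * theta * I (fun w => q w ^+ 2) + dev h / (h * theta)).
  have i2 : itg (fun w => (h * theta)^-1 * (rho h w - 1) ^+ 2) by exact: integrable_realZ.
  have -> : bd = fun w => delta / 4 * (h * theta * q w ^+ 2 + (h * theta)^-1 * (rho h w - 1) ^+ 2).
    by apply/funext => w; rewrite /bd; congr (_ * (_ + _)); exact: mulrC.
  rewrite RintZ; last by apply: integrable_realD => //; exact: integrable_realZ.
  rewrite RintD //; last exact: integrable_realZ.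
  by rewrite !RintZ // /dev; congr (_ * (_ + _)); exact: mulrC.
pose rhs w := alpha * h * q w + (g ((1 + h) *: z w) - gz w).
have irhs : itg rhs by apply: integrable_realD; [exact: integrable_realZ|apply: integrable_realB].
have : I rhs <= I (phi h).
  apply: le_Rint => //; first exact: itgphi.
  move=> w; have h1' : 1 <= 1 + h by lra.
  have := strongly_convex_radial (z w) fbar_sc ler01 h1'.
  rewrite scale1r enorm_sqr /rhs /gz /g /phi => sc.
  have hq : 0 <= alpha * h ^+ 2 * q w
    by apply: mulr_ge0; [apply: mulr_ge0 => //; exact: sqr_ge0|exact: dotvv_ge0].
  by nra.
rewrite /rhs RintD //; [|exact: integrable_realZ|exact: integrable_realB].
rewrite RintZ // RintB // Egr; lra.
Qed.

Let D w := dotv (grad f (xstar + z w)) (z w).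

Let mD : measurable_fun setT D.
Proof.
apply: measurable_dotv => //; apply: (measurableT_comp (measurable_grad f_C1)).
exact: measurable_rVD.
Qed.

(* the shift by 3 keeps the step below 4^-1, where the second moment of the
   likelihood ratio is controlled *)
Let step k : R := harmonic (k + 3)%N.

Let step_gt0 k : 0 < step k.
Proof. exact: harmonic_gt0. Qed.

Let step_le k : step k <= 4^-1.
Proof. by rewrite /step /= lef_pV2 ?posrE ?ltr0n // ler_nat addn3. Qed.

Let cvg_step : step k @[k --> \oo] --> (0 : R).
Proof. exact: (cvg_comp (addn^~ 3)%N (harmonic : nat -> R) (cvg_addnr 3) (@cvg_harmonic R)). Qed.

Let cvg_step_right : step k @[k --> \oo] --> (0 : R)^'+.
Proof.
move=> A /= hA; have := cvg_step hA; rewrite /nbhs /=.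
by apply: filterS => k; apply.
Qed.

Let cvg_quotient w : (step k)^-1 * phi (step k) w @[k --> \oo] --> D w.
Proof.
have [dpsi psiE] := is_derive_ray xstar (z w) 1 df.
rewrite scale1r -/(D w) in psiE.
have qD := cvg_dnbhs_at_right dpsi; rewrite /derive in psiE; rewrite psiE in qD.
have := cvg_comp step _ (@cvg_step_right) qD; apply: cvg_trans.
apply: near_eq_cvg; apply: nearW => k /=.
by rewrite /phi scale1r /GRing.scale /= mulr1 (addrC _ 1).
Qed.

Let cvg_integral_quotient :
  (step k)^-1 * I (phi (step k)) @[k --> \oo] --> I D.
Proof.
pose f_ k w := ((step k)^-1 * phi (step k) w)%:E.
have step1 k : step k <= 1 by have := step_le k; lra.
have itgf k : itg (fun w => (step k)^-1 * phi (step k) w).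
  by apply: integrable_realZ; exact: itgphi.
have igL : itg (fun w => 2 * L * q w) by apply: integrable_realZ; case: itgq.
have [] := @dominated_convergence _ _ _ P setT measurableT f_ (EFin \o D)
  (fun w => (2 * L * q w)%:E).
- by move=> k; case/integrableP: (itgf k).
- exact/measurable_EFinP.
- apply: aeW => w _; apply: cvg_EFin; first exact: nearW.
  exact: cvg_quotient.
- exact: igL.
- apply: aeW => w k _ /=; rewrite lee_fin normrM gtr0_norm ?invr_gt0 //.
  by rewrite ler_pdivrMl //; exact: phi_le.
move=> iD _; rewrite EFin_Rint // => /fine_cvg; apply: cvg_trans.
apply: near_eq_cvg; apply: nearW => k /=.
by rewrite -RintZ //; exact: itgphi.
Qed.

Let C := d%:R * (2 + N).

Let cvg_bound (c1 c2 c3 theta : R) :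
  c1 - c2 * (theta * c3 + rescaling_rate a sigma (step k) *
    expR (step k ^+ 2 * rescaling_rate a sigma (step k)) / theta) @[k --> \oo]
  --> c1 - c2 * (theta * c3 + C / theta).
Proof.
have cr : rescaling_rate a sigma (step k) @[k --> \oo] --> C.
  exact: (cvg_comp step _ (@cvg_step) (@cvg_rescaling_rate R d a sigma)).
have cc (c : R) : c @[_ --> \oo] --> c by exact: cvg_cst.
have ce : expR (step k ^+ 2 * rescaling_rate a sigma (step k)) @[k --> \oo] --> (1 : R).
  have cs2 : step k ^+ 2 @[k --> \oo] --> (0 * 0 : R).
    have -> : (fun k => step k ^+ 2) = (fun k => step k * step k).
      by apply/funext => k; rewrite expr2.
    exact: (cvgM (@cvg_step) (@cvg_step)).
  have cv : step k ^+ 2 * rescaling_rate a sigma (step k) @[k --> \oo] --> 0 * 0 * C.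
    exact: cvgM cs2 cr.
  have := cvg_comp (fun k => step k ^+ 2 * rescaling_rate a sigma (step k)) expR
    (@cv) (@continuous_expR _ _).
  by rewrite mul0r mul0r expR0.
rewrite -[in X in _ --> X](mulr1 C).
apply: cvgB => //; apply: cvgM => //; apply: cvgD => //; apply: cvgM => //.
exact: cvgM.
Qed.

(** Gaussian smoothing turns closeness of values into closeness of radial
    derivatives: nothing is known about the gradient of [f - fbar], yet the mean
    radial derivative of [f] at the perturbed point falls short of that of a
    strongly convex function by a multiple of [delta] only. The bound is the limit
    of the increments under dilations by [1 + h], divided by [h]. *)
Lemma integral_grad_perturbed_ge :
  alpha * I (fun w => q w) - delta / 2 * (Num.sqrt (d%:R * (2 + N)) * M) <=
  I (fun w => dotv (grad f (xstar + z w)) (z w)).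
Proof.
have n20 := dotvv_ge0 a.
have M0 : 0 < M by rewrite ltr_wpDl // mulr_gt0 // exprn_gt0.
have N0 : 0 <= N by rewrite divr_ge0 ?sqr_ge0.
have C0 : 0 < C by rewrite mulr_gt0 ?ltr0n // ltr_wpDr.
pose S := Num.sqrt C; have S0 : 0 < S by rewrite sqrtr_gt0.
have SE : S ^+ 2 = C by rewrite sqr_sqrtr // ltW.
(* the choice of theta that balances the two terms in the limit *)
pose theta := S / M; have th0 : 0 < theta by rewrite divr_gt0.
have -> : delta / 2 * (S * M) = delta / 4 * (theta * M ^+ 2 + C / theta).
  by rewrite -SE /theta; field; rewrite !gt_eqF.
have cb := @cvg_bound (alpha * I (fun w => q w)) (delta / 4) (M ^+ 2) theta.
apply: (ler_cvg_to cb (@cvg_integral_quotient)).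
apply: nearW => k; set h := step k; have h0 : 0 < h := step_gt0 k.
have h4 : h <= 4^-1 := step_le k.
rewrite [leRHS]mulrC ler_pdivlMr //.
apply: le_trans (rescaling_increment h0 h4 th0).
have [_ [_ hdev]] := integral_rescaling_ratio_dev d0 isoX a sigma0 h0 h4.
have [_ hq2] := itgq2.
set r := rescaling_rate _ _ _ * _ in hdev *.
have h1 : dev h / (h * theta) <= h * (r / theta).
  rewrite ler_pdivrMr; last exact: mulr_gt0.
  by rewrite (_ : h * (r / theta) * (h * theta) = h ^+ 2 * r) //; field; rewrite gt_eqF.
have h2 : h * theta * I (fun w => q w ^+ 2) <= h * theta * M ^+ 2.
  by rewrite ler_wpM2l // mulr_ge0 // ltW.
have : delta / 4 * (h * theta * I (fun w => q w ^+ 2) + dev h / (h * theta)) <=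
   delta / 4 * (h * theta * M ^+ 2 + h * (r / theta)).
  by rewrite ler_wpM2l ?divr_ge0 // lerD.
lra.
Qed.

End smoothed_strong_convexity.

(** * One noisy step *)

Section step_arithmetic.
Context {R : realType}.

(** The error of the smoothed strong convexity is absorbed by the contraction.
    Here [n2] is the squared distance before the noise, [v] the squared noise level,
    [vD] its part due to the gap below the minimum, [k3] the cube of [alpha / L],
    and [e] the relative error. The hypothesis on [e] bounds it by a function of
    [n2 / v], and a step function with jumps at 48/5 and 5/2 is a sharp enough
    majorant of it. *)
Lemma step_arithmetic (n2 v vD e k3 : R) : 0 <= n2 -> 0 < v -> 0 <= e ->
  e ^+ 2 * v <= (33 / 32 / 4) ^+ 2 * (k3 * (2 * v + n2)) -> 0 <= k3 -> k3 <= 1 ->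
  k3 * n2 <= 13 * v -> 0 <= vD -> v - 8 / 75 * n2 <= vD ->
  2 / 5 * (e * (n2 + 3 * v)) <= 10 / 19 * n2 + 13 / 15 * vD.
Proof.
move=> n0 v0 e0 ee k0 k1 kn vD0 vD1.
have bnd (c : R) : 0 <= c -> e ^+ 2 * v <= c ^+ 2 * v -> e <= c.
  by move=> c0; rewrite ler_pM2r // ler_pXn2r.
have kv : k3 * v <= v by rewrite ler_piMl // ltW.
have kn2 : k3 * n2 <= n2 by rewrite ler_piMl.
have absorbed (c : R) : e <= c -> 2 / 5 * (c * (n2 + 3 * v)) <= 10 / 19 * n2 + 13 / 15 * vD ->
    2 / 5 * (e * (n2 + 3 * v)) <= 10 / 19 * n2 + 13 / 15 * vD.
  move=> ec; apply: le_trans; rewrite ler_wpM2l // ler_wpM2r //.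
  by rewrite addr_ge0 // mulr_ge0 // ltW.
have [hA|hA] := leP (48 / 5 * v) n2.
  apply: (absorbed (1)); last lra.
  by apply: bnd; [lra|lra].
have [hB|hB] := leP (5 / 2 * v) n2.
  apply: (absorbed (22 / 25)); last lra.
  by apply: bnd; [lra|lra].
apply: (absorbed (11 / 20)); last lra.
by apply: bnd; [lra|lra].
Qed.

End step_arithmetic.

Section noisy_step.
Context {R : realType} {d : nat} dO (Omega : measurableType dO).
Variables (P : probability Omega R) (X : Omega -> 'rV[R]_d).
Hypotheses (d0 : (0 < d)%N) (isoX : isotropic_normal P X d%:R^-1).
Variables (f : 'rV[R]_d -> R) (xstar : 'rV[R]_d) (alpha L : R).
Hypotheses (alpha0 : 0 < alpha) (alphaL : alpha <= L).
Hypothesis f_C1 : C1 f.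
Hypothesis f_grad : forall x, enorm (grad f x) <= L * enorm (x - xstar).
Hypothesis f_dev : (sc_deviation f xstar alpha <=
  (4^-1 * Num.sqrt (alpha ^+ 5 / (d%:R * L ^+ 3)))%:E)%E.
Variables (eta lambda s flb : R).
Hypotheses (etaE : eta = 2 * alpha / (5 * L ^+ 2))
  (lambdaE : lambda = 2 * alpha - eta * L ^+ 2) (sE : s = lambda / (3 * L))
  (flb_le : flb <= f xstar).

Let L0 : 0 < L. Proof. exact: lt_le_trans alphaL. Qed.

Lemma etaL2 : eta * L ^+ 2 = 2 / 5 * alpha.
Proof. by rewrite etaE; field; rewrite gt_eqF. Qed.

Lemma lambda_alpha : lambda = 8 / 5 * alpha.
Proof. by rewrite lambdaE etaL2; field. Qed.

Lemma eta_gt0 : 0 < eta.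
Proof. by rewrite etaE divr_gt0 ?mulr_gt0 // exprn_gt0. Qed.

Let k : R := alpha / L.

Let k0 : 0 < k. Proof. exact: divr_gt0. Qed.

Let k1 : k <= 1. Proof. by rewrite ler_pdivrMr // mul1r. Qed.

Let k31 : k ^+ 3 <= 1. Proof. by rewrite exprn_ile1 // ltW. Qed.

(* A radius slightly above the infimum, so that it is realised by a strongly convex
   function; the factor 33/32 leaves room in the arithmetic of the step. *)
Let delta : R := 33 / 32 * (4^-1 * Num.sqrt (alpha ^+ 5 / (d%:R * L ^+ 3))).

Let dR : 0 < d%:R :> R. Proof. by rewrite ltr0n. Qed.

Let delta0 : 0 < delta.
Proof.
by rewrite /delta !mulr_gt0 // sqrtr_gt0 divr_gt0 ?exprn_gt0 // mulr_gt0 // exprn_gt0.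
Qed.

Let delta_sqr : delta ^+ 2 * d%:R = (33 / 32 / 4) ^+ 2 * (alpha ^+ 2 * k ^+ 3).
Proof.
have arg0 : 0 <= alpha ^+ 5 / (d%:R * L ^+ 3).
  by apply: ltW; rewrite divr_gt0 ?exprn_gt0 // mulr_gt0 // exprn_gt0.
rewrite /delta mulrA exprMn sqr_sqrtr // /k; field.
by rewrite !gt_eqF.
Qed.

Let delta_le : delta <= 33 / 32 / 4 * alpha.
Proof.
apply: le_of_sqr_le; first by apply: mulr_ge0; [lra|exact: ltW].
apply: (@le_trans _ _ (delta ^+ 2 * d%:R)).
  by rewrite ler_peMr ?sqr_ge0 // ler1n.
rewrite delta_sqr [leRHS]exprMn ler_wpM2l ?sqr_ge0 //.
by rewrite ler_piMr ?sqr_ge0.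
Qed.

Let dev_lt : (sc_deviation f xstar alpha < delta%:E)%E.
Proof.
apply: le_lt_trans f_dev _; rewrite lte_fin /delta ltr_pMl; first lra.
by rewrite mulr_gt0 // sqrtr_gt0 divr_gt0 ?exprn_gt0 // mulr_gt0 // exprn_gt0.
Qed.

Definition gradient_step x : 'rV[R]_d := x - eta *: grad f x.

Lemma eta_lambda : eta * lambda = 16 / 25 * k ^+ 2.
Proof. by rewrite lambda_alpha etaE /k; field; rewrite gt_eqF. Qed.

Lemma noise_factor : eta * s = 16 / 75 * (k ^+ 2 / L).
Proof. by rewrite sE lambda_alpha etaE /k; field; rewrite gt_eqF. Qed.

Let noise_factor0 : 0 < eta * s.
Proof. by rewrite noise_factor mulr_gt0 // divr_gt0 // exprn_gt0. Qed.

Let step_expand x : dotv (gradient_step x - xstar) (gradient_step x - xstar) <=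
  (1 + eta ^+ 2 * L ^+ 2) * dotv (x - xstar) (x - xstar)
    - 2 * eta * dotv (grad f x) (x - xstar).
Proof.
have g2 : dotv (grad f x) (grad f x) <= L ^+ 2 * dotv (x - xstar) (x - xstar).
  rewrite -!enorm_sqr -exprMn lerXn2r ?nnegrE ?mulr_ge0 ?enorm_ge0 //.
  exact: ltW.
rewrite /gradient_step addrAC; move: (x - xstar) (grad f x) g2 => u g g2.
by have := ler_wpM2l (sqr_ge0 eta) g2; rewrite !dotvE (dotvC u g); lra.
Qed.

Let sigma xh := Num.sqrt (eta * s * Num.max (f xh - flb) 0).

(** The gradient step contracts by [1 - eta * lambda] for a function that is
    exactly one-point strongly convex. The deviation costs an error that grows as
    the noise decreases, but the noise level is tied to [f xh - flb], which is at
    least of the order of the squared distance: the error takes up all but a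
    fraction of the contraction, and what is not covered is charged to
    [f xstar - flb]. When the noise vanishes, [xh] is the minimizer and there is
    nothing to prove. *)
Lemma noisy_step xh :
  (\int[P]_w (enorm (gradient_step (xh - sigma xh *: X w) - xstar) ^+ 2)%:E <=
   ((1 - eta * lambda / 100) * enorm (xh - xstar) ^+ 2 +
    eta * s * (1 + 5 * (eta * lambda) / 14) * (f xstar - flb))%:E)%E.
Proof.
have alpha_gt0 := alpha0.
set a := xh - xstar; set n2 := enorm a ^+ 2; set Delta := f xstar - flb.
have Delta0 : 0 <= Delta by rewrite subr_ge0.
have n20 : 0 <= n2 by exact: sqr_ge0.
have c20 : 0 < k ^+ 2 by rewrite exprn_gt0.
have c21 : k ^+ 2 <= 1 by rewrite exprn_ile1 // ltW.
have Flo := quadratic_lower xh dev_lt; rewrite -/a -/n2 in Flo.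
have Fup := quadratic_upper xh (proj1 f_C1) f_grad; rewrite -/a -/n2 in Fup.
set F := f xh - f xstar in Flo Fup.
have ad : 8 / 11 * alpha <= alpha - delta by have := delta_le; lra.
have ad0 : 0 <= alpha - delta by apply: le_trans ad; rewrite mulr_ge0 // ltW.
have F0 : 0 <= F.
  by apply: le_trans Flo; apply: mulr_ge0 => //; apply: divr_ge0.
have maxE : Num.max (f xh - flb) 0 = F + Delta.
  rewrite (_ : f xh - flb = F + Delta); last by rewrite /F /Delta; ring.
  by rewrite (max_idPl _) // addr_ge0.
have v0 : 0 <= eta * s * (F + Delta) by apply: mulr_ge0; [exact: ltW|exact: addr_ge0].
have sigma2 : sigma xh ^+ 2 = eta * s * (F + Delta).
  by rewrite /sigma maxE sqr_sqrtr.
have rhs0 : 0 <= eta * s * (1 + 5 * (eta * lambda) / 14) * Delta.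
  apply: mulr_ge0 => //; apply: mulr_ge0; first exact: ltW.
  by rewrite eta_lambda; lra.
have [sig0|sig0] := eqVneq (sigma xh) 0.
  have FD : F + Delta = 0.
    move: sigma2; rewrite sig0 expr0n /= => /esym/eqP.
    by rewrite mulf_eq0 (gt_eqF noise_factor0) /= => /eqP.
  have n2E : n2 = 0.
    have h : alpha * n2 <= 0.
      by have := ler_wpM2r n20 ad; have := Flo; have := Delta0; lra.
    by apply/eqP; rewrite eq_le n20 andbT -(pmulr_rle0 _ alpha0).
  have a0 : a = 0 by apply: dotvv_eq0; rewrite -enorm_sqr.
  rewrite n2E mulr0 add0r; under eq_integral => w _.
    rewrite sig0 scale0r subr0.
    over.
  rewrite integral_probability_cst lee_fin; apply: le_trans rhs0.
  rewrite enorm_sqr; apply: le_trans (step_expand _) _.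
  by rewrite -/a a0 -(scale0r (0 : 'rV[R]_d)) !dotvE; lra.
have sg0 : 0 < sigma xh by rewrite lt_neqAle eq_sym sig0 sqrtr_ge0.
set sg := sigma xh in sig0 sg0 sigma2 *.
have [fbar fbar_sc f_fbar] := sc_deviation_witness dev_lt.
have := integral_grad_perturbed_ge d0 isoX a sg0 f_C1 L0 (ltW delta0) (ltW alpha0)
  f_grad fbar_sc f_fbar.
rewrite -enorm_sqr -/n2.
set q := fun w => dotv _ _; set D := fun w => dotv (grad f _) _.
set S := Num.sqrt _; move=> key.
have xz w : xstar + perturbed X a sg w = xh - sg *: X w.
  by rewrite /perturbed /a addrA [xstar + _]addrC subrK.
have mz : measurable_fun setT (perturbed X a sg) := measurable_perturbed isoX a sg.
have mq : measurable_fun setT q by exact: measurable_dotv.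
have q0 w : 0 <= q w := dotvv_ge0 _.
have [itgq Iq] := integrable_real_ge0 mq q0 (integral_perturbed_sqr_le d0 isoX a sg).
rewrite -enorm_sqr -/n2 in Iq.
have mD : measurable_fun setT D.
  apply: measurable_dotv => //; apply: (measurableT_comp (measurable_grad f_C1)).
  exact: measurable_rVD.
have D_le w : `|D w| <= L * q w.
  apply: le_trans (ler_dotv _ _) _; rewrite /q -enorm_sqr expr2 mulrA.
  rewrite ler_wpM2r ?enorm_ge0 //; apply: le_trans (f_grad _) _.
  by rewrite addrAC subrr add0r.
have integrable_realD : P.-integrable setT (EFin \o D).
  by apply: (integrable_real_le mD D_le); exact: integrable_realZ.
pose B w := (1 + eta ^+ 2 * L ^+ 2) * q w - 2 * eta * D w.
have integrable_realB : P.-integrable setT (EFin \o B) by apply: integrable_realB; exact: integrable_realZ.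
have my : measurable_fun setT (fun w => (enorm (gradient_step (xh - sg *: X w) - xstar) ^+ 2)%:E).
  apply/measurable_EFinP; under eq_fun do rewrite enorm_sqr -xz.
  have mx : measurable_fun setT (fun w => xstar + perturbed X a sg w).
    exact: measurable_rVD.
  have mgs : measurable_fun setT (fun w => gradient_step (xstar + perturbed X a sg w) - xstar).
    apply: measurable_rVB => //; apply: measurable_rVB => //; apply: measurable_rVZ => //.
    exact: (measurableT_comp (measurable_grad f_C1) mx).
  exact: measurable_dotv.
apply: (@le_trans _ _ (\int[P]_w (B w)%:E)%E).
  apply: ge0_le_integral => //.
  - by move=> w _; rewrite lee_fin sqr_ge0.
  - by case/integrableP: integrable_realB.
  move=> w _; rewrite lee_fin enorm_sqr; apply: le_trans (step_expand _) _.
  by rewrite -xz addrAC subrr add0r.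
rewrite EFin_Rint // lee_fin /B RintB ?RintZ //; [|exact: integrable_realZ|exact: integrable_realZ].
set Q := Rintegral P setT q in Iq key *; set DD := Rintegral P setT D in key *.
have e0 := eta_gt0.
have el : 1 + eta ^+ 2 * L ^+ 2 - 2 * eta * alpha = 1 - eta * lambda.
  by rewrite lambdaE; ring.
have el1 : 0 <= 1 - eta * lambda by rewrite eta_lambda; lra.
apply: (@le_trans _ _ ((1 - eta * lambda) * (n2 + sg ^+ 2) +
    eta * (delta * S) * (n2 + 3 * sg ^+ 2))).
  have := ler_wpM2l (ltW e0) key; have := ler_wpM2l el1 Iq.
  by rewrite -el; lra.
have vE := sigma2; set v := sg ^+ 2 in vE Iq key *.
have vp : 0 < v by rewrite exprn_gt0.
pose e := delta * S / alpha.
have S0 : 0 <= S := sqrtr_ge0 _.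
have ep : 0 <= e by rewrite divr_ge0 ?mulr_ge0 // ltW.
have SE : S ^+ 2 = d%:R * (2 + n2 / v).
  by rewrite sqr_sqrtr // mulr_ge0 // addr_ge0 // divr_ge0 // ltW.
have ee : e ^+ 2 * v <= (33 / 32 / 4) ^+ 2 * (k ^+ 3 * (2 * v + n2)).
  have -> : e ^+ 2 * v = (delta ^+ 2 * d%:R) * (2 * v + n2) / alpha ^+ 2.
    by rewrite /e expr_div_n exprMn SE; field; rewrite !gt_eqF.
  rewrite delta_sqr le_eqVlt; apply/orP; left; apply/eqP.
  by field; rewrite gt_eqF.
pose vD := eta * s * Delta; pose vF := eta * s * F.
have vDF : v = vF + vD by rewrite vE mulrDr.
have vD0 : 0 <= vD by apply: mulr_ge0 => //; exact: ltW.
have vF0 : 0 <= vF by apply: mulr_ge0 => //; exact: ltW.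
have vFup : vF <= 8 / 75 * (k ^+ 2 * n2).
  apply: (@le_trans _ _ (eta * s * (L / 2 * n2))).
    by rewrite ler_wpM2l // ltW.
  rewrite noise_factor le_eqVlt; apply/orP; left; apply/eqP.
  by field; rewrite gt_eqF.
have vFlo : k ^+ 3 * n2 <= 13 * vF.
  have : eta * s * (4 / 11 * alpha * n2) <= vF.
    rewrite /vF; apply: ler_wpM2l; first exact: ltW.
    by apply: le_trans Flo; apply: ler_wpM2r => //; have := ad; lra.
  have -> : eta * s * (4 / 11 * alpha * n2) = 64 / 75 / 11 * (k ^+ 3 * n2).
    by rewrite noise_factor /k; field; rewrite gt_eqF.
  have : 0 <= k ^+ 3 * n2 by apply: mulr_ge0 => //; exact: exprn_ge0 (ltW k0).
  lra.
have kn : k ^+ 2 * n2 <= n2 by rewrite ler_piMl.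
have vlo : k ^+ 3 * n2 <= 13 * v by lra.
have vup : v - 8 / 75 * n2 <= vD by lra.
have := step_arithmetic n20 vp ep ee (exprn_ge0 3 (ltW k0)) k31 vlo vD0 vup.
have -> : eta * (delta * S) * (n2 + 3 * v) = k ^+ 2 * (2 / 5 * (e * (n2 + 3 * v))).
  by rewrite etaE /e /k; field; rewrite !gt_eqF.
move=> /(ler_wpM2l (ltW c20)) arith.
rewrite eta_lambda (_ : eta * s * _ * Delta = (1 + 5 * (16 / 25 * k ^+ 2) / 14) * vD);
  last by rewrite /vD; ring.
have h1 : 0 <= k ^+ 2 * vF by apply: mulr_ge0 => //; exact: ltW.
have h2 : 0 <= k ^+ 2 * vD by apply: mulr_ge0 => //; exact: ltW.
rewrite vDF in arith *; lra.
Qed.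

End noisy_step.

(** * Conditioning a run on its past *)

Lemma dotv_subZ {R : realType} {d : nat} (k : R) (p v : 'rV[R]_d) :
  dotv (p - k *: v) (p - k *: v) = dotv p p - 2 * k * dotv p v + k ^+ 2 * dotv v v.
Proof. by rewrite !dotvE (dotvC v p); ring. Qed.

Section oracle_step.
Context {R : realType} {d : nat} {dS : measure_display} {S : measurableType dS}.
Variables (mu : probability S R) (SG : 'rV[R]_d -> S -> 'rV[R]_d)
  (f : 'rV[R]_d -> R) (r : R).
Hypothesis oracle : unbiased_oracle mu SG f r.

(** The error of the oracle is centred, so the cross term has mean zero and only
    the variance is added. *)
Lemma oracle_step eta x xstar :
  (\int[mu]_u (enorm (x - eta *: SG x u - xstar) ^+ 2)%:E <=
   (enorm (gradient_step f eta x - xstar) ^+ 2 + eta ^+ 2 * r ^+ 2)%:E)%E.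
Proof.
case: oracle => mSG mean var.
have mSGx : measurable_fun setT (SG x).
  exact: (measurable_fun_pair2 (f := fun p => SG p.1 p.2) x mSG).
pose e u := SG x u - grad f x.
have me : measurable_fun setT e by exact: measurable_rVB.
have me2 : measurable_fun setT (fun u => dotv (e u) (e u)) by exact: measurable_dotv.
set b := gradient_step f eta x - xstar.
have i2 : mu.-integrable setT (EFin \o (fun u => dotv (e u) (e u))) /\
    \int[mu]_u dotv (e u) (e u) <= r ^+ 2.
  apply: integrable_real_ge0 => // [u|]; first exact: dotvv_ge0.
  have := var x; rewrite unlock; under eq_integral do rewrite enorm_sqr; exact.
have ei i : mu.-integrable setT (EFin \o (fun u => e u 0 i)) /\ \int[mu]_u e u 0 i = 0.
  have [ig mg] := mean x i.
  have gi : \int[mu]_u SG x u 0 i = grad f x 0 i.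
    by move: mg; rewrite unlock /Rintegral => ->.
  have -> : (fun u => e u 0 i) = (fun u => SG x u 0 i - grad f x 0 i).
    by apply/funext => u; rewrite !mxE.
  split; first by apply: integrable_realB => //; exact: integrable_real_cst.
  by rewrite RintB ?Rint_cst ?gi ?subrr //; exact: integrable_real_cst.
have [ib mb] : mu.-integrable setT (EFin \o (fun u => dotv b (e u))) /\
    \int[mu]_u dotv b (e u) = 0.
  rewrite /dotv; elim: (index_enum _) => [|i l [IH1 IH2]].
    have -> : (fun u => \sum_(i <- [::]) b 0 i * e u 0 i) = (fun=> 0).
      by apply/funext => u; rewrite big_nil.
    by split; [exact: integrable_real_cst|rewrite Rint_cst].
  have -> : (fun u => \sum_(j <- i :: l) b 0 j * e u 0 j) =
      (fun u => b 0 i * e u 0 i + \sum_(j <- l) b 0 j * e u 0 j).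
    by apply/funext => u; rewrite big_cons.
  have [ii mi] := ei i; have iz := integrable_realZ (b 0 i) ii.
  by split; [exact: integrable_realD|rewrite RintD // RintZ // mi IH2 mulr0 addr0].
have E u : enorm (x - eta *: SG x u - xstar) ^+ 2 =
    dotv b b - 2 * eta * dotv b (e u) + eta ^+ 2 * dotv (e u) (e u).
  have -> : x - eta *: SG x u - xstar = b - eta *: e u.
    by apply/rowP => i; rewrite /b /e /gradient_step !mxE; ring.
  by rewrite enorm_sqr dotv_subZ; ring.
have [i2i i2m] := i2.
have ih : mu.-integrable setT (EFin \o (fun u => dotv b b - 2 * eta * dotv b (e u))).
  by apply: integrable_realB; [exact: integrable_real_cst|exact: integrable_realZ].
under eq_integral do rewrite E.
rewrite EFin_Rint; last by apply: integrable_realD => //; exact: integrable_realZ.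
rewrite lee_fin RintD //; last exact: integrable_realZ.
rewrite RintB ?Rint_cst ?RintZ ?mb //; [|exact: integrable_real_cst|exact: integrable_realZ].
have := ler_wpM2l (sqr_ge0 eta) i2m; rewrite enorm_sqr; lra.
Qed.

End oracle_step.

Section run.
Context {R : realType} {d : nat} {dS : measure_display} {S : measurableType dS}
  {dO : measure_display} {Omega : measurableType dO}.
Variables (P : probability Omega R) (mu : probability S R).
Variables (u : nat -> Omega -> S) (xi : nat -> Omega -> 'rV[R]_d) (T : nat).
Hypothesis run : gnd_randomness P u xi mu T.

Definition past_generators t : set (set Omega) :=
  \bigcup_(k in `I_t) (preimage_set_system setT (u k) measurable `|`
                       preimage_set_system setT (xi k) measurable).

Definition past_half_generators t : set (set Omega) :=
  past u xi t `|` preimage_set_system setT (u t) measurable.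

Local Notation Past t := (g_sigma_algebraType (past_generators t)).
Local Notation PastHalf t := (g_sigma_algebraType (past_half_generators t)).

Lemma measurable_u t : (t < T)%N -> measurable_fun setT (u t).
Proof. by case/run => -[]. Qed.

Lemma measurable_xi t : (t < T)%N -> measurable_fun setT (xi t).
Proof. by case/run => _ []. Qed.

Lemma past_measurable t : (t <= T)%N -> past u xi t `<=` measurable.
Proof.
move=> tT; apply: smallest_sub; first exact: sigma_algebra_measurable.
move=> _ [k /= kt [|] [B mB <-]].
  exact: (measurable_u (leq_trans kt tT)).
exact: (measurable_xi (leq_trans kt tT)).
Qed.

Lemma past_half_measurable t : (t < T)%N -> past_half u xi t `<=` measurable.
Proof.
move=> tT; apply: smallest_sub; first exact: sigma_algebra_measurable.
move=> A [/(past_measurable (ltnW tT)) // | [B mB <-]].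
exact: (measurable_u tT).
Qed.

Lemma past_sub_half t : past u xi t `<=` past_half u xi t.
Proof. by move=> A hA; apply: sub_sigma_algebra; left. Qed.

Lemma past_half_sub t : past_half u xi t `<=` past u xi t.+1.
Proof.
apply: smallest_sub; first exact: smallest_sigma_algebra.
move=> A [|hA]; last by apply: sub_sigma_algebra; exists t => //=; left.
apply: sub_sigma_algebra2 => {}A [k /= kt hA]; exists k => //=.
exact: ltnW.
Qed.

Lemma past_subS t : past u xi t `<=` past u xi t.+1.
Proof. by move=> A /past_sub_half/past_half_sub. Qed.

Lemma past_measurable_u t : measurable_fun (setT : set (PastHalf t)) (u t).
Proof. by move=> _ B mB; apply: sub_sigma_algebra; right; exists B. Qed.

Lemma past_measurable_xi t : measurable_fun (setT : set (Past t.+1)) (xi t).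
Proof.
move=> _ B mB; apply: sub_sigma_algebra; exists t; first exact: ltnSn.
by right; exists B.
Qed.

Lemma past_half_fun t d' (T' : measurableType d') (g : Omega -> T') :
  measurable_fun (setT : set (Past t)) g -> measurable_fun (setT : set (PastHalf t)) g.
Proof. by move=> mg _ B mB; apply: past_sub_half; exact: mg. Qed.

Lemma past_succ_fun t d' (T' : measurableType d') (g : Omega -> T') :
  measurable_fun (setT : set (PastHalf t)) g -> measurable_fun (setT : set (Past t.+1)) g.
Proof. by move=> mg _ B mB; apply: past_half_sub; exact: mg. Qed.

Local Open Scope ereal_scope.

(** The integrand is measurable for the sigma-algebra of the past in its first
    argument, which is what makes it legitimate to freeze that argument. *)
Lemma resample_oracle t (F : Omega * S -> \bar R) : (t < T)%N ->
  measurable_fun (setT : set (Past t * S)%type) F -> (forall p, 0 <= F p) ->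
  \int[P]_w F (w, u t w) = \int[P]_w \int[mu]_v F (w, v).
Proof.
move=> tT mF F0; have [[mu_t law] _ indep _] := run tT.
have mid : measurable_fun (setT : set Omega) (id : Omega -> Past t).
  by move=> _ B mB; rewrite setTI; apply: (past_measurable (ltnW tT)).
have mS : measurable_fun setT (id : S -> S) by exact: measurable_id.
have := @integral_resample R _ _ _ _ Omega S (Past t) S P mu id (u t) id mid mu_t
  mS _ F mF F0.
apply=> A B mA mB; rewrite preimage_id setIC.
rewrite (indep (u t @^-1` B) A) //; last by exists B => //; rewrite setTI.
by rewrite law // muleC.
Qed.

Lemma resample_noise t (F : Omega * 'rV[R]_d -> \bar R) : (t < T)%N ->
  measurable_fun (setT : set (PastHalf t * 'rV[R]_d)%type) F -> (forall p, 0 <= F p) ->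
  \int[P]_w F (w, xi t w) = \int[P]_w \int[P]_v F (w, xi t v).
Proof.
move=> tT mF F0; have [_ [mxi _] _ indep] := run tT.
have mid : measurable_fun (setT : set Omega) (id : Omega -> PastHalf t).
  by move=> _ B mB; rewrite setTI; apply: (past_half_measurable tT).
have := @integral_resample R _ _ _ _ Omega Omega (PastHalf t) 'rV[R]_d P P id (xi t) (xi t)
  mid mxi mxi _ F mF F0.
apply=> A B mA mB; rewrite preimage_id setIC.
rewrite (indep (xi t @^-1` B) A) //; last by exists B => //; rewrite setTI.
by rewrite muleC.
Qed.

End run.

Section conditional_step.
Context {R : realType} {d : nat} {dS : measure_display} {S : measurableType dS}
  {dO : measure_display} {Omega : measurableType dO}.
Variables (P : probability Omega R) (mu : probability S R).
Variables (u : nat -> Omega -> S) (xi : nat -> Omega -> 'rV[R]_d) (T : nat).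
Hypothesis run : gnd_randomness P u xi mu T.
Variables (SG : 'rV[R]_d -> S -> 'rV[R]_d) (f : 'rV[R]_d -> R) (r : R).
Hypothesis oracle : unbiased_oracle mu SG f r.
Variables (xstar : 'rV[R]_d) (alpha L : R).
Hypotheses (d0 : (0 < d)%N) (alpha0 : 0 < alpha) (alphaL : alpha <= L).
Hypothesis f_C1 : C1 f.
Hypothesis f_grad : forall x, enorm (grad f x) <= L * enorm (x - xstar).
Hypothesis f_dev : (sc_deviation f xstar alpha <=
  (4^-1 * Num.sqrt (alpha ^+ 5 / (d%:R * L ^+ 3)))%:E)%E.
Variables (eta lambda s flb b : R).
Hypotheses (etaE : eta = 2 * alpha / (5 * L ^+ 2))
  (lambdaE : lambda = 2 * alpha - eta * L ^+ 2) (sE : s = lambda / (3 * L))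
  (flb_le : flb <= f xstar)
  (bE : b = eta * r ^+ 2 / lambda + (5 * eta * lambda + 14) / (42 * L) * (f xstar - flb)).
Variable x0 : 'rV[R]_d.

Local Notation Past t := (g_sigma_algebraType (past_generators u xi t)).
Local Notation PastHalf t := (g_sigma_algebraType (past_half_generators u xi t)).

Definition iterate t w : 'rV[R]_d := gnd f SG eta s flb x0 (u ^~ w) (xi ^~ w) t.
Local Notation x := iterate.
Definition half_iterate t w : 'rV[R]_d := x t w - eta *: SG (x t w) (u t w).
Local Notation xh := half_iterate.
Definition noise_level v : R := Num.sqrt (eta * s * Num.max (f v - flb) 0).
Local Notation V v := (enorm (gradient_step f eta v - xstar) ^+ 2).

Let L0 : 0 < L. Proof. exact: lt_le_trans alphaL. Qed.

Let k2_gt0 : 0 < (alpha / L) ^+ 2. Proof. by rewrite exprn_gt0 // divr_gt0. Qed.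

Let k2_le1 : (alpha / L) ^+ 2 <= 1.
Proof. by rewrite exprn_ile1 ?divr_ge0 ?ler_pdivrMr ?mul1r // ltW. Qed.

Let elE : eta * lambda = 16 / 25 * (alpha / L) ^+ 2 := eta_lambda alpha0 alphaL etaE lambdaE.

Let esE : eta * s = 16 / 75 * ((alpha / L) ^+ 2 / L) :=
  noise_factor alpha0 alphaL etaE lambdaE sE.

Let lambda0 : 0 < lambda.
Proof. by rewrite (lambda_alpha alpha0 alphaL etaE lambdaE) mulr_gt0. Qed.

Lemma contraction_ge0 : 0 <= 1 - eta * lambda / 100.
Proof. by have h1 := k2_gt0; have h2 := k2_le1; rewrite elE; lra. Qed.

Lemma contraction_le1 : 1 - eta * lambda / 100 <= 1.
Proof. by have h1 := k2_gt0; have h2 := k2_le1; rewrite elE; lra. Qed.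

Let c := eta * s * (1 + 5 * (eta * lambda) / 14) * (f xstar - flb).

Let c_ge0 : 0 <= c.
Proof.
have h1 := k2_gt0; rewrite /c elE esE.
apply: mulr_ge0; last by rewrite subr_ge0.
apply: mulr_ge0; last lra.
by apply: mulr_ge0 => //; apply: divr_ge0; exact: ltW.
Qed.

(* b is the level at which the additive errors balance the full contraction *)
Let balance : (1 - eta * lambda / 100) * (eta ^+ 2 * r ^+ 2) + c <= eta * lambda * b.
Proof.
have -> : eta * lambda * b = eta ^+ 2 * r ^+ 2 + c.
  by rewrite bE /c sE; field; rewrite !gt_eqF.
rewrite lerD2r; apply: ler_piMl; last exact: contraction_le1.
by apply: mulr_ge0; exact: sqr_ge0.
Qed.

Let mf : measurable_fun setT f.
Proof. by apply: continuous_measurable_rV; apply: differentiable_continuousT; case: f_C1. Qed.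

Let mSG : measurable_fun setT (fun p : 'rV[R]_d * S => SG p.1 p.2).
Proof. by case: oracle. Qed.

Lemma measurable_noise_level : measurable_fun setT noise_level.
Proof.
apply: (measurableT_comp (f := @Num.sqrt R)).
  exact: (continuous_measurable_fun (@sqrt_continuous R)).
apply: measurable_funM => //; apply: measurable_maxr => //.
exact: measurable_funB.
Qed.

Lemma measurable_gradient_step : measurable_fun setT (gradient_step f eta).
Proof.
apply: measurable_rVB => //; apply: measurable_rVZ => //; exact: measurable_grad.
Qed.

Lemma measurable_sqr_dist : measurable_fun setT (fun v => V v).
Proof.
under eq_fun do rewrite enorm_sqr; apply: measurable_dotv;
  by apply: measurable_rVB => //; exact: measurable_gradient_step.
Qed.

Let measurable_half t : measurable_fun (setT : set (Past t)) (x t) ->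
  measurable_fun (setT : set (PastHalf t)) (xh t).
Proof.
move=> /past_half_fun mx; apply: measurable_rVB => //; apply: measurable_rVZ => //.
have mp : measurable_fun (setT : set (PastHalf t)) (fun w => (x t w, u t w)).
  by apply: measurable_fun_pair => //; exact: past_measurable_u.
exact: (measurableT_comp mSG mp).
Qed.

Lemma past_measurable_iterate t : measurable_fun (setT : set (Past t)) (x t).
Proof.
elim: t => [|t IH]; first exact: measurable_cst.
have mxh := past_succ_fun (measurable_half IH).
have -> : x t.+1 = (fun w => xh t w - noise_level (xh t w) *: xi t w) by [].
apply: measurable_rVB => //; apply: measurable_rVZ; last exact: past_measurable_xi.
exact: (measurableT_comp measurable_noise_level mxh).
Qed.

Lemma past_measurable_half_iterate t : measurable_fun (setT : set (PastHalf t)) (xh t).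
Proof. exact: measurable_half (@past_measurable_iterate t). Qed.

Lemma measurable_iterate t : (t <= T)%N -> measurable_fun setT (x t).
Proof.
move=> tT _ B mB; rewrite setTI; apply: (past_measurable run tT).
by rewrite -[X in past _ _ _ X]setTI; apply: past_measurable_iterate.
Qed.

Local Open Scope ereal_scope.

(** The conditional expectation of the squared distance given the past, written
    against the indicators of past events. The two averages, over the noise and
    then over the oracle, contribute the two terms of [b]. *)
Lemma conditional_step t A : (t < T)%N -> past u xi t A ->
  \int[P]_w (\1_A w * V (x t.+1 w))%:E <=
  \int[P]_w (\1_A w * ((1 - eta * lambda / 100) * V (x t w) + eta * lambda * b))%:E.
Proof.
move=> tT pA.
have mA : measurable_fun (setT : set (Past t)) (\1_A : Omega -> R).
  exact: (@measurable_indic _ (Past t)).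
have mAh := past_half_fun mA.
have A0 w : (0 <= \1_A w :> R)%R by rewrite indicE.
have mx := @past_measurable_iterate t; have mxh := @past_measurable_half_iterate t.
set rho := (1 - eta * lambda / 100)%R.
have rho0 : (0 <= rho)%R := contraction_ge0.
(* first integrate out the Gaussian noise, with the half iterate frozen *)
pose F1 (p : PastHalf t * 'rV[R]_d) : \bar R :=
  (\1_A p.1 * V (xh t p.1 - noise_level (xh t p.1) *: p.2))%:E.
have mF1 : measurable_fun setT F1.
  apply/measurable_EFinP; apply: measurable_funM.
    exact: (measurableT_comp mAh measurable_fst).
  apply: (measurableT_comp measurable_sqr_dist).
  have m1 : measurable_fun (setT : set (PastHalf t * 'rV[R]_d)%type) (fun p => xh t p.1).
    exact: (measurableT_comp mxh measurable_fst).
  apply: measurable_rVB => //; apply: measurable_rVZ; last exact: measurable_snd.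
  exact: (measurableT_comp measurable_noise_level m1).
have F10 p : 0 <= F1 p by rewrite lee_fin mulr_ge0 // sqr_ge0.
have -> : \int[P]_w (\1_A w * V (x t.+1 w))%:E = \int[P]_w F1 (w, xi t w) by [].
rewrite (resample_noise run tT mF1 F10).
(* then the seed of the oracle, with the iterate frozen *)
pose F2 (p : Past t * S) : \bar R :=
  (\1_A p.1 * (rho * enorm (x t p.1 - eta *: SG (x t p.1) p.2 - xstar) ^+ 2 + c))%:E.
have mF2 : measurable_fun setT F2.
  apply/measurable_EFinP; apply: measurable_funM.
    exact: (measurableT_comp mA measurable_fst).
  have m1 : measurable_fun (setT : set (Past t * S)%type) (fun p => x t p.1).
    exact: (measurableT_comp mx measurable_fst).
  have m2 : measurable_fun (setT : set (Past t * S)%type) (fun p => SG (x t p.1) p.2).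
    have mp : measurable_fun (setT : set (Past t * S)%type) (fun p => (x t p.1, p.2)).
      by apply: measurable_fun_pair => //; exact: measurable_snd.
    exact: (measurableT_comp mSG mp).
  have m3 : measurable_fun (setT : set (Past t * S)%type)
      (fun p => x t p.1 - eta *: SG (x t p.1) p.2 - xstar)%R.
    by apply: measurable_rVB => //; apply: measurable_rVB => //; exact: measurable_rVZ.
  apply: measurable_funD => //; apply: measurable_funM => //.
  by under eq_fun do rewrite enorm_sqr; exact: measurable_dotv.
have F20 p : 0 <= F2 p.
  by rewrite lee_fin mulr_ge0 // addr_ge0 // mulr_ge0 // sqr_ge0.
apply: (@le_trans _ _ (\int[P]_w F2 (w, u t w))).
  apply: ge0_le_integral => //.
  - by move=> w _; exact: integral_ge0.
  - pose F1' (p : PastHalf t * Omega) := F1 (p.1, xi t p.2).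
    have mF1' : measurable_fun setT F1'.
      have mp : measurable_fun (setT : set (PastHalf t * Omega)%type) (fun p => (p.1, xi t p.2)).
        apply: measurable_fun_pair; first exact: measurable_fst.
        exact: (measurableT_comp (measurable_xi run tT) measurable_snd).
      exact: (measurableT_comp mF1 mp).
    have mFF := @measurable_fun_fubini_tonelli_F _ _ _ _ R P F1' mF1' (fun p => F10 _).
    move=> _ B mB; rewrite setTI; apply: (past_half_measurable run tT).
    by rewrite -[Z in past_half _ _ _ Z]setTI; exact: mFF.
  - move=> _ B mB; rewrite setTI; apply: (past_half_measurable run tT).
    rewrite -[Z in past_half _ _ _ Z]setTI.
    have mpr : measurable_fun (setT : set (PastHalf t)) (fun w => F2 (w, u t w)).
      have mp : measurable_fun (setT : set (PastHalf t)) (fun w => (w : Past t, u t w)).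
        apply: measurable_fun_pair; last exact: past_measurable_u.
        by apply: past_half_fun; exact: measurable_id.
      exact: (measurableT_comp mF2 mp).
    exact: mpr.
  move=> w _; rewrite /F1 /F2 /= [leRHS]EFinM.
  under eq_integral do rewrite EFinM.
  rewrite ge0_integralZl_EFin //; first last.
  - apply/measurable_EFinP; apply: (measurableT_comp measurable_sqr_dist).
    apply: measurable_rVB => //; apply: measurable_rVZ => //.
    exact: (measurable_xi run tT).
  - by move=> v _; rewrite lee_fin sqr_ge0.
  apply: lee_wpmul2l; first by rewrite lee_fin.
  have [_ iso _ _] := run tT.
  exact: (noisy_step d0 iso alpha0 alphaL f_C1 f_grad f_dev etaE lambdaE sE flb_le).
rewrite (resample_oracle run tT mF2 F20).
have mx' : measurable_fun setT (x t) by exact: measurable_iterate (ltnW tT).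
have mA' : measurable_fun setT (\1_A : Omega -> R).
  by apply: measurable_indic; exact: (past_measurable run (ltnW tT)).
apply: ge0_le_integral => //.
- by move=> w _; exact: integral_ge0.
- have mFF := @measurable_fun_fubini_tonelli_F _ _ _ _ R mu F2 mF2 F20.
  move=> _ B mB; rewrite setTI; apply: (past_measurable run (ltnW tT)).
  by rewrite -[Z in past _ _ _ Z]setTI; exact: mFF.
- apply/measurable_EFinP; apply: measurable_funM => //; apply: measurable_funD => //.
  by apply: measurable_funM => //; exact: (measurableT_comp measurable_sqr_dist mx').
move=> w _; rewrite /F2 /= [leRHS]EFinM.
have mSGw : measurable_fun setT (SG (x t w)).
  exact: (measurable_fun_pair2 (f := fun p => SG p.1 p.2) (x t w) mSG).
have mq : measurable_fun setT (fun v => (enorm (x t w - eta *: SG (x t w) v - xstar) ^+ 2)%R).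
  under eq_fun do rewrite enorm_sqr; apply: measurable_dotv;
    by apply: measurable_rVB => //; apply: measurable_rVB => //; exact: measurable_rVZ.
under eq_integral do rewrite EFinM.
rewrite ge0_integralZl_EFin //; first last.
- by apply/measurable_EFinP; apply: measurable_funD => //; exact: measurable_funM.
- by move=> v _; rewrite lee_fin addr_ge0 // mulr_ge0 // sqr_ge0.
apply: lee_wpmul2l; first by rewrite lee_fin.
under eq_integral do rewrite EFinD EFinM.
rewrite ge0_integralD //; first last.
- by apply: emeasurable_funM => //; exact/measurable_EFinP.
- by move=> v _; rewrite -EFinM lee_fin mulr_ge0 // sqr_ge0.
rewrite integral_probability_cst ge0_integralZl_EFin //; first last.
- exact/measurable_EFinP.
- by move=> v _; rewrite lee_fin sqr_ge0.
apply: (@le_trans _ _ (rho%:E * (V (x t w) + eta ^+ 2 * r ^+ 2)%:E + c%:E)).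
  by apply: leeD => //; apply: lee_wpmul2l => //; exact: oracle_step.
by rewrite -EFinM -EFinD lee_fin; have := balance; rewrite -/rho; lra.
Qed.

End conditional_step.

(** * Tail bounds and hitting times *)

Section tails.
Context {R : realType}.

Lemma pow_onem_le_expR (x : R) n : 0 <= x -> x <= 1 -> (1 - x) ^+ n <= expR (- (x * n%:R)).
Proof.
move=> x0 x1; rewrite -mulNr expRM_natr; apply: lerXn2r; rewrite ?nnegrE ?expR_ge0 //.
  by rewrite subr_ge0.
exact: expR_ge1Dx.
Qed.

(** From [1 - x <= expR (- x)]; when [v] is 0 the hypothesis carries no
    information but the conclusion is immediate. *)
Lemma geometric_decay_le (x v c : R) n : 0 < x -> x <= 1 -> 0 <= v -> 0 < c ->
  x^-1 * ln (v / c) <= n%:R -> (1 - x) ^+ n * v <= c.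
Proof.
move=> x0 x1 v0 c0 hn.
have [->|vn0] := eqVneq v 0; first by rewrite mulr0 ltW.
have vp : 0 < v by rewrite lt_neqAle eq_sym vn0.
have vc : 0 < v / c by rewrite divr_gt0.
apply: (@le_trans _ _ (expR (- (x * n%:R)) * v)).
  by rewrite ler_wpM2r // pow_onem_le_expR // ltW.
rewrite expRN mulrC ler_pdivrMr ?expR_gt0 // -ler_pdivrMl // mulrC.
rewrite -[leLHS]lnK ?posrE // ler_expR.
by rewrite -ler_pdivrMl.
Qed.

Context dO (Omega : measurableType dO) (P : probability Omega R).

Lemma markov_indicator (g : Omega -> R) (eps : R) (A : set Omega) : 0 <= eps ->
  measurable A -> measurable_fun setT g -> (forall w, A w -> eps <= g w) ->
  (eps%:E * P A <= \int[P]_w (\1_A w * g w)%:E)%E.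
Proof.
move=> e0 mA mg Ag.
have mI : measurable_fun setT (\1_A : Omega -> R) by exact: measurable_indic.
rewrite -[X in (_ * P X)%E]setIT -integral_indic // -ge0_integralZl_EFin //; last first.
  exact/measurable_EFinP.
apply: ge0_le_integral => //.
- by move=> w _; rewrite -EFinM lee_fin mulr_ge0.
- by apply: emeasurable_funM => //; exact/measurable_EFinP.
- by apply/measurable_EFinP; exact: measurable_funM.
move=> w _; rewrite -EFinM lee_fin indicE.
have [/set_mem/Ag h|_] := boolP (w \in A); first by rewrite mulr1 mul1r.
by rewrite mulr0 mul0r.
Qed.

Lemma probability_setC_ge (A : set Omega) (zeta : R) : measurable A ->
  (P A <= zeta%:E)%E -> ((1 - zeta)%:E <= P (~` A))%E.
Proof.
move=> mA h; rewrite probability_setC // EFinB; exact: leeB.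
Qed.

Lemma markov_le_event (g : Omega -> R) (eps zeta : R) : 0 < eps ->
  (forall w, 0 <= g w) -> measurable_fun setT g ->
  (\int[P]_w (g w)%:E <= (zeta * eps)%:E)%E ->
  ((1 - zeta)%:E <= P [set w | (g w <= eps)%R])%E.
Proof.
move=> eps0 g0 mg hg; pose A := [set w | eps < g w].
have mA : measurable A.
  rewrite (_ : A = setT `&` g @^-1` `]eps, +oo[); first exact: mg.
  by rewrite setTI; apply/seteqP; split=> w /=; rewrite in_itv /= andbT.
have -> : [set w | g w <= eps] = ~` A.
  by apply/seteqP; split=> w /=; rewrite /A /= leNgt => /negP.
apply: probability_setC_ge => //.
have h := markov_indicator (ltW eps0) mA mg (fun w hw => ltW hw).
have h2 : (\int[P]_w (\1_A w * g w)%:E <= (zeta * eps)%:E)%E.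
  apply: le_trans hg; apply: ge0_le_integral => //.
  - by move=> w _; rewrite lee_fin mulr_ge0.
  - by apply/measurable_EFinP; apply: measurable_funM => //; exact: measurable_indic.
  - exact/measurable_EFinP.
  - by move=> w _; rewrite lee_fin indicE; case: (_ \in _); rewrite ?mul1r ?mul0r.
have fP : P A \is a fin_num by exact: fin_num_measure.
move: (le_trans h h2); rewrite -(fineK fP) -EFinM !lee_fin mulrC.
by rewrite ler_pM2r.
Qed.

End tails.

Section first_argmin_theory.
Context {R : realType}.

Lemma first_argminP (v : nat -> R) T :
  (first_argmin v T <= T)%N /\ forall k, (k <= T)%N -> v (first_argmin v T) <= v k.
Proof.
pose p t := all (fun k => v t <= v k) (iota 0 T.+1).
have hp : has p (iota 0 T.+1).
  pose i0 := [arg min_(i < ord0 : 'I_T.+1) v i]%O.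
  apply/hasP; exists (i0 : nat); first by rewrite mem_iota add0n ltn_ord.
  apply/allP => k; rewrite mem_iota add0n => kT.
  rewrite /i0; case: arg_minP => // i _ /(_ (Ordinal kT) isT); exact.
have ltT : (find p (iota 0 T.+1) < T.+1)%N by rewrite -[X in (_ < X)%N](size_iota 0) -has_find.
split=> [|k kT]; first exact: ltT.
have := nth_find 0%N hp; rewrite nth_iota // add0n => /allP; apply.
by rewrite mem_iota add0n.
Qed.

(** The search for the first minimizer is a cascade of finitely many comparisons
    of measurable functions. *)
Lemma measurable_first_argmin dO (Omega : measurableType dO) (v : nat -> Omega -> R) T :
  (forall k, (k <= T)%N -> measurable_fun setT (v k)) ->
  measurable_fun setT (fun w => first_argmin (v ^~ w) T).
Proof.
move=> mv.
have mall k (l : seq nat) : (k <= T)%N -> {subset l <= iota 0 T.+1} ->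
    measurable_fun setT (fun w => all (fun j => v k w <= v j w) l).
  move=> kT; elim: l => [|j l IH] hl; first exact: measurable_cst.
  apply: measurable_and; last by apply: IH => i il; apply: hl; rewrite inE il orbT.
  apply: measurable_fun_ler; apply: mv => //.
  by have := hl j (mem_head _ _); rewrite mem_iota.
pose p w t := all (fun j => v t w <= v j w) (iota 0 T.+1).
suff main l : {subset l <= iota 0 T.+1} -> measurable_fun setT (fun w => find (p w) l).
  exact: main.
elim: l => [|k l IH] hl; first exact: measurable_cst.
change (measurable_fun setT (fun w => if p w k then 0%N else (find (p w) l).+1)).
apply: measurable_fun_ifT.
- by apply: mall => //; have := hl k (mem_head _ _); rewrite mem_iota.
- exact: measurable_cst.
- apply: (measurableT_comp (f := succn)) => //.
  by apply: IH => i il; apply: hl; rewrite inE il orbT.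
Qed.

End first_argmin_theory.

(** * Processes with a contracting conditional drift *)

Section contracting_drift.
Context {R : realType} dO (Omega : measurableType dO) (P : probability Omega R).
Variables (T : nat) (Fil : nat -> set (set Omega)) (g : nat -> Omega -> R).
Variables (x c v0 : R).
Hypotheses (x0 : 0 < x) (x1 : x <= 1) (c0 : 0 <= c).
Hypothesis Fil_measurable : forall t, (t <= T)%N -> Fil t `<=` measurable.
Hypothesis Fil_T : forall t, Fil t setT.
Hypothesis Fil_I : forall t A B, Fil t A -> Fil t B -> Fil t (A `&` B).
Hypothesis Fil_S : forall t, Fil t `<=` Fil t.+1.
Hypothesis g_ge0 : forall t w, 0 <= g t w.
Hypothesis g_mfun : forall t, (t <= T)%N -> measurable_fun setT (g t).
Hypothesis g_adapted : forall t a, (t <= T)%N -> Fil t [set w | a < g t w].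
Hypothesis g_init : forall w, g 0%N w = v0.
Hypothesis drift : forall t A, (t < T)%N -> Fil t A ->
  (\int[P]_w (\1_A w * g t.+1 w)%:E <=
   \int[P]_w (\1_A w * ((1 - x) * g t w + x * c))%:E)%E.

(** The level [c] is the fixed point of the drift [v |-> (1 - x) * v + x * c]. *)
Lemma drift_expectation t : (t <= T)%N ->
  (\int[P]_w (g t w)%:E <= ((1 - x) ^+ t * v0 + c)%:E)%E.
Proof.
have y0 : 0 <= 1 - x by rewrite subr_ge0.
elim: t => [_|t IH tT].
  under eq_integral do rewrite g_init.
  by rewrite integral_probability_cst lee_fin expr0 mul1r lerDl.
have mt := g_mfun (ltnW tT).
have := drift tT (Fil_T t).
under eq_integral do rewrite indicT mul1r.
under [X in (_ <= X)%E -> _]eq_integral do rewrite indicT mul1r EFinD EFinM.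
move=> /le_trans; apply.
have mE : measurable_fun setT (fun w => (g t w)%:E) by exact/measurable_EFinP.
rewrite ge0_integralD //; first last.
- by move=> w _; rewrite lee_fin mulr_ge0 // ltW.
- exact: emeasurable_funM.
- by move=> w _; rewrite -EFinM lee_fin mulr_ge0.
rewrite integral_probability_cst ge0_integralZl_EFin // => [|w _]; last by rewrite lee_fin.
apply: (@le_trans _ _ ((1 - x)%:E * ((1 - x) ^+ t * v0 + c)%:E + (x * c)%:E)%E).
  by apply: leeD => //; apply: lee_wpmul2l => //; exact: IH (ltnW tT).
by rewrite -EFinM -EFinD lee_fin exprS; lra.
Qed.

Let away t := [set w | forall k, (k <= t)%N -> 2 * c < g k w].

Let awayS t : away t.+1 = away t `&` [set w | 2 * c < g t.+1 w].
Proof.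
apply/seteqP; split=> w /=.
  by move=> h; split=> [k kt|]; apply: h => //; exact: leqW.
by move=> [h h1] k; rewrite leq_eqVlt => /predU1P[->//|]; exact: h.
Qed.

Let Fil_away t : (t <= T)%N -> Fil t (away t).
Proof.
elim: t => [|t IH] tT.
  have -> : away 0 = [set w | 2 * c < g 0%N w]; last exact: g_adapted.
  apply/seteqP; split=> w /=; first exact.
  by move=> h k; rewrite leqn0 => /eqP ->.
rewrite awayS; apply: Fil_I; last exact: g_adapted.
by apply: Fil_S; apply: IH; exact: ltnW.
Qed.

Let decay t : (t <= T)%N ->
  (\int[P]_w (\1_(away t) w * g t w)%:E <= ((1 - x / 2) ^+ t * v0)%:E)%E.
Proof.
have y0 : 0 <= 1 - x / 2 by have h1 := x1; have h0 := x0; lra.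
have mprod k j : (k <= T)%N -> (j <= T)%N -> measurable_fun setT (fun w => \1_(away k) w * g j w).
  move=> kT jT; apply: measurable_funM; last exact: g_mfun.
  by apply: measurable_indic; apply: (Fil_measurable kT); exact: Fil_away.
elim: t => [_|t IH tT].
  rewrite expr0 mul1r -[leRHS](integral_probability_cst P).
  apply: ge0_le_integral => //.
  - by move=> w _; rewrite lee_fin mulr_ge0.
  - by apply/measurable_EFinP; exact: mprod.
  - move=> w _; rewrite lee_fin -(g_init w) indicE.
    by case: (_ \in _); rewrite ?mul1r ?mul0r.
have tT' := ltnW tT.
apply: (@le_trans _ _ (\int[P]_w (\1_(away t) w * g t.+1 w)%:E)%E).
  apply: ge0_le_integral => //.
  - by move=> w _; rewrite lee_fin mulr_ge0.
  - by apply/measurable_EFinP; exact: mprod.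
  - by apply/measurable_EFinP; exact: mprod.
  - move=> w _; rewrite lee_fin ler_wpM2r // awayS !indicE in_setI.
    by case: (_ \in _); case: (_ \in _).
apply: le_trans (drift tT (Fil_away tT')) _.
apply: (@le_trans _ _ (\int[P]_w ((1 - x / 2)%:E * (\1_(away t) w * g t w)%:E))%E).
  apply: ge0_le_integral => //.
  - by move=> w _; rewrite lee_fin mulr_ge0 // addr_ge0 // mulr_ge0 ?subr_ge0 // ltW.
  - apply/measurable_EFinP; apply: measurable_funM.
      by apply: measurable_indic; apply: (Fil_measurable tT'); exact: Fil_away.
    by apply: measurable_funD => //; apply: measurable_funM => //; exact: g_mfun.
  - by apply: emeasurable_funM => //; apply/measurable_EFinP; exact: mprod.
  move=> w _; rewrite -EFinM lee_fin indicE.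
  have [/set_mem h|_] := boolP (w \in away t); last by rewrite !mul0r mulr0.
  rewrite !mul1r; have := ltW (h t (leqnn t)) => /(ler_wpM2l (ltW x0)); lra.
rewrite ge0_integralZl_EFin //; first last.
- by apply/measurable_EFinP; exact: mprod.
- by move=> w _; rewrite lee_fin mulr_ge0.
by rewrite exprS -mulrA [leRHS]EFinM; apply: lee_wpmul2l => //; exact: IH.
Qed.

(** As long as the process is above twice the level of the drift, it contracts
    at half the rate; hence it is unlikely to remain there. *)
Lemma drift_hitting zeta : 0 < c -> (1 - x / 2) ^+ T * v0 <= c * zeta -> 0 <= zeta ->
  measurable [set w | exists t, (t <= T)%N /\ g t w <= 2 * c] /\
  ((1 - zeta)%:E <= P [set w | exists t, (t <= T)%N /\ (g t w <= 2 * c)%R])%E.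
Proof.
move=> cp hT z0.
have mA : measurable (away T) by apply: (Fil_measurable (leqnn T)); exact: Fil_away.
have -> : [set w | exists t, (t <= T)%N /\ g t w <= 2 * c] = ~` away T.
  apply/seteqP; split=> w /=.
    by move=> [t [tT h]] /(_ t tT); rewrite ltNge h.
  move=> /existsNP[t] /not_implyP[tT /negP]; rewrite -leNgt => h.
  by exists t.
split; first exact: measurableC.
apply: probability_setC_ge => //.
have cc : 0 < 2 * c by rewrite mulr_gt0.
have h := @markov_indicator R _ Omega P (g T) (2 * c) (away T) (ltW cc) mA
  (g_mfun (leqnn T)) (fun w hw => ltW (hw T (leqnn T))).
have := le_trans h (decay (leqnn T)) => {}h.
have fP : P (away T) \is a fin_num by exact: fin_num_measure.
move: h; rewrite -(fineK fP) -EFinM !lee_fin => h.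
rewrite -(ler_pM2l cc); apply: (le_trans h); apply: (le_trans hT).
by rewrite ler_wpM2r //; lra.
Qed.

End contracting_drift.

(** * Accuracy of the best iterate *)

Lemma ler_of_slope {R : realType} (a q c : R) : 0 <= q ->
  (forall e, 0 < e -> a - e * q <= c) -> a <= c.
Proof.
move=> q0 h; rewrite leNgt; apply/negP => ca.
have q1 : 0 < q + 1 by rewrite ltr_wpDl.
have ac : 0 < a - c by rewrite subr_gt0.
have := h ((a - c) / (q + 1)); rewrite divr_gt0 // => /(_ isT).
apply/negP; rewrite -ltNge ltrBrDr -ltrBrDl mulrAC ltr_pdivrMr //.
by rewrite ltr_pM2l // ltrDl.
Qed.

(** The bound holds for every radius above the infimum, hence for the infimum. *)
Lemma quadratic_lower_exact {R : realType} {d : nat} (f : 'rV[R]_d -> R)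
    (xstar : 'rV[R]_d) (alpha beta : R) x :
  sc_deviation f xstar alpha = beta%:E ->
  (alpha - beta) / 2 * enorm (x - xstar) ^+ 2 <= f x - f xstar.
Proof.
move=> hb; apply: (@ler_of_slope _ _ (enorm (x - xstar) ^+ 2 / 2)).
  by rewrite divr_ge0 ?sqr_ge0.
move=> e e0; have hlt : (sc_deviation f xstar alpha < (beta + e)%:E)%E.
  by rewrite hb lte_fin ltrDl.
by have := quadratic_lower x hlt; lra.
Qed.

Section best_iterate.
Context {R : realType} {d : nat} (f : 'rV[R]_d -> R) (xstar : 'rV[R]_d) (L eta : R).
Hypotheses (L0 : 0 < L) (eta0 : 0 < eta) (eL1 : 0 < 1 - eta * L).
Hypothesis f_grad : forall x, enorm (grad f x) <= L * enorm (x - xstar).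

Lemma gradient_step_dist z :
  (1 - eta * L) * enorm (z - xstar) <= enorm (gradient_step f eta z - xstar)
  <= (1 + eta * L) * enorm (z - xstar).
Proof.
have gz := ler_wpM2l (ltW eta0) (f_grad z); rewrite mulrA in gz.
rewrite -{1}(gtr0_norm eta0) -enormZ in gz.
have e1 : gradient_step f eta z - xstar = (z - xstar) + - (eta *: grad f z).
  by rewrite /gradient_step addrAC.
have e2 : z - xstar = (gradient_step f eta z - xstar) + eta *: grad f z.
  by rewrite e1 subrK.
have := ler_enormD (z - xstar) (- (eta *: grad f z)); rewrite -e1 enormN.
have := ler_enormD (gradient_step f eta z - xstar) (eta *: grad f z); rewrite -e2.
by move=> h1 h2; apply/andP; split; rewrite ?mulrBl ?mulrDl mul1r; lra.
Qed.

(** A point at which [f] is no larger than at [x] inherits the accuracy of [x]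
    up to the condition number: the function values compare through the
    quadratic upper bound at [x], and the quadratic lower bound turns the gap at
    [z] back into a distance. *)
Lemma accuracy_of_lower_value (alpha beta c : R) x z :
  C1 f -> sc_deviation f xstar alpha = beta%:E -> beta < alpha ->
  f z <= f x -> enorm (gradient_step f eta x - xstar) ^+ 2 <= c ->
  [/\ f z - f xstar <= L * c / 2 / (1 - eta * L) ^+ 2,
      enorm (z - xstar) ^+ 2 <= L * c / ((1 - eta * L) ^+ 2 * (alpha - beta))
    & enorm (gradient_step f eta z - xstar) ^+ 2 <=
        ((1 + eta * L) / (1 - eta * L)) ^+ 2 * (L * c / (alpha - beta))].
Proof.
move=> f_C1 betaE beta_lt fzx hc.
have ab : 0 < alpha - beta by rewrite subr_gt0.
have eL0 : 0 < 1 + eta * L by rewrite addr_gt0 // mulr_gt0.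
have xt : (1 - eta * L) ^+ 2 * enorm (x - xstar) ^+ 2 <= c.
  apply: le_trans hc; rewrite -exprMn; have /andP[h _] := gradient_step_dist x.
  by apply: lerXn2r h; rewrite nnegrE ?enorm_ge0 // mulr_ge0 ?enorm_ge0 // ltW.
have fs : f z - f xstar <= L * c / 2 / (1 - eta * L) ^+ 2.
  have h := quadratic_upper x (proj1 f_C1) f_grad.
  apply: (@le_trans _ _ (L / 2 * enorm (x - xstar) ^+ 2)); first by lra.
  rewrite ler_pdivlMr ?exprn_gt0 // -mulrA [_ * (1 - _) ^+ 2]mulrC.
  have := ler_wpM2l (ltW L0) xt; lra.
have zs : enorm (z - xstar) ^+ 2 <= L * c / ((1 - eta * L) ^+ 2 * (alpha - beta)).
  have h := le_trans (quadratic_lower_exact z betaE) fs.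
  by rewrite invfM mulrA ler_pdivlMr //; lra.
split=> //; have /andP[_ h] := gradient_step_dist z.
have hy : enorm (gradient_step f eta z - xstar) ^+ 2 <=
    (1 + eta * L) ^+ 2 * enorm (z - xstar) ^+ 2.
  rewrite -exprMn; apply: lerXn2r h; rewrite ?nnegrE ?enorm_ge0 //.
  by rewrite mulr_ge0 ?enorm_ge0 // ltW.
apply: le_trans hy _.
have := ler_wpM2l (sqr_ge0 (1 + eta * L)) zs => /le_trans; apply.
rewrite le_eqVlt; apply/orP; left; apply/eqP; field.
by rewrite !gt_eqF.
Qed.

End best_iterate.

(** The output index is random, but it takes finitely many values. *)
Lemma measurable_at_index {dO} {Omega : measurableType dO} (k : Omega -> nat) (T : nat)
    (Q : nat -> set Omega) : measurable_fun setT k -> (forall w, (k w <= T)%N) ->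
  (forall j, (j <= T)%N -> measurable (Q j)) -> measurable [set w | Q (k w) w].
Proof.
move=> mk kT mQ.
have -> : [set w | Q (k w) w] = \bigcup_(j in `I_T.+1) (k @^-1` [set j] `&` Q j).
  apply/seteqP; split=> w /=; first by move=> hw; exists (k w) => //=; rewrite ltnS.
  by case=> j _ [/= <-].
apply: bigcup_measurable => j jT; apply: measurableI; last exact: mQ.
by rewrite -[Z in measurable Z]setTI; exact: mk.
Qed.

(** * Convergence *)

Theorem theorem4p1
  (R : realType) (d : nat) (d_gt0 : (0 < d)%N)
  (alpha L : R) (alpha_gt0 : 0 < alpha) (alpha_le_L : alpha <= L)
  (f : 'rV[R]_d -> R) (f_nc : nearly_convex alpha L f)
  (xstar : 'rV[R]_d) (xstar_min : global_minimizer f xstar)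
  (dS : measure_display) (S : measurableType dS) (mu : probability S R)
  (SG : 'rV[R]_d -> S -> 'rV[R]_d) (r : R) (r_ge0 : 0 <= r)
  (SG_oracle : unbiased_oracle mu SG f r)
  (eta lambda s flb b : R)
  (etaE : eta = 2 * alpha / (5 * L ^+ 2))
  (lambdaE : lambda = 2 * alpha - eta * L ^+ 2)
  (sE : s = lambda / (3 * L))
  (flb_le : flb <= f xstar)
  (bE : b = eta * r ^+ 2 / (2 * alpha - eta * L ^+ 2)
          + (5 * eta * (2 * alpha - eta * L ^+ 2) + 14) / (42 * L)
            * (f xstar - flb))
  (x0 : 'rV[R]_d) (T : nat)
  (dO : measure_display) (Omega : measurableType dO) (P : probability Omega R)
  (u : nat -> Omega -> S) (xi : nat -> Omega -> 'rV[R]_d)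
  (run : gnd_randomness P u xi mu T) :
  let x (t : nat) (w : Omega) : 'rV[R]_d := gnd f SG eta s flb x0 (u ^~ w) (xi ^~ w) t in
  let y (t : nat) (w : Omega) : 'rV[R]_d := x t w - eta *: grad f (x t w) in
  let y0 : 'rV[R]_d := x0 - eta *: grad f x0 in
  let tstar (w : Omega) : nat := first_argmin (fun t => f (x t w)) T in
  [/\ 0 < lambda,
      0 <= b,
      forall t, (t <= T)%N ->
        ('E_P[fun w => (enorm (y t w - xstar) ^+ 2)%R] <=
           ((1 - eta * lambda / 100) ^+ t * enorm (y0 - xstar) ^+ 2
            + 100 * b)%:E)%E,
      b = 0 -> forall eps zeta : R, 0 < eps -> 0 < zeta < 1 ->
        100 / (eta * (2 * alpha - eta * L ^+ 2))
          * ln (enorm (y0 - xstar) ^+ 2 / (zeta * eps)) <= T%:R ->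
        ((1 - zeta)%:E <=
           P [set w | (enorm (y T w - xstar) ^+ 2 <= eps)%R])%E
    & 0 < b -> forall zeta : R, 0 < zeta < 1 ->
        200 / (eta * (2 * alpha - eta * L ^+ 2))
          * ln (enorm (y0 - xstar) ^+ 2 / (100 * b * zeta)) <= T%:R ->
        ((1 - zeta)%:E <=
           P [set w | exists t, (t <= T)%N /\
                        (enorm (y t w - xstar) ^+ 2 <= 200 * b)%R])%E /\
        exists beta : R,
          [/\ sc_deviation f xstar alpha = beta%:E,
              beta < alpha
            & ((1 - zeta)%:E <=
                 P [set w |
                      [/\ (f (x (tstar w) w) - f xstar
                            <= 100 * L * b / (1 - eta * L) ^+ 2)%R,
                          (enorm (x (tstar w) w - xstar) ^+ 2
                            <= 200 * L * b
                               / ((1 - eta * L) ^+ 2 * (alpha - beta)))%R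
                        & (enorm (y (tstar w) w - xstar) ^+ 2
                            <= ((1 + eta * L) / (1 - eta * L)) ^+ 2
                               * (200 * L * b / (alpha - beta)))%R]])%E]].
Proof.
move=> x y y0 tstar.
case: f_nc => f_C1 [xs [[_ xs_uniq]]].
rewrite -(xs_uniq xstar xstar_min) => f_grad f_dev.
have L0 : 0 < L by exact: lt_le_trans alpha_le_L.
have lamE := lambda_alpha alpha_gt0 alpha_le_L etaE lambdaE.
have elE := eta_lambda alpha_gt0 alpha_le_L etaE lambdaE.
have eta0 : 0 < eta := eta_gt0 alpha_gt0 alpha_le_L etaE.
have lam0 : 0 < lambda by rewrite lamE mulr_gt0.
have el0 : 0 < eta * lambda by exact: mulr_gt0.
have k0 : 0 <= alpha / L by rewrite divr_ge0 // ltW.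
have k1 : alpha / L <= 1 by rewrite ler_pdivrMr // mul1r.
have kk1 : (alpha / L) ^+ 2 <= 1 by rewrite exprn_ile1.
have etaL : eta * L = 2 / 5 * (alpha / L) by rewrite etaE; field; rewrite gt_eqF.
have {}bE : b = eta * r ^+ 2 / lambda + (5 * eta * lambda + 14) / (42 * L) * (f xstar - flb).
  by rewrite lambdaE.
have b0 : 0 <= b.
  rewrite bE; apply: addr_ge0.
    by apply: divr_ge0; [apply: mulr_ge0; [exact: ltW|exact: sqr_ge0]|exact: ltW].
  apply: mulr_ge0; last by rewrite subr_ge0.
  apply: divr_ge0; first by rewrite -mulrA; lra.
  by rewrite mulr_ge0 // ltW.
rewrite -lambdaE.
(* the drift of the squared distances has rate eta * lambda / 100 and level 100 * b *)
pose rate := eta * lambda / 100.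
have rate0 : 0 < rate by rewrite /rate; lra.
have rate1 : rate <= 1 by rewrite /rate elE; lra.
have c0 : 0 <= 100 * b by rewrite mulr_ge0.
pose g t w := enorm (gradient_step f eta (x t w) - xstar) ^+ 2.
pose v0 := enorm (y0 - xstar) ^+ 2.
have v00 : 0 <= v0 by exact: sqr_ge0.
have Fm t (tT : (t <= T)%N) : past u xi t `<=` measurable := past_measurable run tT.
have FT t : past u xi t setT by exact: (@measurableT _ (g_sigma_algebraType (past_generators u xi t))).
have FI t A B : past u xi t A -> past u xi t B -> past u xi t (A `&` B).
  exact: (@measurableI _ (g_sigma_algebraType (past_generators u xi t))).
have g0 t w : 0 <= g t w by exact: sqr_ge0.
have mV := measurable_sqr_dist xstar f_C1 eta.
have mx t : measurable_fun (setT : set (g_sigma_algebraType (past_generators u xi t))) (x t).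
  exact: (past_measurable_iterate (mu := mu) SG_oracle f_C1).
have mxT t : (t <= T)%N -> measurable_fun setT (x t).
  exact: (measurable_iterate run SG_oracle f_C1).
have gm t : (t <= T)%N -> measurable_fun setT (g t).
  by move=> tT; exact: (measurableT_comp mV (mxT t tT)).
have ga t a : (t <= T)%N -> past u xi t [set w | a < g t w].
  move=> _; have mg : measurable_fun (setT : set (g_sigma_algebraType (past_generators u xi t))) (g t).
    exact: (measurableT_comp mV (mx t)).
  rewrite (_ : [set w | _] = g t @^-1` `]a, +oo[).
    rewrite -[Z in past _ _ _ Z]setTI; exact: mg.
  by apply/seteqP; split=> w /=; rewrite in_itv /= andbT.
have drift t A : (t < T)%N -> past u xi t A ->
    (\int[P]_w (\1_A w * g t.+1 w)%:E <=
     \int[P]_w (\1_A w * ((1 - rate) * g t w + rate * (100 * b)))%:E)%E.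
  move=> tT hA; have -> : rate * (100 * b) = eta * lambda * b by rewrite /rate; field.
  exact: (conditional_step run SG_oracle d_gt0 alpha_gt0 alpha_le_L f_C1 f_grad f_dev
    etaE lambdaE sE flb_le bE).
have expect := drift_expectation rate0 rate1 c0 FT g0 gm (fun=> erefl v0) drift.
split=> //.
- by move=> t tT; rewrite unlock; exact: expect.
- move=> bz eps zeta eps0 /andP[z0 z1] hT.
  have pz : 0 < zeta * eps by exact: mulr_gt0.
  have hT' : rate^-1 * ln (v0 / (zeta * eps)) <= T%:R by rewrite /rate invf_div.
  have vT := geometric_decay_le rate0 rate1 v00 pz hT'.
  apply: (markov_le_event eps0 (g0 T) (gm T (leqnn T))).
  apply: le_trans (expect T (leqnn T)) _.
  by rewrite lee_fin bz mulr0 addr0.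
move=> bp zeta /andP[z0 z1] hT.
have cp : 0 < 100 * b by rewrite mulr_gt0.
have pz : 0 < 100 * b * zeta by exact: mulr_gt0.
have hT' : (rate / 2)^-1 * ln (v0 / (100 * b * zeta)) <= T%:R.
  by move: hT; rewrite (_ : (rate / 2)^-1 = 200 / (eta * lambda)) // /rate; field; rewrite !gt_eqF.
have rate2 : 0 < rate / 2 by rewrite divr_gt0.
have rate21 : rate / 2 <= 1 by move: rate0 rate1; clear; lra.
have vT := geometric_decay_le rate2 rate21 v00 pz hT'.
have [mE hE] := drift_hitting rate0 rate1 c0 Fm FI (@past_subS _ _ _ _ _ _ u xi) g0 gm ga
  (fun=> erefl v0) drift cp vT (ltW z0).
have cE : 2 * (100 * b) = 200 * b by ring.
rewrite cE in mE hE.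
split; first exact: hE.
have [beta betaE beta_le] := sc_deviation_fin_num d_gt0 f_dev.
have beta_lt : beta < alpha.
  apply: le_lt_trans beta_le _.
  have : Num.sqrt (alpha ^+ 5 / (d%:R * L ^+ 3)) <= alpha.
    apply: le_of_sqr_le; first exact: ltW.
    have dL : 0 < d%:R * L ^+ 3 by rewrite mulr_gt0 ?ltr0n // exprn_gt0.
    rewrite sqr_sqrtr; last by rewrite divr_ge0 ?exprn_ge0 // ltW.
    rewrite ler_pdivrMr // (exprD _ 2 3) ler_wpM2l ?sqr_ge0 //.
    apply: (@le_trans _ _ (L ^+ 3)); first by rewrite lerXn2r ?nnegrE // ltW.
    by rewrite ler_peMl ?exprn_ge0 ?ler1n // ltW.
  by move: alpha_gt0; clear; lra.
exists beta; split=> //.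
set E2 := [set w | [/\ _, _ & _]].
have eL1 : 0 < 1 - eta * L by rewrite etaL; move: k1; clear; lra.
have e100 : L * (200 * b) / 2 = 100 * L * b by field.
have e200 : L * (200 * b) = 200 * L * b by rewrite mulrCA mulrA.
have sub : [set w | exists t, (t <= T)%N /\ g t w <= 200 * b] `<=` E2.
  move=> w [t [tT ht]].
  have [_ /(_ t tT) fmin] := first_argminP (fun t => f (x t w)) T.
  have := accuracy_of_lower_value L0 eta0 eL1 f_grad f_C1 betaE beta_lt fmin ht.
  by rewrite e100 e200.
apply: le_trans hE _; apply: le_measure; rewrite ?inE //.
pose Q k := [set w | [/\ f (x k w) - f xstar <= 100 * L * b / (1 - eta * L) ^+ 2,
   enorm (x k w - xstar) ^+ 2 <= 200 * L * b / ((1 - eta * L) ^+ 2 * (alpha - beta)) &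
   enorm (y k w - xstar) ^+ 2 <=
     ((1 + eta * L) / (1 - eta * L)) ^+ 2 * (200 * L * b / (alpha - beta))]].
have mf : measurable_fun setT f.
  by apply: continuous_measurable_rV; apply: differentiable_continuousT; case: f_C1.
have mle (h : Omega -> R) (a : R) : measurable_fun setT h -> measurable [set w | h w <= a].
  move=> mh; rewrite (_ : [set w | _] = setT `&` h @^-1` `]-oo, a]); first exact: mh.
  by rewrite setTI; apply/seteqP; split=> w /=; rewrite in_itv.
have mQ k : (k <= T)%N -> measurable (Q k).
  move=> kT.
  rewrite (_ : Q k = [set w | f (x k w) - f xstar <= 100 * L * b / (1 - eta * L) ^+ 2] `&`
     ([set w | enorm (x k w - xstar) ^+ 2 <= 200 * L * b / ((1 - eta * L) ^+ 2 * (alpha - beta))] `&`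
     [set w | g k w <=
     ((1 + eta * L) / (1 - eta * L)) ^+ 2 * (200 * L * b / (alpha - beta))])).
    apply: measurableI; [|apply: measurableI]; apply: mle.
    - by apply: measurable_funB => //; exact: (measurableT_comp mf (mxT k kT)).
    - under eq_fun do rewrite enorm_sqr.
      by apply: measurable_dotv; apply: measurable_rVB => //; exact: mxT.
    - exact: gm.
  by apply/seteqP; split=> w /=; [case|case=> ? []].
have mt : measurable_fun setT tstar.
  apply: measurable_first_argmin => k kT; exact: (measurableT_comp mf (mxT k kT)).
exact: (measurable_at_index mt (fun w => proj1 (first_argminP (fun t => f (x t w)) T)) mQ).
Qed.
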